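(* Let $a_+>0$ be fixed. Then $$\lim_{a_-\downarrow0}g_R\big(a_+,a_-;z+\lambda s(a_+,a_-)\big)=\begin{cases}\dfrac{a_+}{2\pi}e^{-2\pi z/a_+},&\lambda=1,\\[2mm]0,&\lambda>1,\end{cases}$$ and $$\lim_{a_-\downarrow0}g_L\big(a_+,a_-;z-\lambda s(a_+,a_-)\big)=\begin{cases}-\dfrac{a_+}{2\pi}e^{2\pi z/a_+},&\lambda=1,\\[2mm]0,&\lambda>1,\end{cases}$$ where $$s(a_+,a_-)=\frac{a_+}{2\pi}\ln\frac{1}{a_-},$$ and the limits hold uniformly for $z$ varying over arbitrary compact subsets of $\mathbb{C}$.
   Context: For $a_+,a_->0$ put $a=(a_++a_-)/2$, $\alpha=2\pi/(a_+a_-)$, $\chi=\frac{\pi}{24}\left(\frac{a_+}{a_-}+\frac{a_-}{a_+}\right)$, and $$g(a_+,a_-;z)=\int_0^\infty\frac{dt}{t}\left(\frac{\sin 2tz}{2\sinh(a_+t)\sinh(a_-t)}-\frac{z}{a_+a_-t}\right),\qquad |\mathrm{Im}\,z|<a.$$ The function $G=\exp(ig)$ (hyperbolic gamma function) extends to a meromorphic function on $\mathbb{C}$ whose poles and zeros all lie on $\pm i[a,\infty)$, and correspondingly $g$ extends holomorphically to the cut plane $\mathbb{C}\setminus\big(i[a,\infty)\cup -i[a,\infty)\big)$. Define $g_R=g+\chi+\alpha z^2/4$ and $g_L=g-\chi-\alpha z^2/4$. (For $z$ in a fixed compact set and $\lambda\ge1$, the points $z\pm\lambda s(a_+,a_-)$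 belong to the cut plane for $a_-$ small enough.) *)

(* Defs.v *)
From HB Require Import structures.
From mathcomp Require Import all_boot all_order all_algebra.
From mathcomp Require Import all_classical all_reals all_analysis.
From mathcomp Require Import complex.

Set Implicit Arguments.
Unset Strict Implicit.
Unset Printing Implicit Defensive.

Import Order.TTheory GRing.Theory Num.Theory.
Import numFieldTopology.Exports numFieldNormedType.Exports.

Local Open Scope classical_set_scope.
Local Open Scope ring_scope.
Local Open Scope complex_scope.

(* The topology, uniformity and normed module structure (over R[i] itself) of
   the complex plane are the library ones, attached to the regular module
   R[i]^o; this is why all complex functions below are typed with R[i]^o. *)
Section HyperbolicGamma.
Variable R : realType.
Local Notation C := (R[i]^o).

Definition rsinh (t : R) : R := (expR t - expR (- t)) / 2.

Definition cexp (z : C) : C :=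
  (expR (complex.Re z))%:C * (cos (complex.Im z) +i* sin (complex.Im z)).

Definition csin (z : C) : C :=
  (cexp ((0 +i* 1) * z) - cexp (- ((0 +i* 1) * z))) / (2 * (0 +i* 1)).

(* Derivability over the field R[i], i.e. existence of the complex
   derivative at every point of D; used for open D only. *)
Definition holomorphic_on (D : set C) (f : C -> C) : Prop :=
  forall z : C, D z -> derivable f z 1.

(* Lebesgue integral of a complex-valued function of a real variable. *)
Definition cintegral (D : set R) (f : R -> C) : C :=
  (\int[lebesgue_measure]_(t in D) complex.Re (f t)) +i*
  (\int[lebesgue_measure]_(t in D) complex.Im (f t)).

Section Periods.
Variables ap am : R.

Definition a_ : R := (ap + am) / 2.
Definition alpha_ : R := 2 * pi / (ap * am).
Definition chi_ : R := pi / 24 * (ap / am + am / ap).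
Definition s_ : R := ap / (2 * pi) * ln (1 / am).

Definition g_integrand (z : C) (t : R) : C :=
  (t^-1)%:C * (csin (2 * t%:C * z) / (2 * rsinh (ap * t) * rsinh (am * t))%:C
               - z / (ap * am * t)%:C).

(* For |Im z| < a_ the integrand is absolutely integrable on ]0, +oo[ (it is
   bounded near 0 and O(t^-2) at infinity), so the improper integral is this
   Lebesgue integral. *)
Definition g_strip (z : C) : C := cintegral `]0, +oo[ (g_integrand z).

(* Complement of the two half-lines i[a, oo) and -i[a, oo). *)
Definition cut_plane : set C :=
  [set z | ~ (complex.Re z = 0 /\ a_ <= `|complex.Im z|)].

(* g is the holomorphic extension of g_strip to the cut plane.  The cut plane
   is open and connected, so g is determined there; its values on the cuts
   are left unconstrained. *)
Definition is_g (g : C -> C) : Prop :=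
  (forall z : C, `|complex.Im z| < a_ -> g z = g_strip z) /\
  holomorphic_on cut_plane g.

Definition g_R (g : C -> C) (z : C) : C :=
  g z + chi_%:C + alpha_%:C * z ^+ 2 / 4.

Definition g_L (g : C -> C) (z : C) : C :=
  g z - chi_%:C - alpha_%:C * z ^+ 2 / 4.

End Periods.
End HyperbolicGamma.

(* Main.v *)
Require Import Defs.
From mathcomp Require Import all_boot all_order all_algebra.
From mathcomp Require Import all_classical all_reals all_analysis.
From mathcomp Require Import complex measurable_realfun.
From mathcomp Require Import ring lra.

Set Implicit Arguments.
Unset Strict Implicit.
Unset Printing Implicit Defensive.

Import Order.TTheory GRing.Theory Num.Theory.
Import numFieldTopology.Exports numFieldNormedType.Exports.

Local Open Scope classical_set_scope.
Local Open Scope ring_scope.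
Local Open Scope complex_scope.

(** Put b = pi / (2 ap) and F_z(t) = exp (2 i t z) / (t sinh (ap t) sinh (am t)).
    For Re z > 0 and am <= ap / 2 the function g_R has the closed form
<<
  g_R z = exp (- 2 pi z / ap) / (2 sin (pi am / ap)) + (4 i)^-1 S z
>>
    ([right_formula]), where S z ([staple]) is the integral of F_z along the
    contour that comes down the line Re t = - b to the height 3 b, crosses to
    Re t = b and goes up again. Both limits are read off from it. As
    exp (- 2 pi s / ap) = am, the first term at z + lam s is
    exp (- 2 pi z / ap) am^lam / (2 sin (pi am / ap)), with the limit of the
    statement. The contour lies above the height 3 b, where the exponential
    contributes a factor exp (- 6 b lam s) = am^(3 lam / 2), against a factor
    O(1 / am) from sinh (am t); hence S tends to 0 ([right_formula_limit]).

    In the half-strip Re z > 0, |Im z| < a, the integrand of g is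
    (4 i)^-1 (F_z(t) + F_z(- t)) - z / (ap am t^2). Beyond b, Cauchy's theorem
    turns the half-line [b, oo) into the vertical half-line above b, and the
    reflection t |-> - conj t gives the other half of the contour
    ([rotate_ray], [gker_refl]). Before b, the principal part of F_z at 0 is
    subtracted, and the segment [- b, b] is replaced by the three other sides of
    the half-square [- b, b] x [0, b] ([gker_laurent0], [goursat_but_one]); the
    principal part accounts for chi, alpha z^2 / 4 and the tail of z / t^2
    ([strip_formula_low]). Lifting the crossing from height b to 3 b passes the
    pole i pi / ap, whose residue is the leading exponential ([strip_formula]).
    Both sides are holomorphic on Re z > 0, so the identity theorem
    ([vanishing_near]) carries the formula beyond the strip.

    The statement on g_L is the one on g_R for z |-> - g (- z), which extends the
    same integral because the integrand is odd in z. *)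

(** * The complex plane with a real modulus *)

Ltac split_ReIm :=
  apply/eqP; rewrite eq_complex /=; apply/andP; split; apply/eqP.

Section ComplexPlane.
Variable R : realType.
Local Notation C := (R[i]^o).
Implicit Types (x y r : R) (z w : C) (f : C -> C).

(** The norm of the library on R[i] takes its values in R[i]; estimates are
    made with its real value. *)
Definition nrm (z : C) : R := Num.sqrt (complex.Re z ^+ 2 + complex.Im z ^+ 2).

Lemma nrmE z : `|z| = (nrm z)%:C.
Proof. by rewrite /nrm normc_def. Qed.

Lemma nrm_ge0 z : 0 <= nrm z. Proof. exact: sqrtr_ge0. Qed.

Lemma nrmM z w : nrm (z * w) = nrm z * nrm w.
Proof. by apply: complexI; rewrite rmorphM /= -!nrmE normrM. Qed.

Lemma nrmV z : nrm (z^-1) = (nrm z)^-1.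
Proof. by apply: complexI; rewrite fmorphV /= -!nrmE normfV. Qed.

Lemma nrmN z : nrm (- z) = nrm z.
Proof. by apply: complexI; rewrite -!nrmE normrN. Qed.

Lemma nrmBC z w : nrm (z - w) = nrm (w - z).
Proof. by rewrite -nrmN opprB. Qed.

Lemma nrmX z n : nrm (z ^+ n) = nrm z ^+ n.
Proof. by apply: complexI; rewrite rmorphXn /= -!nrmE normrX. Qed.

Lemma nrmD z w : nrm (z + w) <= nrm z + nrm w.
Proof. by rewrite -lecR rmorphD /= -!nrmE ler_normD. Qed.

Lemma nrmB z w : nrm (z - w) <= nrm z + nrm w.
Proof. by rewrite -(nrmN w) nrmD. Qed.

Lemma nrm0 : nrm 0 = 0.
Proof. by apply: complexI; rewrite -nrmE normr0. Qed.

Lemma nrm1 : nrm 1 = 1.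
Proof. by apply: complexI; rewrite -nrmE normr1. Qed.

Lemma nrm_eq0 z : (nrm z == 0) = (z == 0).
Proof.
rewrite -(normr_eq0 z) nrmE; apply/eqP/eqP => [->//|].
by move/complexI.
Qed.

Lemma nrm_gt0 z : (0 < nrm z) = (z != 0).
Proof. by rewrite lt_def nrm_ge0 andbT nrm_eq0. Qed.

Lemma nrmR x : nrm x%:C = `|x|.
Proof. by rewrite /nrm /= expr0n addr0 sqrtr_sqr. Qed.

Lemma nrm_nat n : nrm (n%:R : C) = n%:R.
Proof. by apply: complexI; rewrite -nrmE normr_nat rmorph_nat. Qed.

Lemma nrmJ z : nrm (z^*)%C = nrm z.
Proof. by case: z => a b; rewrite /nrm /= sqrrN. Qed.

Lemma nrm_i : nrm ('i%C) = 1.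
Proof. by rewrite /nrm /= expr0n expr1n add0r sqrtr1. Qed.

Lemma sqr_nrm z : nrm z ^+ 2 = complex.Re z ^+ 2 + complex.Im z ^+ 2.
Proof. by rewrite /nrm sqr_sqrtr // addr_ge0 // sqr_ge0. Qed.

Lemma ler_Re_nrm z : `|complex.Re z| <= nrm z.
Proof.
rewrite -(@ler_pXn2r _ 2) ?nnegrE ?nrm_ge0 // sqr_nrm real_normK ?num_real//.
by rewrite lerDl sqr_ge0.
Qed.

Lemma ler_Im_nrm z : `|complex.Im z| <= nrm z.
Proof.
rewrite -(@ler_pXn2r _ 2) ?nnegrE ?nrm_ge0 // sqr_nrm real_normK ?num_real//.
by rewrite lerDr sqr_ge0.
Qed.

Lemma nrm_le z : nrm z <= `|complex.Re z| + `|complex.Im z|.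
Proof.
rewrite -(@ler_pXn2r _ 2) ?nnegrE ?nrm_ge0 ?addr_ge0 // sqr_nrm sqrrD.
rewrite !real_normK ?num_real// -addrA lerD2l lerDr mulrn_wge0 //.
Qed.

Lemma distnrm z w : nrm z - nrm w <= nrm (z - w).
Proof. by rewrite lerBlDr; apply: le_trans (nrmD _ _); rewrite subrK. Qed.

Lemma scaleCE (a : R[i]) (b : C) : a *: b = a * b :> C.
Proof. by []. Qed.

Lemma near_nrmP (z : C) (P : C -> Prop) :
  (\forall w \near z, P w) <->
  exists2 d : R, 0 < d & forall w, nrm (w - z) < d -> P w.
Proof.
split.
- move=> /nbhs_ballP[e /= e0 h].
  move: (e0); rewrite ltcE /= => /andP[/eqP ei er].
  exists (complex.Re e) => // w wz; apply: h.
  rewrite -ball_normE /ball_ /= distrC nrmE ltcE /= ei eqxx /=.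
  exact: wz.
- move=> [d d0 h]; apply/nbhs_ballP; exists d%:C => /=; first by rewrite ltcR.
  move=> w; rewrite -ball_normE /ball_ /= distrC nrmE ltcR; exact: h.
Qed.

Lemma continuousCP f z : {for z, continuous f} <->
  forall e : R, 0 < e -> exists2 d : R, 0 < d &
    forall w, nrm (w - z) < d -> nrm (f w - f z) < e.
Proof.
split.
- move=> /cvgrPdist_lt h e e0.
  have := h e%:C; rewrite ltcR => /(_ e0) /near_nrmP[d d0 {}h].
  by exists d => // w /h; rewrite nrmE ltcR nrmBC.
- move=> h.
  apply: (proj2 (@cvgrPdist_lt R[i] C C (nbhs z) _ f (f z))) => e.
  rewrite ltcE /= => /andP[/eqP ei er].
  apply/near_nrmP; have [d d0 {}h] := h _ er; exists d => // w /h.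
  by rewrite nrmE ltcE /= ei eqxx /= nrmBC.
Qed.

(** The form without division is the one that estimates produce. *)
Lemma is_deriveCP f z (d : C) : is_derive z 1 f d <->
  forall e : R, 0 < e -> exists2 r : R, 0 < r &
    forall w, nrm (w - z) < r -> nrm (f w - f z - d * (w - z)) <= e * nrm (w - z).
Proof.
split.
- move=> hd; have dfz : derivable f z 1 by [].
  have hdf : 'D_1 f z = d by rewrite derive_val.
  move=> e e0.
  have : h^-1 *: (f (h *: 1 + z) - f z) @[h --> (0:C)^'] --> (d : C).
    by rewrite -hdf; exact: dfz.
  move=> /cvgrPdist_lt /(_ e%:C); rewrite ltcR => /(_ e0).
  rewrite near_withinE => /(@near_nrmP (0 : C))[r r0 h].
  exists r => // w wz; have [->|wnz] := eqVneq w z.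
    by rewrite !subrr mulr0 subr0 nrm0 mulr0.
  have := h (w - z); rewrite subr0 => /(_ wz).
  rewrite subr_eq0 => /(_ wnz); rewrite scaler1 /= subrK nrmE ltcR => hh.
  have wz0 : w - z != 0 by rewrite subr_eq0.
  have -> : f w - f z - d * (w - z) =
     - ((w - z) * (d - (w - z)^-1 *: (f w - f z))).
    by rewrite scaleCE; field.
  by rewrite nrmN nrmM mulrC ler_wpM2r ?nrm_ge0 // ltW.
- move=> h.
  have hc : h^-1 *: (f (h *: 1 + z) - f z) @[h --> (0:C)^'] --> (d : C).
    apply/cvgrPdist_lt => e; rewrite ltcE /= => /andP[/eqP ei er].
    rewrite near_withinE; apply/(@near_nrmP (0 : C)).
    have [|r r0 {}h] := h (complex.Re e / 2); first by rewrite divr_gt0.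
    exists r => // w; rewrite subr0 => wr w0.
    have := h (w + z); rewrite addrK => /(_ wr) hh.
    rewrite nrmE ltcE /= ei eqxx /=.
    rewrite scaler1 -nrmN opprB.
    have -> : (w^-1 *: (f (w + z) - f z) - d : C) =
       w^-1 * (f (w + z) - f z - d * w).
      by rewrite scaleCE; field.
    rewrite nrmM nrmV mulrC ltr_pdivrMr ?nrm_gt0 //.
    apply: le_lt_trans hh _; rewrite ltr_pM2r ?nrm_gt0 //.
    by rewrite ltr_pdivrMr // ltr_pMr // ltr1n.
  apply: DeriveDef; first by apply/cvg_ex; exists d.
  exact: cvg_lim hc.
Qed.

End ComplexPlane.

(** * Complex derivatives and their restriction to lines *)

Section Calculus.
Variable R : realType.
Local Notation C := (R[i]^o).
Implicit Types (f g : C -> C) (z : C).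

Lemma derivable_continuousC f z : derivable f z 1 -> {for z, continuous f}.
Proof. by move=> /derivable1_diffP hf; exact: differentiable_continuous. Qed.

Lemma derivable_compC f g z :
  derivable g z 1 -> derivable f (g z) 1 -> derivable (fun w => f (g w)) z 1.
Proof.
move=> /derivable1_diffP hg /derivable1_diffP hf; apply/derivable1_diffP.
exact: (differentiable_comp hg hf).
Qed.

Lemma derivableC_cst (k : C) z : derivable (fun=> k) z 1.
Proof. exact: derivable_cst. Qed.

Lemma derivableC_id z : derivable (fun w : C => w) z 1.
Proof. exact: derivable_id. Qed.

Lemma derivableCD f g z : derivable f z 1 -> derivable g z 1 ->
  derivable (fun w => f w + g w) z 1.
Proof. by move=> hf hg; exact: (derivableD hf hg). Qed.

Lemma derivableCB f g z : derivable f z 1 -> derivable g z 1 ->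
  derivable (fun w => f w - g w) z 1.
Proof. by move=> hf hg; exact: (derivableB hf hg). Qed.

Lemma derivableCN f z : derivable f z 1 -> derivable (fun w => - f w) z 1.
Proof. by move=> hf; exact: (derivableN hf). Qed.

Lemma derivableCM f g z : derivable f z 1 -> derivable g z 1 ->
  derivable (fun w => f w * g w) z 1.
Proof. by move=> hf hg; exact: (derivableM hf hg). Qed.

Lemma derivableCV f z : f z != 0 -> derivable f z 1 ->
  derivable (fun w => (f w)^-1) z 1.
Proof. by move=> fz hf; exact: (derivableV fz hf). Qed.

Lemma derivableCX f n z : derivable f z 1 -> derivable (fun w => f w ^+ n) z 1.
Proof.
move=> hf; elim: n => [|n IH].
  by under eq_fun do rewrite expr0; exact: derivableC_cst.
by under eq_fun do rewrite exprS; exact: derivableCM.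
Qed.

Lemma continuous_Re z : {for z, continuous (@complex.Re R : C -> R)}.
Proof.
apply: (proj2 (@cvgrPdist_lt _ _ _ (nbhs z) _ _ _)) => e e0.
apply/near_nrmP; exists e => // w wz.
rewrite -raddfB /=; apply: le_lt_trans wz.
by rewrite -nrmN opprB; exact: ler_Re_nrm.
Qed.

Lemma continuous_Im z : {for z, continuous (@complex.Im R : C -> R)}.
Proof.
apply: (proj2 (@cvgrPdist_lt _ _ _ (nbhs z) _ _ _)) => e e0.
apply/near_nrmP; exists e => // w wz.
rewrite -raddfB /=; apply: le_lt_trans wz.
by rewrite -nrmN opprB; exact: ler_Im_nrm.
Qed.

Lemma continuous_real_complex (t : R) :
  {for t, continuous (fun t : R => t%:C : C)}.
Proof.
apply: (proj2 (@cvgrPdist_lt _ _ _ (nbhs t) _ _ _)) => e.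
rewrite ltcE /= => /andP[/eqP ei er].
apply/nbhs_ballP; exists (complex.Re e) => // s.
rewrite /ball /= => ts.
by rewrite -rmorphB nrmE nrmR ltcE /= ei eqxx.
Qed.

Definition line (p v : C) (t : R) : C := p + t%:C * v.

Lemma continuous_line p v t : {for t, continuous (line p v)}.
Proof.
apply: (@continuousD R[i] C R (cst p) (fun t : R => t%:C * v)).
  exact: cvg_cst.
apply: (@continuousM R[i] R (fun t : R => t%:C : C) (cst v)).
  exact: continuous_real_complex.
exact: cvg_cst.
Qed.

Lemma continuous_on_line f p v (t : R) : {for line p v t, continuous f} ->
  {for t, continuous (fun t : R => f (line p v t))}.
Proof.
by move=> hf; exact: (@continuous_comp R C C (line p v) f t (@continuous_line p v t) hf).
Qed.

Lemma is_derive_on_line f p v (t : R) (d : C) : is_derive (line p v t) 1 f d ->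
  is_derive t 1 (fun t : R => complex.Re (f (line p v t))) (complex.Re (v * d)) /\
  is_derive t 1 (fun t : R => complex.Im (f (line p v t))) (complex.Im (v * d)).
Proof.
move=> /is_deriveCP hf.
have key (L : C -> R) : (forall z w, L (z - w) = L z - L w) ->
    (forall (a : R) z, L (a%:C * z) = a * L z) -> (forall z, `|L z| <= nrm z) ->
    is_derive t 1 (fun t : R => L (f (line p v t))) (L (v * d)).
  move=> LB LZ Ln.
  have hc : h^-1 *: (L (f (line p v (h *: 1 + t))) - L (f (line p v t)))
      @[h --> (0:R)^'] --> L (v * d).
    apply/cvgrPdist_lt => e0' e0; pose e : R := e0'.
    rewrite -[e0']/e in e0 *; move: e e0 => {e0'} e e0.
    have k0 : 0 < nrm v + 1 by rewrite ltr_wpDl ?nrm_ge0.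
    have [|r r0 {}hf] := hf (e / (nrm v + 1)); first by rewrite divr_gt0.
    near=> h0'; pose h : R := h0'; rewrite -[h0']/h.
    have h0 : h != 0 by rewrite /h; near: h0'; exact: nbhs_dnbhs_neq.
    have hr : `|h| < r / (nrm v + 1).
      rewrite /h; near: h0'; apply: dnbhs0_lt; by rewrite divr_gt0.
    have hE : line p v (h *: 1 + t) - line p v t = h%:C * v.
      by rewrite /line scaler1 rmorphD /=; ring.
    have := hf (line p v (h *: 1 + t)); rewrite hE nrmM nrmR.
    have hr' : `|h| * nrm v < r.
      apply: (@le_lt_trans _ _ (`|h| * (nrm v + 1))).
        by rewrite ler_wpM2l // lerDl.
      by rewrite -ltr_pdivlMr.
    move=> /(_ hr') hh.
    have -> : L (v * d) - h^-1 *: (L (f (line p v (h *: 1 + t))) - L (f (line p v t)))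
       = - (h^-1 * L (f (line p v (h *: 1 + t)) - f (line p v t) - d * (h%:C * v))).
      rewrite [h^-1 *: _]/GRing.scale /= [in RHS]LB.
      have -> : d * (h%:C * v) = h%:C * (v * d) by ring.
      by rewrite LZ LB; field.
    rewrite normrN normrM normfV.
    apply: (@le_lt_trans _ _ (`|h|^-1 * (e / (nrm v + 1) * (`|h| * nrm v)))).
      by rewrite ler_wpM2l ?invr_ge0 //; apply: le_trans hh; exact: Ln.
    have hn0 : `|h| != 0 by rewrite normr_eq0.
    have -> : `|h|^-1 * (e / (nrm v + 1) * (`|h| * nrm v)) =
      e * (nrm v / (nrm v + 1)).
      by field; rewrite hn0 (gt_eqF k0).
    by rewrite gtr_pMr // ltr_pdivrMr // mul1r ltrDl.
  apply: DeriveDef; first by apply/cvg_ex; exists (L (v * d)).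
  exact: cvg_lim hc.
split; apply: key => //.
- by move=> z w; rewrite raddfB.
- by move=> a [x y] /=; rewrite mul0r subr0.
- exact: ler_Re_nrm.
- by move=> z w; rewrite raddfB.
- by move=> a [x y] /=; rewrite mul0r addr0.
- exact: ler_Im_nrm.
Unshelve. all: by end_near. Qed.

End Calculus.

(** * Integrals of complex functions of a real variable *)

Section ComplexIntegral.
Variable R : realType.
Local Notation C := (R[i]^o).
Local Notation mu := (@lebesgue_measure R).
Implicit Types (D : set (measurableTypeR R)) (f g : R -> C).

Definition cintegrable (D : set R) f :=
  mu.-integrable D (EFin \o (fun t => complex.Re (f t))) /\
  mu.-integrable D (EFin \o (fun t => complex.Im (f t))).

Lemma eq_cintegral D f g : (forall t, D t -> f t = g t) ->
  cintegral D f = cintegral D g.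
Proof.
move=> fg; rewrite /cintegral; congr (_ +i* _);
  by apply: eq_Rintegral => t /set_mem/fg ->.
Qed.

Lemma eq_cintegrable D f g : measurable D -> (forall t, D t -> f t = g t) ->
  cintegrable D f -> cintegrable D g.
Proof.
move=> mD fg [h1 h2]; split.
  by apply: eq_integrable h1 => // t /set_mem/fg /= ->.
by apply: eq_integrable h2 => // t /set_mem/fg /= ->.
Qed.

Lemma cintegrableD D f g : measurable D -> cintegrable D f -> cintegrable D g ->
  cintegrable D (fun t => f t + g t).
Proof.
move=> mD [f1 f2] [g1 g2]; split.
  apply: eq_integrable (integrableD mD f1 g1) => // t _ /=.
  by case: (f t) (g t) => a b [c d].
apply: eq_integrable (integrableD mD f2 g2) => // t _ /=.
by case: (f t) (g t) => a b [c d].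
Qed.

Lemma cintegralD D f g : measurable D -> cintegrable D f -> cintegrable D g ->
  cintegral D (fun t => f t + g t) = cintegral D f + cintegral D g.
Proof.
move=> mD [f1 f2] [g1 g2]; rewrite /cintegral.
rewrite [RHS]/(_ +i* _ + _ +i* _) /=.
have -> : \int[mu]_(t in D) complex.Re (f t + g t) =
  \int[mu]_(t in D) (complex.Re (f t) + complex.Re (g t)).
  by apply: eq_Rintegral => t _; case: (f t) (g t) => a b [c d].
have -> : \int[mu]_(t in D) complex.Im (f t + g t) =
  \int[mu]_(t in D) (complex.Im (f t) + complex.Im (g t)).
  by apply: eq_Rintegral => t _; case: (f t) (g t) => a b [c d].
by rewrite !RintegralD.
Qed.

Lemma cintegrableZl D (c : C) f : measurable D -> cintegrable D f ->
  cintegrable D (fun t => c * f t).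
Proof.
move=> mD [f1 f2]; case: c => a b; split.
  have := integrableB mD (integrableZl mD a f1) (integrableZl mD b f2).
  by apply: eq_integrable => // t _ /=; case: (f t).
have := integrableD mD (integrableZl mD a f2) (integrableZl mD b f1).
by apply: eq_integrable => // t _ /=; case: (f t).
Qed.

Lemma cintegralZl D (c : C) f : measurable D -> cintegrable D f ->
  cintegral D (fun t => c * f t) = c * cintegral D f.
Proof.
move=> mD [f1 f2]; case: c => a b; rewrite /cintegral.
rewrite [RHS]/((_ +i* _) * (_ +i* _)) /=.
have -> : \int[mu]_(t in D) complex.Re ((a +i* b) * f t) =
  \int[mu]_(t in D) (a * complex.Re (f t) - b * complex.Im (f t)).
  by apply: eq_Rintegral => t _; case: (f t).
have -> : \int[mu]_(t in D) complex.Im ((a +i* b) * f t) =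
  \int[mu]_(t in D) (a * complex.Im (f t) + b * complex.Re (f t)).
  by apply: eq_Rintegral => t _; case: (f t).
have iZ (k : R) (h : R -> R) : mu.-integrable D (EFin \o h) ->
  mu.-integrable D (EFin \o (fun t => k * h t)).
  by move=> hh; apply: eq_integrable (integrableZl mD k hh).
rewrite (RintegralB mD (iZ a _ f1) (iZ b _ f2)).
by rewrite (RintegralD mD (iZ a _ f2) (iZ b _ f1)) !RintegralZl.
Qed.

Lemma cintegrableN D f : measurable D -> cintegrable D f ->
  cintegrable D (fun t => - f t).
Proof.
move=> mD hf; have := cintegrableZl (-1) mD hf.
by apply: eq_cintegrable => // t _; rewrite mulN1r.
Qed.

Lemma cintegralN D f : measurable D -> cintegrable D f ->
  cintegral D (fun t => - f t) = - cintegral D f.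
Proof.
move=> mD hf; rewrite -[RHS]mulN1r -cintegralZl //.
by apply: eq_cintegral => t _; rewrite mulN1r.
Qed.

Lemma cintegrableB D f g : measurable D -> cintegrable D f -> cintegrable D g ->
  cintegrable D (fun t => f t - g t).
Proof. by move=> mD hf hg; apply: cintegrableD => //; exact: cintegrableN. Qed.

Lemma cintegralB D f g : measurable D -> cintegrable D f -> cintegrable D g ->
  cintegral D (fun t => f t - g t) = cintegral D f - cintegral D g.
Proof.
move=> mD hf hg; rewrite cintegralD ?cintegralN //; exact: cintegrableN.
Qed.

Lemma cintegrableJ D f : measurable D -> cintegrable D f ->
  cintegrable D (fun t => (f t)^*%C).
Proof.
move=> mD [f1 f2]; split.
  by apply: eq_integrable f1 => // t _ /=; case: (f t).
by apply: eq_integrable (integrableN f2) => // t _ /=; case: (f t).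
Qed.

Lemma cintegralJ D f : measurable D -> cintegrable D f ->
  cintegral D (fun t => (f t)^*%C) = (cintegral D f)^*%C.
Proof.
move=> mD [f1 f2]; rewrite /cintegral /=.
have -> : \int[mu]_(t in D) complex.Re ((f t)^*%C) =
  \int[mu]_(t in D) complex.Re (f t).
  by apply: eq_Rintegral => t _; case: (f t).
have -> : \int[mu]_(t in D) complex.Im ((f t)^*%C) =
  \int[mu]_(t in D) (-1 * complex.Im (f t)).
  by apply: eq_Rintegral => t _; case: (f t) => a b /=; rewrite mulN1r.
by rewrite RintegralZl // mulN1r.
Qed.

(** The real case applies after a rotation of the integral onto the positive
    real axis. *)
Lemma cintegral_nrm_le D f (h : R -> R) : measurable D -> cintegrable D f ->
  mu.-integrable D (EFin \o h) -> (forall t, D t -> nrm (f t) <= h t) ->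
  nrm (cintegral D f) <= \int[mu]_(t in D) h t.
Proof.
move=> mD hf hh fh; set I := cintegral D f.
have [I0|I0] := eqVneq I 0.
  rewrite I0 nrm0; apply: Rintegral_ge0 => t Dt.
  by apply: le_trans (fh _ Dt); exact: nrm_ge0.
pose c : C := (I^*)%C / (nrm I)%:C.
have nI0 : nrm I != 0 by rewrite nrm_eq0.
have cI : c * I = (nrm I)%:C.
  rewrite /c mulrAC [_ * I]mulrC -sqr_normc nrmE expr2 mulfK //.
  by rewrite -(inj_eq (@complexI R)) in nI0.
have nc : nrm c = 1.
  by rewrite /c nrmM nrmV nrmJ nrmR ger0_norm ?nrm_ge0 // divff.
have := cintegralZl c mD hf; rewrite -/I cI => /(congr1 (@complex.Re R)) /= <-.
have [g1 _] := cintegrableZl c mD hf.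
apply: le_Rintegral => // t Dt; apply: le_trans (fh _ Dt).
apply: le_trans (ler_norm _) _; apply: le_trans (ler_Re_nrm _) _.
by rewrite nrmM nc mul1r.
Qed.

Lemma cintegral_split (a c : itv_bound R) (b : R) f :
  (a <= BLeft b)%O -> (BRight b <= c)%O ->
  cintegrable [set` Interval a c] f ->
  cintegral [set` Interval a c] f =
  cintegral [set` Interval a (BRight b)] f + cintegral [set` Interval (BLeft b) c] f.
Proof.
move=> ab bc [f1 f2].
have aux (h : R -> R) : mu.-integrable [set` Interval a c] (EFin \o h) ->
  \int[mu]_(t in [set` Interval a c]) h t =
  \int[mu]_(t in [set` Interval a (BRight b)]) h t +
  \int[mu]_(t in [set` Interval (BLeft b) c]) h t.
  move=> hh; have ab' : (a <= BRight b)%O by apply: le_trans ab _; rewrite bnd_simp.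
  have := @Rintegral_itvB _ h a c b hh ab' bc.
  rewrite Rintegral_itv_obnd_cbnd; last first.
    by apply: integrableS hh => //; apply: subset_itvr.
  by move=> <-; rewrite addrC subrK.
by rewrite /cintegral; rewrite (aux _ f1) (aux _ f2).
Qed.

Lemma cintegrable_dominated D f (h : R -> R) : measurable D ->
  measurable_fun D (fun t : measurableTypeR R => complex.Re (f t)) ->
  measurable_fun D (fun t : measurableTypeR R => complex.Im (f t)) ->
  mu.-integrable D (EFin \o h) -> (forall t, D t -> nrm (f t) <= h t) ->
  cintegrable D f.
Proof.
move=> mD m1 m2 hh fh; split.
  apply: (le_integrable mD _ _ hh); first exact/measurable_EFinP.
  move=> t Dt /=; rewrite lee_fin.
  by apply: le_trans (ler_Re_nrm _) (le_trans (fh _ Dt) (ler_norm _)).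
apply: (le_integrable mD _ _ hh); first exact/measurable_EFinP.
move=> t Dt /=; rewrite lee_fin.
by apply: le_trans (ler_Im_nrm _) (le_trans (fh _ Dt) (ler_norm _)).
Qed.

Lemma continuous_ReIm f (t : R) : {for t, continuous f} ->
  {for t, continuous (fun t => complex.Re (f t))} /\
  {for t, continuous (fun t => complex.Im (f t))}.
Proof.
move=> hf; split.
  exact: (continuous_comp hf (@continuous_Re _ _)).
exact: (continuous_comp hf (@continuous_Im _ _)).
Qed.

Lemma cintegrable_continuous (a b : R) f :
  {in `[a, b], forall t, {for t, continuous f}} -> cintegrable `[a, b] f.
Proof.
move=> hf; split; apply: continuous_compact_integrable;
  try exact: segment_compact; apply: continuous_in_subspaceT => t /set_mem tab.
  by have [] := continuous_ReIm (hf t tab).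
by have [] := continuous_ReIm (hf t tab).
Qed.

Lemma cintegral_nrm_le_segment (a b M : R) f : a <= b ->
  {in `[a, b], forall t, {for t, continuous f}} ->
  {in `[a, b], forall t, nrm (f t) <= M} ->
  nrm (cintegral `[a, b] f) <= M * (b - a).
Proof.
move=> ab cf fM.
have -> : M * (b - a) = \int[mu]_(t in `[a, b]) M.
  rewrite Rintegral_cst //= lebesgue_measure_itv /= lte_fin.
  by case: ltP => //= ba; rewrite (@le_anti _ _ a b) ?ab //= subrr.
apply: cintegral_nrm_le => //; first exact: cintegrable_continuous.
apply: continuous_compact_integrable; first exact: segment_compact.
by apply: continuous_subspaceT => t; exact: cvg_cst.
Qed.

Lemma cintegral_segment_split (a b c : R) f : a <= b -> b <= c ->
  {in `[a, c], forall t, {for t, continuous f}} ->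
  cintegral `[a, c] f = cintegral `[a, b] f + cintegral `[b, c] f.
Proof.
move=> ab bc cf; apply: cintegral_split; rewrite ?bnd_simp //.
exact: cintegrable_continuous.
Qed.

Lemma cintegral_point (a : R) f : cintegral `[a, a] f = 0.
Proof. by rewrite /cintegral set_itv1 !Rintegral_set1. Qed.

Lemma Rintegral_primitive (a b : R) (f G : R -> R) : a < b ->
  {in `[a, b], forall t, {for t, continuous f}} ->
  {in `[a, b], forall t : R, is_derive t 1 G (f t)} ->
  \int[mu]_(t in `[a, b]) f t = G b - G a.
Proof.
move=> ab cf dG.
have cG : {in `[a, b], forall t, {for t, continuous G}}.
  move=> t /dG dGt; apply: differentiable_continuous; exact/derivable1_diffP.
rewrite /Rintegral (@continuous_FTC2 _ f G a b) //=.
- by apply: continuous_in_subspaceT => t /set_mem; exact: cf.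
- split.
  + move=> t tab; have /dG [] // : t \in `[a, b] by exact: subset_itv_oo_cc tab.
  + apply: cvg_at_right_filter; apply: cG.
    by rewrite in_itv /= lexx ltW.
  + apply: cvg_at_left_filter; apply: cG.
    by rewrite in_itv /= lexx ltW.
- move=> t tab; have /dG d : t \in `[a, b] by exact: subset_itv_oo_cc tab.
  by rewrite derive1E derive_val.
Qed.

(** The fundamental theorem of calculus for the real and imaginary parts of P
    along the segment. *)
Lemma cintegral_line (a b : R) (p v : C) (F P : C -> C) : a <= b ->
  {in `[a, b], forall t, {for line p v t, continuous F}} ->
  {in `[a, b], forall t, is_derive (line p v t) 1 P (F (line p v t))} ->
  v * cintegral `[a, b] (fun t => F (line p v t)) = P (line p v b) - P (line p v a).
Proof.
rewrite le_eqVlt => /predU1P[->|ab] cF dP.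
  by rewrite cintegral_point subrr mulr0.
have cFl : {in `[a, b], forall t, {for t, continuous (fun t => F (line p v t))}}.
  by move=> t /cF; exact: continuous_on_line.
rewrite -cintegralZl //; last exact: cintegrable_continuous.
have cG : {in `[a, b], forall t, {for t, continuous (fun t => v * F (line p v t))}}.
  move=> t tab.
  apply: (@continuousM R[i] R (cst v) (fun t => F (line p v t))).
    exact: cvg_cst.
  exact: cFl.
rewrite /cintegral.
rewrite (@Rintegral_primitive a b _ (fun t => complex.Re (P (line p v t))) ab); last first.
- by move=> t tab; have [] := is_derive_on_line (dP t tab).
- by move=> t tab; have [] := continuous_ReIm (cG t tab).
rewrite (@Rintegral_primitive a b _ (fun t => complex.Im (P (line p v t))) ab); last first.
- by move=> t tab; have [] := is_derive_on_line (dP t tab).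
- by move=> t tab; have [] := continuous_ReIm (cG t tab).
by case: (P (line p v b)) (P (line p v a)) => x y [x' y'].
Qed.

End ComplexIntegral.

(** * Integrals around rectangles and Goursat's theorem *)

Section Goursat.
Variable R : realType.
Local Notation C := (R[i]^o).
Implicit Types (x y a b c : R) (F G P : C -> C).

Definition hint F y a b : C := cintegral `[a, b] (fun x => F (x +i* y)).
Definition vint F x a b : C := cintegral `[a, b] (fun y => F (x +i* y)).

(** The integral along the boundary of [x0, x1] x [y0, y1], counterclockwise. *)
Definition rint F x0 x1 y0 y1 : C :=
  hint F y0 x0 x1 - hint F y1 x0 x1 + 'i%C * (vint F x1 y0 y1 - vint F x0 y0 y1).

Lemma line_h y x : line (0 +i* y) (1 : C) x = x +i* y.
Proof. by rewrite /line mulr1 /GRing.add /= add0r addr0. Qed.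

Lemma line_v x y : line x%:C ('i%C : C) y = x +i* y.
Proof. by rewrite /line; split_ReIm; ring. Qed.

Lemma continuous_h F y x : {for (x +i* y : C), continuous F} ->
  {for x, continuous (fun x => F (x +i* y))}.
Proof.
move=> hF; have := @continuous_on_line R F (0 +i* y) 1 x.
rewrite line_h => /(_ hF).
by rewrite (_ : (fun t => F (line (0 +i* y) 1 t)) = (fun x => F (x +i* y))) //;
  apply/funext => t; rewrite line_h.
Qed.

Lemma continuous_v F x y : {for (x +i* y : C), continuous F} ->
  {for y, continuous (fun y => F (x +i* y))}.
Proof.
move=> hF; have := @continuous_on_line R F x%:C 'i%C y.
rewrite line_v => /(_ hF).
by rewrite (_ : (fun t => F (line x%:C 'i%C t)) = (fun y => F (x +i* y))) //;
  apply/funext => t; rewrite line_v.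
Qed.

Lemma hint_primitive F P y a b : a <= b ->
  {in `[a, b], forall x, {for (x +i* y : C), continuous F}} ->
  {in `[a, b], forall x, is_derive (x +i* y : C) 1 P (F (x +i* y))} ->
  hint F y a b = P (b +i* y) - P (a +i* y).
Proof.
move=> ab cF dP.
have := @cintegral_line R a b (0 +i* y) 1 F P ab; rewrite !line_h mul1r.
under eq_cintegral do rewrite line_h.
by apply => x xab; rewrite line_h; [exact: cF|exact: dP].
Qed.

Lemma vint_primitive F P x a b : a <= b ->
  {in `[a, b], forall y, {for (x +i* y : C), continuous F}} ->
  {in `[a, b], forall y, is_derive (x +i* y : C) 1 P (F (x +i* y))} ->
  'i%C * vint F x a b = P (x +i* b) - P (x +i* a).
Proof.
move=> ab cF dP.
have := @cintegral_line R a b x%:C 'i%C F P ab; rewrite !line_v.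
under eq_cintegral do rewrite line_v.
by apply => y yab; rewrite line_v; [exact: cF|exact: dP].
Qed.

Definition on_rect x0 x1 y0 y1 (Q : C -> Prop) :=
  forall x y, x0 <= x <= x1 -> y0 <= y <= y1 -> Q (x +i* y).

Local Notation contr x0 x1 y0 y1 F :=
  (on_rect x0 x1 y0 y1 (fun z : C => {for z, continuous F})).

Lemma on_rect_sub x0 x1 y0 y1 x0' x1' y0' y1' (Q : C -> Prop) :
  x0 <= x0' -> x1' <= x1 -> y0 <= y0' -> y1' <= y1 ->
  on_rect x0 x1 y0 y1 Q -> on_rect x0' x1' y0' y1' Q.
Proof.
move=> h1 h2 h3 h4 hQ x y /andP[xa xb] /andP[ya yb]; apply: hQ.
  by rewrite (le_trans h1 xa) (le_trans xb h2).
by rewrite (le_trans h3 ya) (le_trans yb h4).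
Qed.

Lemma contr_h x0 x1 y0 y1 F y : contr x0 x1 y0 y1 F -> y0 <= y <= y1 ->
  {in `[x0, x1], forall x, {for x, continuous (fun x => F (x +i* y))}}.
Proof.
by move=> cF hy x; rewrite in_itv /= => hx; apply: continuous_h; exact: cF.
Qed.

Lemma contr_v x0 x1 y0 y1 F x : contr x0 x1 y0 y1 F -> x0 <= x <= x1 ->
  {in `[y0, y1], forall y, {for y, continuous (fun y => F (x +i* y))}}.
Proof.
by move=> cF hx y; rewrite in_itv /= => hy; apply: continuous_v; exact: cF.
Qed.

Lemma rint_splitx F x0 x1 x2 y0 y1 : x0 <= x1 -> x1 <= x2 -> y0 <= y1 ->
  contr x0 x2 y0 y1 F ->
  rint F x0 x2 y0 y1 = rint F x0 x1 y0 y1 + rint F x1 x2 y0 y1.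
Proof.
move=> h01 h12 hy cF; rewrite /rint /hint.
rewrite (@cintegral_segment_split _ x0 x1 x2) //; last first.
  by apply: contr_h cF _; rewrite lexx.
rewrite (@cintegral_segment_split _ x0 x1 x2 (fun x => F (x +i* y1))) //.
  by ring.
by apply: contr_h cF _; rewrite lexx andbT.
Qed.

Lemma rint_splity F x0 x1 y0 y1 y2 : x0 <= x1 -> y0 <= y1 -> y1 <= y2 ->
  contr x0 x1 y0 y2 F ->
  rint F x0 x1 y0 y2 = rint F x0 x1 y0 y1 + rint F x0 x1 y1 y2.
Proof.
move=> hx h01 h12 cF; rewrite /rint /vint.
rewrite (@cintegral_segment_split _ y0 y1 y2) //; last first.
  by apply: contr_v cF _; rewrite lexx andbT.
rewrite (@cintegral_segment_split _ y0 y1 y2 (fun y => F (x0 +i* y))) //.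
  by ring.
by apply: contr_v cF _; rewrite lexx.
Qed.

Lemma rint_primitive F P x0 x1 y0 y1 : x0 <= x1 -> y0 <= y1 ->
  contr x0 x1 y0 y1 F ->
  on_rect x0 x1 y0 y1 (fun z => is_derive z 1 P (F z)) ->
  rint F x0 x1 y0 y1 = 0.
Proof.
move=> hx hy cF dP; rewrite /rint mulrBr.
rewrite !(@hint_primitive F P) // ?(@vint_primitive F P) //; first by ring.
all: move=> t; rewrite in_itv /= => ht; solve [
  by apply: cF => //; rewrite lexx ?andbT | by apply: dP => //; rewrite lexx ?andbT].
Qed.

Definition on_boundary x0 x1 y0 y1 (Q : C -> Prop) :=
  on_rect x0 x1 y0 y1 (fun z => complex.Re z = x0 \/ complex.Re z = x1 \/
    complex.Im z = y0 \/ complex.Im z = y1 -> Q z).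

Local Notation contb x0 x1 y0 y1 F :=
  (on_boundary x0 x1 y0 y1 (fun z : C => {for z, continuous F})).

Lemma on_boundary_sides x0 x1 y0 y1 (Q : C -> Prop) : x0 <= x1 -> y0 <= y1 ->
  on_boundary x0 x1 y0 y1 Q ->
  [/\ forall x, x0 <= x <= x1 -> Q (x +i* y0), forall x, x0 <= x <= x1 -> Q (x +i* y1),
      forall y, y0 <= y <= y1 -> Q (x0 +i* y) & forall y, y0 <= y <= y1 -> Q (x1 +i* y)].
Proof.
move=> hx hy hQ; split => t ht; apply: hQ => //=; rewrite ?lexx ?hx ?hy //.
- by right; right; left.
- by right; right; right.
- by left.
- by right; left.
Qed.

Lemma cintegrable_sides F x0 x1 y0 y1 : x0 <= x1 -> y0 <= y1 -> contb x0 x1 y0 y1 F ->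
  [/\ cintegrable `[x0, x1] (fun x => F (x +i* y0)),
      cintegrable `[x0, x1] (fun x => F (x +i* y1)),
      cintegrable `[y0, y1] (fun y => F (x0 +i* y)) &
      cintegrable `[y0, y1] (fun y => F (x1 +i* y))].
Proof.
move=> hx hy /(on_boundary_sides hx hy)[h1 h2 h3 h4].
split; apply: cintegrable_continuous => t; rewrite in_itv /= => ht.
- by apply: continuous_h; exact: h1.
- by apply: continuous_h; exact: h2.
- by apply: continuous_v; exact: h3.
- by apply: continuous_v; exact: h4.
Qed.

Lemma rintB F G x0 x1 y0 y1 : x0 <= x1 -> y0 <= y1 ->
  contb x0 x1 y0 y1 F -> contb x0 x1 y0 y1 G ->
  rint (fun z => F z - G z) x0 x1 y0 y1 = rint F x0 x1 y0 y1 - rint G x0 x1 y0 y1.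
Proof.
move=> hx hy /(cintegrable_sides hx hy)[f1 f2 f3 f4] /(cintegrable_sides hx hy)[g1 g2 g3 g4].
rewrite /rint /hint /vint !cintegralB //; ring.
Qed.

Lemma rintZ F (k : C) x0 x1 y0 y1 : x0 <= x1 -> y0 <= y1 ->
  contb x0 x1 y0 y1 F ->
  rint (fun z => k * F z) x0 x1 y0 y1 = k * rint F x0 x1 y0 y1.
Proof.
move=> hx hy /(cintegrable_sides hx hy)[f1 f2 f3 f4].
rewrite /rint /hint /vint !cintegralZl //; ring.
Qed.

Lemma eq_rint F G x0 x1 y0 y1 : x0 <= x1 -> y0 <= y1 ->
  on_boundary x0 x1 y0 y1 (fun z => F z = G z) ->
  rint F x0 x1 y0 y1 = rint G x0 x1 y0 y1.
Proof.
move=> hx hy /(on_boundary_sides hx hy)[h1 h2 h3 h4]; rewrite /rint /hint /vint.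
rewrite (@eq_cintegral _ _ _ _ (fun t tab => h1 t _)) ?(@eq_cintegral _ _ _ _ (fun t tab => h2 t _))
  ?(@eq_cintegral _ _ _ _ (fun t tab => h3 t _)) ?(@eq_cintegral _ _ _ _ (fun t tab => h4 t _)) //;
  by move: tab; rewrite /= in_itv.
Qed.

Lemma nrm_rint_le F x0 x1 y0 y1 (M : R) : x0 <= x1 -> y0 <= y1 ->
  contr x0 x1 y0 y1 F -> on_rect x0 x1 y0 y1 (fun z => nrm (F z) <= M) ->
  nrm (rint F x0 x1 y0 y1) <= 2 * M * ((x1 - x0) + (y1 - y0)).
Proof.
move=> hx hy cF FM; rewrite /rint.
have hh y : y0 <= y <= y1 -> nrm (hint F y x0 x1) <= M * (x1 - x0).
  move=> yy; apply: cintegral_nrm_le_segment => //; first exact: contr_h cF yy.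
  by move=> x; rewrite in_itv /= => xx; apply: FM.
have hv x : x0 <= x <= x1 -> nrm (vint F x y0 y1) <= M * (y1 - y0).
  move=> xx; apply: cintegral_nrm_le_segment => //; first exact: contr_v cF xx.
  by move=> y; rewrite in_itv /= => yy; apply: FM.
apply: le_trans (nrmD _ _) _; rewrite nrmM nrm_i mul1r.
have := hh y0; rewrite lexx hy => /(_ isT) h1.
have := hh y1; rewrite lexx hy => /(_ isT) h2.
have := hv x0; rewrite lexx hx => /(_ isT) h3.
have := hv x1; rewrite lexx hx => /(_ isT) h4.
apply: le_trans (lerD (nrmB _ _) (nrmB _ _)) _.
by lra.
Qed.

Lemma rint_degx F x y0 y1 : rint F x x y0 y1 = 0.
Proof. by rewrite /rint /hint !cintegral_point !subrr mulr0 addr0. Qed.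

Lemma rint_degy F x0 x1 y : rint F x0 x1 y y = 0.
Proof. by rewrite /rint /vint !cintegral_point !subrr mulr0 addr0. Qed.

Lemma nested_intervals (l r : nat -> R) : (forall n m, l n <= r m) ->
  exists x, forall n, l n <= x <= r n.
Proof.
move=> lr; pose S := [set l n | n in setT].
have S0 : S !=set0 by exists (l 0%N); exists 0%N.
have Sub m : ubound S (r m) by move=> _ [n _ <-].
exists (sup S) => n; apply/andP; split.
  by apply: ub_le_sup; [exists (r 0%N)|exists n].
exact: ge_sup.
Qed.

Lemma max4 (s a b c d : R) : s <= a + b + c + d ->
  [\/ s <= 4 * a, s <= 4 * b, s <= 4 * c | s <= 4 * d].
Proof.
move=> hs; have [h1|h1] := leP s (4 * a); first by apply: Or41.
have [h2|h2] := leP s (4 * b); first by apply: Or42.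
have [h3|h3] := leP s (4 * c); first by apply: Or43.
by apply: Or44; lra.
Qed.

(** Quartering a rectangle keeps at least a quarter of the boundary integral in
    one of the pieces. *)
Lemma rint_quarter F x0 y0 w h : 0 <= w -> 0 <= h ->
  contr x0 (x0 + w) y0 (y0 + h) F ->
  exists p : R * R, [/\ x0 <= p.1, p.1 + w / 2 <= x0 + w,
    y0 <= p.2, p.2 + h / 2 <= y0 + h &
    nrm (rint F x0 (x0 + w) y0 (y0 + h)) <=
      4 * nrm (rint F p.1 (p.1 + w / 2) p.2 (p.2 + h / 2))].
Proof.
move=> w0 h0 cF.
have ew : x0 + w / 2 + w / 2 = x0 + w by field.
have eh : y0 + h / 2 + h / 2 = y0 + h by field.
have [w1 w2] : x0 <= x0 + w / 2 /\ x0 + w / 2 <= x0 + w by split; lra.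
have [h1 h2] : y0 <= y0 + h / 2 /\ y0 + h / 2 <= y0 + h by split; lra.
have cF1 : contr x0 (x0 + w / 2) y0 (y0 + h) F by apply: on_rect_sub cF; lra.
have cF2 : contr (x0 + w / 2) (x0 + w) y0 (y0 + h) F by apply: on_rect_sub cF; lra.
rewrite (rint_splitx w1 w2 (le_trans h1 h2) cF).
rewrite (rint_splity w1 h1 h2 cF1) (rint_splity w2 h1 h2 cF2).
have nrm4 (a b c d : C) : nrm (a + b + (c + d)) <= nrm a + nrm b + nrm c + nrm d.
  apply: le_trans (nrmD _ _) _; rewrite -addrA.
  by apply: lerD; exact: nrmD.
case: (max4 (nrm4 (rint F x0 (x0 + w / 2) y0 (y0 + h / 2))
   (rint F x0 (x0 + w / 2) (y0 + h / 2) (y0 + h))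
   (rint F (x0 + w / 2) (x0 + w) y0 (y0 + h / 2))
   (rint F (x0 + w / 2) (x0 + w) (y0 + h / 2) (y0 + h)))) => hS.
- by exists (x0, y0).
- by exists (x0, y0 + h / 2); rewrite /= eh.
- by exists (x0 + w / 2, y0); rewrite /= ew.
- by exists (x0 + w / 2, y0 + h / 2); rewrite /= ew eh.
Qed.

(** Goursat: the quarters selected by [rint_quarter] shrink to a point, where
    F differs from an affine function, which has a primitive, by little. *)
Theorem goursat F x0 x1 y0 y1 : x0 <= x1 -> y0 <= y1 ->
  on_rect x0 x1 y0 y1 (fun z => derivable F z 1) ->
  rint F x0 x1 y0 y1 = 0.
Proof.
move=> hx hy dF.
have cF : contr x0 x1 y0 y1 F.
  by move=> x y xx yy; apply: derivable_continuousC; exact: dF.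
pose w n := (x1 - x0) / 2 ^+ n; pose h n := (y1 - y0) / 2 ^+ n.
have p2 n : 0 < 2 ^+ n :> R by rewrite exprn_gt0.
have w0 n : 0 <= w n by rewrite divr_ge0 ?subr_ge0 // ltW.
have h0 n : 0 <= h n by rewrite divr_ge0 ?subr_ge0 // ltW.
have wS n : w n.+1 = w n / 2.
  by rewrite /w exprSr; field; rewrite gt_eqF.
have hS n : h n.+1 = h n / 2.
  by rewrite /h exprSr; field; rewrite gt_eqF.
pose inside n (p : R * R) := [/\ x0 <= p.1, p.1 + w n <= x1, y0 <= p.2 & p.2 + h n <= y1].
(* f (n, p) is the corner of the quarter chosen in the rectangle with corner p
   and sides w n, h n; outside the given rectangle its value is arbitrary. *)
have [f hf] : {f : nat * (R * R) -> R * R & forall q,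
   inside q.1 q.2 -> [/\ q.2.1 <= (f q).1, (f q).1 + w q.1.+1 <= q.2.1 + w q.1,
    q.2.2 <= (f q).2, (f q).2 + h q.1.+1 <= q.2.2 + h q.1 &
    nrm (rint F q.2.1 (q.2.1 + w q.1) q.2.2 (q.2.2 + h q.1)) <=
      4 * nrm (rint F (f q).1 ((f q).1 + w q.1.+1) (f q).2 ((f q).2 + h q.1.+1))]}.
  apply: (@choice _ _ (fun (q : nat * (R * R)) (r : R * R) =>
    inside q.1 q.2 -> [/\ q.2.1 <= r.1, r.1 + w q.1.+1 <= q.2.1 + w q.1,
    q.2.2 <= r.2, r.2 + h q.1.+1 <= q.2.2 + h q.1 &
    nrm (rint F q.2.1 (q.2.1 + w q.1) q.2.2 (q.2.2 + h q.1)) <=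
      4 * nrm (rint F r.1 (r.1 + w q.1.+1) r.2 (r.2 + h q.1.+1))])) => -[n [x y]] /=.
  have [[/= i1 i2 i3 i4]|ni] := pselect (inside n (x, y)); last by exists (0, 0).
  have [|p hp] := @rint_quarter F x y (w n) (h n) (w0 n) (h0 n).
    by apply: on_rect_sub cF.
  by exists p => _; rewrite wS hS.
pose u := fix u n := if n is m.+1 then f (m, u m) else (x0, y0).
have uin n : inside n (u n).
  elim: n => [|n IH]; first by split=> //=; rewrite /w /h expr0; lra.
  have [/= a1 a2 a3 a4 _] := hf (n, u n) IH.
  have [b1 b2 b3 b4] := IH.
  by split => /=; lra.
have ustep n := hf (n, u n) (uin n).
pose A n := rint F (u n).1 ((u n).1 + w n) (u n).2 ((u n).2 + h n).
have hA n : nrm (rint F x0 x1 y0 y1) <= 4 ^+ n * nrm (A n).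
  elim: n => [|n IH].
    rewrite expr0 mul1r /A /= /w /h expr0 !divr1.
    by rewrite ![_ + (_ - _)]addrC !subrK.
  apply: le_trans IH _; have [_ _ _ _ /= s5] := ustep n.
  by rewrite exprSr -mulrA ler_pM2l // exprn_gt0.
have nestx n k : (u n).1 <= (u (n + k)%N).1 /\ (u (n + k)%N).1 + w (n + k)%N <= (u n).1 + w n.
  elim: k => [|k [I1 I2]]; first by rewrite addn0.
  have [/= s1 s2 _ _ _] := ustep (n + k)%N; rewrite addnS; split => /=; lra.
have nesty n k : (u n).2 <= (u (n + k)%N).2 /\ (u (n + k)%N).2 + h (n + k)%N <= (u n).2 + h n.
  elim: k => [|k [I1 I2]]; first by rewrite addn0.
  have [/= _ _ s1 s2 _] := ustep (n + k)%N; rewrite addnS; split => /=; lra.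
have [x hxn] : exists x, forall n, (u n).1 <= x <= (u n).1 + w n.
  apply: nested_intervals => n m; have [nm|mn] := leqP n m.
    have := nestx n (m - n)%N; rewrite subnKC // => -[I1 I2].
    by have := w0 m; lra.
  have := nestx m (n - m)%N; rewrite subnKC 1?ltnW // => -[I1 I2].
  by have := w0 n; lra.
have [y hyn] : exists y, forall n, (u n).2 <= y <= (u n).2 + h n.
  apply: nested_intervals => n m; have [nm|mn] := leqP n m.
    have := nesty n (m - n)%N; rewrite subnKC // => -[I1 I2].
    by have := h0 m; lra.
  have := nesty m (n - m)%N; rewrite subnKC 1?ltnW // => -[I1 I2].
  by have := h0 n; lra.
pose p : C := x +i* y.
have dFp : derivable F p 1.
  have [i1 i2 i3 i4] := uin 0%N; apply: dF.
    by have := hxn 0%N; lra.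
  by have := hyn 0%N; lra.
have {}dFp := derivableP dFp; set d := 'D_1 F p in dFp.
move/is_deriveCP: dFp => dFp.
apply/eqP; rewrite -nrm_eq0 eq_le nrm_ge0 andbT.
apply/ler_addgt0Pl => e e0; rewrite addr0.
pose s := (x1 - x0) + (y1 - y0).
have s0 : 0 <= s by rewrite /s; lra.
(* The factor 4^n of the bisection is absorbed by the perimeter and the
   distance to p, each of order s / 2^n. *)
pose e' := e / (2 * s ^+ 2 + 1).
have k0 : 0 < 2 * s ^+ 2 + 1 by rewrite ltr_wpDl // mulr_ge0 // sqr_ge0.
have e'0 : 0 < e' by rewrite divr_gt0.
have [r r0 {}dFp] := dFp _ e'0.
have [n hn] : exists n, s / 2 ^+ n < r.
  have sr0 : 0 <= s / r by rewrite divr_ge0 // ltW.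
  exists (Num.truncn (s / r)).+1; rewrite ltr_pdivrMr // mulrC -ltr_pdivrMr //.
  apply: lt_le_trans (truncnS_gt _) _.
  by rewrite -natrX ler_nat ltnW // ltn_expl.
(* The affine part of F at p, and its primitive. *)
pose L (z : C) : C := F p + d * (z - p).
pose P (z : C) : C := F p * z + d / 2 * (z - p) ^+ 2.
have dP (z : C) : is_derive z (1 : C) P (L z).
  apply/is_deriveCP => ep ep0.
  have nd : 0 < nrm (d / 2) + 1 by rewrite ltr_wpDl ?nrm_ge0.
  exists (ep / (nrm (d / 2) + 1)); first by rewrite divr_gt0.
  move=> z' hz'; rewrite /P /L.
  have -> : F p * z' + d / 2 * (z' - p) ^+ 2 - (F p * z + d / 2 * (z - p) ^+ 2) -
   (F p + d * (z - p)) * (z' - z) = d / 2 * (z' - z) * (z' - z) by field.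
  rewrite nrmM ler_wpM2r ?nrm_ge0 // nrmM.
  have h1 : nrm (d / 2) * nrm (z' - z) <= (nrm (d / 2) + 1) * nrm (z' - z).
    by rewrite ler_wpM2r ?nrm_ge0 // lerDl.
  by apply: le_trans h1 _; rewrite mulrC -ler_pdivlMr // ltW.
have dL z : derivable L z 1.
  apply: derivableCD; first exact: derivableC_cst.
  apply: derivableCM; first exact: derivableC_cst.
  by apply: derivableCB; [exact: derivableC_id|exact: derivableC_cst].
have cL a b c' d' : contr a b c' d' L.
  by move=> ? ? _ _; apply: derivable_continuousC; exact: dL.
have [i1 i2 i3 i4] := uin n.
have cFn : contr (u n).1 ((u n).1 + w n) (u n).2 ((u n).2 + h n) F.
  by apply: on_rect_sub cF.
have hw : (u n).1 <= (u n).1 + w n by rewrite lerDl.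
have hh : (u n).2 <= (u n).2 + h n by rewrite lerDl.
have AE : A n = rint (fun z => F z - L z) (u n).1 ((u n).1 + w n) (u n).2 ((u n).2 + h n).
  rewrite (rintB hw hh (fun x y hx hy _ => cFn x y hx hy) (fun x y hx hy _ => cL _ _ _ _ x y hx hy)).
  by rewrite (rint_primitive hw hh (cL _ _ _ _) (fun a b _ _ => dP (a +i* b))) subr0.
have swh : s / 2 ^+ n = w n + h n by rewrite /s mulrDl.
have := @nrm_rint_le (fun z => F z - L z) _ _ _ _ (e' * (s / 2 ^+ n)) hw hh.
rewrite -AE => hAn.
apply: le_trans (hA n) _.
have : nrm (A n) <= 2 * (e' * (s / 2 ^+ n)) * (s / 2 ^+ n).
  have -> : 2 * (e' * (s / 2 ^+ n)) * (s / 2 ^+ n) =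
   2 * (e' * (s / 2 ^+ n)) * ((u n).1 + w n - (u n).1 + ((u n).2 + h n - (u n).2)).
    by congr (_ * _); rewrite swh; ring.
  apply: hAn.
    move=> a b ha hb.
    by apply: (@continuousB R[i] C C F L); [exact: cFn|exact: cL ha hb].
  move=> a b ha hb.
  have hz : nrm ((a +i* b : C) - p) <= s / 2 ^+ n.
    apply: le_trans (nrm_le _) _; rewrite swh /=.
    have hx' := hxn n; have hy' := hyn n.
    by apply: lerD; rewrite ler_norml; lra.
  rewrite /L opprD addrA; apply: le_trans (dFp _ _) _.
    exact: le_lt_trans hz hn.
  by rewrite ler_wpM2l // ltW.
move=> hAn'; have h4 : 0 <= 4 ^+ n :> R by rewrite exprn_ge0.
apply: le_trans (ler_wpM2l h4 hAn') _.
have -> : 4 ^+ n * (2 * (e' * (s / 2 ^+ n)) * (s / 2 ^+ n)) = e * (2 * s ^+ 2 / (2 * s ^+ 2 + 1)).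
  have -> : 4 ^+ n = 2 ^+ n * 2 ^+ n :> R by rewrite -exprMn -natrM.
  by rewrite /e'; field; rewrite !gt_eqF.
by rewrite ger_pMr // ler_pdivrMr // mul1r lerDl.
Qed.

(** The small rectangle around the exceptional point contributes arbitrarily
    little, since F is bounded there. *)
Theorem goursat_but_one F x0 x1 y0 y1 (p : C) : x0 <= x1 -> y0 <= y1 ->
  {for p, continuous F} ->
  on_rect x0 x1 y0 y1 (fun z => z != p -> derivable F z 1) ->
  rint F x0 x1 y0 y1 = 0.
Proof.
move=> hx hy cp dF.
have cF : contr x0 x1 y0 y1 F.
  move=> x y xx yy; have [->//|np] := eqVneq (x +i* y : C) p.
  by apply: derivable_continuousC; exact: dF.
have away a b c d : x0 <= a -> b <= x1 -> y0 <= c -> d <= y1 -> a <= b -> c <= d ->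
    ~~ ((a <= complex.Re p <= b) && (c <= complex.Im p <= d)) -> rint F a b c d = 0.
  move=> h1 h2 h3 h4 h5 h6 np; apply: (@goursat F a b c d h5 h6) => x y xx yy.
  apply: dF; [lra|lra|].
  by apply: contraNneq np => <- /=; rewrite xx yy.
have [pin|pout] := boolP ((x0 <= complex.Re p <= x1) && (y0 <= complex.Im p <= y1));
  last exact: away.
case/andP: pin => /andP[p1 p2] /andP[p3 p4].
set px := complex.Re p in p1 p2 away; set py := complex.Im p in p3 p4 away.
move/continuousCP: cp => /(_ 1 ltr01)[r r0 hr].
apply/eqP; rewrite -nrm_eq0 eq_le nrm_ge0 andbT.
apply/ler_addgt0Pl => e e0; rewrite addr0.
pose M := nrm (F p) + 1.
have M0 : 0 < M by rewrite ltr_wpDl ?nrm_ge0.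
pose d := Num.min (r / 4) (e / (8 * M)).
have d0 : 0 < d by rewrite lt_min !divr_gt0 // mulr_gt0.
have dr : d <= r / 4 by rewrite ge_min lexx.
have de : d <= e / (8 * M) by rewrite ge_min lexx orbT.
(* [u0, u1] x [v0, v1] is the part of the given rectangle within distance d of
   p; the four other pieces avoid p or are degenerate. *)
pose u0 := Num.max x0 (px - d); pose u1 := Num.min x1 (px + d).
pose v0 := Num.max y0 (py - d); pose v1 := Num.min y1 (py + d).
have [a1 a2 a3 a4] : [/\ x0 <= u0, u0 <= px, px <= u1 & u1 <= x1].
  rewrite /u0 /u1 le_max lexx ge_max p1 le_min p2 ge_min lexx /=; split => //; lra.
have [b1 b2 b3 b4] : [/\ y0 <= v0, v0 <= py, py <= v1 & v1 <= y1].
  rewrite /v0 /v1 le_max lexx ge_max p3 le_min p4 ge_min lexx /=; split => //; lra.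
have u0d : px - d <= u0 by rewrite /u0 le_max lexx orbT.
have u1d : u1 <= px + d by rewrite /u1 ge_min lexx orbT.
have v0d : py - d <= v0 by rewrite /v0 le_max lexx orbT.
have v1d : v1 <= py + d by rewrite /v1 ge_min lexx orbT.
have u0E : u0 = x0 \/ u0 = px - d by rewrite /u0; case: ltP => _; [right|left].
have u1E : u1 = x1 \/ u1 = px + d by rewrite /u1; case: ltP => _; [left|right].
have v0E : v0 = y0 \/ v0 = py - d by rewrite /v0; case: ltP => _; [right|left].
have v1E : v1 = y1 \/ v1 = py + d by rewrite /v1; case: ltP => _; [left|right].
have sub a b c' d' : x0 <= a -> b <= x1 -> y0 <= c' -> d' <= y1 -> contr a b c' d' F.
  by move=> *; apply: on_rect_sub cF.
have h1 : u0 <= u1 by exact: le_trans a2 a3.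
have h2 : v0 <= v1 by exact: le_trans b2 b3.
rewrite (rint_splitx a1 (le_trans a2 p2) hy cF).
rewrite (rint_splitx h1 a4 hy (sub _ _ _ _ a1 (lexx _) (lexx _) (lexx _))).
rewrite (rint_splity h1 b1 (le_trans b2 p4) (sub _ _ _ _ a1 a4 (lexx _) (lexx _))).
rewrite (rint_splity h1 h2 b4 (sub _ _ _ _ a1 a4 b1 (lexx _))).
have -> : rint F x0 u0 y0 y1 = 0.
  have [<-|ne] := eqVneq x0 u0; first exact: rint_degx.
  have {}ne : u0 < px.
    by case: u0E ne => ->; rewrite ?eqxx // => _; lra.
  by apply: away => //; [lra|]; apply/negP; lra.
have -> : rint F u1 x1 y0 y1 = 0.
  have [->|ne] := eqVneq u1 x1; first exact: rint_degx.
  have {}ne : px < u1.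
    by case: u1E ne => ->; rewrite ?eqxx // => _; lra.
  by apply: away => //; [lra|]; apply/negP; lra.
have -> : rint F u0 u1 y0 v0 = 0.
  have [<-|ne] := eqVneq y0 v0; first exact: rint_degy.
  have {}ne : v0 < py.
    by case: v0E ne => ->; rewrite ?eqxx // => _; lra.
  by apply: away => //; [lra|]; apply/negP; lra.
have -> : rint F u0 u1 v1 y1 = 0.
  have [->|ne] := eqVneq v1 y1; first exact: rint_degy.
  have {}ne : py < v1.
    by case: v1E ne => ->; rewrite ?eqxx // => _; lra.
  by apply: away => //; [lra|]; apply/negP; lra.
rewrite !add0r !addr0.
have := @nrm_rint_le F u0 u1 v0 v1 M h1 h2 (sub _ _ _ _ a1 a4 b1 b4).
have hM : on_rect u0 u1 v0 v1 (fun z => nrm (F z) <= M).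
  move=> x y xx yy.
  have : nrm ((x +i* y : C) - p) < r.
    apply: le_lt_trans (nrm_le _) _; rewrite !raddfB /= -/px -/py.
    have : `|x - px| <= d by rewrite ler_norml; lra.
    have : `|y - py| <= d by rewrite ler_norml; lra.
    by lra.
  move=> /hr hh; have := distnrm (F (x +i* y)) (F p); rewrite /M; lra.
move=> /(_ hM) hh; apply: le_trans hh _.
apply: (@le_trans _ _ (2 * M * (4 * d))).
  have hd : u1 - u0 + (v1 - v0) <= 4 * d by lra.
  by apply: ler_wpM2l hd; rewrite mulr_ge0 // ltW.
move: de; rewrite ler_pdivlMr; last by rewrite mulr_gt0.
lra.
Qed.

End Goursat.

(** * The complex exponential *)

Section ComplexExponential.
Variable R : realType.
Local Notation C := (R[i]^o).
Implicit Types (x y : R) (z w : C).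

Lemma cexpD z w : cexp (z + w) = cexp z * cexp w.
Proof.
case: z w => a b [c d]; rewrite /cexp /= expRD cosD sinD.
by split_ReIm; ring.
Qed.

Lemma cexp0 : cexp (0 : C) = 1.
Proof. by rewrite /cexp /= expR0 cos0 sin0 mul1r. Qed.

Lemma nrm_cexp z : nrm (cexp z) = expR (complex.Re z).
Proof.
rewrite /cexp nrmM nrmR ger0_norm ?expR_ge0 // /nrm /= cos2Dsin2 sqrtr1.
by rewrite mulr1.
Qed.

Lemma cexp_neq0 z : cexp z != 0.
Proof. by rewrite -nrm_gt0 nrm_cexp expR_gt0. Qed.

Lemma cexpN z : cexp (- z) = (cexp z)^-1.
Proof.
by apply: (mulfI (cexp_neq0 z)); rewrite -cexpD subrr cexp0 divff // cexp_neq0.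
Qed.

Lemma cexpJ z : cexp (z^*%C) = (cexp z)^*%C.
Proof.
case: z => a b; rewrite /cexp /= cosN sinN.
by split_ReIm; ring.
Qed.

Lemma is_derive_littleo (f : R -> R) x (d : R) : is_derive x (1 : R) f d ->
  forall e : R, 0 < e -> exists2 r : R, 0 < r &
    forall h : R, `|h| < r -> `|f (h + x) - f x - d * h| <= e * `|h|.
Proof.
move=> hd e e0; have dfx : derivable f x 1 by [].
have : h^-1 *: (f (h *: 1 + x) - f x) @[h --> (0:R)^'] --> d.
  by have <- : 'D_1 f x = d by rewrite derive_val.
move=> /cvgrPdist_lt /(_ e e0); rewrite near_withinE => /nbhs_ballP[r /= r0 h].
exists r => // k kr; have [->|k0] := eqVneq k 0.
  by rewrite add0r subrr mulr0 subr0 normr0 mulr0.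
have := h k; rewrite /ball /= sub0r normrN => /(_ kr k0).
rewrite scaler1 => hh.
have -> : f (k + x) - f x - d * k = - (k * (d - k^-1 *: (f (k + x) - f x))).
  by rewrite [k^-1 *: _]/GRing.scale /=; field.
by rewrite normrN normrM mulrC ler_wpM2r // ltW.
Qed.

(** The derivative at 0 comes from the real functions exp, sin and cos; the
    functional equation moves it to z. *)
Lemma is_derive_cexp z : is_derive z (1 : C) (@cexp R) (cexp z).
Proof.
have at0 (e : R) : 0 < e -> exists2 r : R, 0 < r &
    forall w, nrm w < r -> nrm (cexp w - 1 - w) <= e * nrm w.
  move=> e0; pose e1 := Num.min 1 (e / 8).
  have e10 : 0 < e1 by rewrite lt_min ltr01 divr_gt0.
  have e11 : e1 <= 1 by rewrite ge_min lexx.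
  have e1e : e1 <= e / 8 by rewrite ge_min lexx orbT.
  have [r1 r10 h1] := is_derive_littleo (is_derive_expR 0) e10.
  have [r2 r20 h2] := is_derive_littleo (is_derive_sin 0) e10.
  have [r3 r30 h3] := is_derive_littleo (is_derive_cos 0) e10.
  exists (Num.min (e1 / 2) (Num.min r1 (Num.min r2 r3))).
    by rewrite !lt_min r10 r20 r30 divr_gt0.
  move=> w; rewrite !lt_min => /and4P[w0 w1 w2 w3].
  have wx := ler_Re_nrm w; have wy := ler_Im_nrm w.
  have := h1 _ (le_lt_trans wx w1); rewrite addr0 expR0 mul1r => {}h1.
  have := h2 _ (le_lt_trans wy w2); rewrite addr0 sin0 cos0 mul1r subr0 => {}h2.
  have := h3 _ (le_lt_trans wy w3); rewrite addr0 sin0 cos0 oppr0 mul0r subr0 => {}h3.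
  have -> : e * nrm w = e * nrm w / 8 * 8 by field.
  move: wx wy h1 h2 h3 w0; rewrite /cexp.
  have -> : (expR (complex.Re w))%:C * (cos (complex.Im w) +i* sin (complex.Im w)) - 1 - w =
    (expR (complex.Re w) * cos (complex.Im w) - 1 - complex.Re w) +i*
     (expR (complex.Re w) * sin (complex.Im w) - complex.Im w).
    by case: w {w1 w2 w3} => a b; split_ReIm; ring.
  set x := complex.Re w; set y := complex.Im w; set n := nrm w => wx wy h1 h2 h3 w0.
  have n0 : 0 <= n := nrm_ge0 w.
  have k1 : `|expR x - 1 - x| <= e1 * n by apply: le_trans h1 _; rewrite ler_wpM2l // ltW.
  have k2 : `|sin y - y| <= e1 * n by apply: le_trans h2 _; rewrite ler_wpM2l // ltW.
  have k3 : `|cos y - 1| <= e1 * n by apply: le_trans h3 _; rewrite ler_wpM2l // ltW.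
  have e1n : e1 * n <= n by rewrite ler_piMl.
  have k4 : `|expR x - 1| <= 2 * n.
    have -> : expR x - 1 = (expR x - 1 - x) + x by ring.
    by apply: le_trans (ler_normD _ _) _; rewrite mulr_natl mulr2n lerD // (le_trans k1).
  have k5 : expR x <= 2.
    have := ler_norm (expR x - 1); lra.
  have ex0 := expR_ge0 x.
  apply: le_trans (nrm_le _) _ => /=.
  have -> : expR x * cos y - 1 - x = (expR x - 1 - x) + expR x * (cos y - 1) by ring.
  have -> : expR x * sin y - y = expR x * (sin y - y) + (expR x - 1) * y by ring.
  have m1 : `|expR x * (cos y - 1)| <= 2 * (e1 * n).
    by rewrite normrM ger0_norm // ler_pM.
  have m2 : `|expR x * (sin y - y)| <= 2 * (e1 * n).
    by rewrite normrM ger0_norm // ler_pM.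
  have m3 : `|(expR x - 1) * y| <= e1 * n.
    by rewrite normrM; apply: ler_pM => //; lra.
  have m4 : e1 * n <= e * n / 8 by rewrite mulrAC ler_wpM2r.
  have t1 := ler_normD (expR x - 1 - x) (expR x * (cos y - 1)).
  have t2 := ler_normD (expR x * (sin y - y)) ((expR x - 1) * y).
  have en0 : 0 <= e * n by rewrite mulr_ge0 // ltW.
  by move: t1 t2 m1 m2 m3 m4 k1 en0; lra.
apply/is_deriveCP => e e0.
have [|r r0 hr] := at0 (e / expR (complex.Re z)); first by rewrite divr_gt0 ?expR_gt0.
exists r => // w /hr hw.
have -> : cexp w - cexp z - cexp z * (w - z) = cexp z * (cexp (w - z) - 1 - (w - z)).
  have wE : cexp w = cexp z * cexp (w - z) by rewrite -cexpD addrC subrK.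
  by rewrite wE; ring.
rewrite nrmM nrm_cexp mulrC -ler_pdivlMr ?expR_gt0 //.
by rewrite mulrAC.
Qed.

Lemma derivable_cexp z : derivable (@cexp R) z 1.
Proof. by have := is_derive_cexp z. Qed.

Lemma continuous_nrm z : {for z, continuous (@nrm R : C -> R)}.
Proof.
apply: (proj2 (@cvgrPdist_lt _ _ _ (nbhs z) _ _ _)) => e e0.
apply/near_nrmP; exists e => // w wz; apply: le_lt_trans wz.
rewrite ler_norml; have := distnrm w z; have := distnrm z w.
by rewrite (nrmBC z w); lra.
Qed.

End ComplexExponential.

(** * The maximum principle and the identity theorem *)

Section IdentityTheorem.
Variable R : realType.
Local Notation C := (R[i]^o).
Implicit Types (f h q : C -> C) (c z w : C).

(** The integral of q over the circle of radius e^l around c, with respect to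
    the angle. *)
Definition circ q c (l : R) : C := vint (fun w => q (c + cexp w)) l (- pi) pi.

(** Goursat for w |-> q (c + e^w) on a rectangle of height 2 pi; the horizontal
    sides cancel by periodicity. *)
Lemma circ_const q c (l0 l1 : R) : l0 <= l1 ->
  (forall z, nrm (z - c) <= expR l1 -> derivable q z 1) ->
  circ q c l0 = circ q c l1.
Proof.
move=> l01 dq; pose G w := q (c + cexp w).
have pipi : - pi <= pi :> R by have := pi_ge0 R; lra.
have dG : on_rect l0 l1 (- pi) pi (fun z : C => derivable G z 1).
  move=> x y /andP[_ xl] _.
  apply: (@derivable_compC R q (fun w => c + cexp w)).
    by apply: derivableCD; [exact: derivableC_cst|exact: derivable_cexp].
  by apply: dq; rewrite addrC addKr nrm_cexp ler_expR.
have := goursat l01 pipi dG.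
have hE : hint G (- pi) l0 l1 = hint G pi l0 l1.
  apply: eq_cintegral => x _; rewrite /G; congr (q (c + _)).
  by rewrite /cexp /= cosN sinN sinpi oppr0.
rewrite /rint hE (subrr (hint G pi l0 l1)) add0r => /(congr1 (@nrm R)).
rewrite nrmM nrm_i mul1r nrm0 => /eqP; rewrite nrm_eq0 subr_eq0 => /eqP hv.
exact: esym hv.
Qed.

(** The mean of Re q is close to Re (q c) on small circles around c, at most
    Re (q c) - e r^2 on the circle of radius r, and the same on both. *)
Lemma no_strict_max q c (r e : R) : 0 < r -> 0 < e ->
  (forall z, nrm (z - c) <= r -> derivable q z 1) ->
  ~ (forall z, nrm (z - c) <= r ->
     complex.Re (q z) <= complex.Re (q c) - e * nrm (z - c) ^+ 2).
Proof.
move=> r0 e0 dq hq.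
have er : 0 < e * r ^+ 2 by rewrite mulr_gt0 // exprn_gt0.
have /continuousCP /(_ (e * r ^+ 2 / 2)) : {for c, continuous q}.
  by apply: derivable_continuousC; apply: dq; rewrite subrr nrm0 ltW.
rewrite divr_gt0 // => /(_ isT)[d d0 hd].
pose m := Num.min (d / 2) r.
have m0 : 0 < m by rewrite lt_min r0 divr_gt0.
have md : m <= d / 2 by rewrite ge_min lexx.
have mr : m <= r by rewrite ge_min lexx orbT.
have em : expR (ln m) = m by rewrite lnK.
have er' : expR (ln r) = r by rewrite lnK.
have lmr : ln m <= ln r by rewrite ler_ln.
have circR l (k : R) : l <= ln r ->
  (\int[lebesgue_measure]_(y in `[- pi, pi]) k = k * (2 * pi))
  /\ lebesgue_measure.-integrable `[- pi, pi] (EFin \o (fun y : R => complex.Re (q (c + cexp (l +i* y)))))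
  /\ lebesgue_measure.-integrable `[(- pi : R), pi] (EFin \o (fun y : R => k)).
  move=> lr; split; [|split].
  - rewrite Rintegral_cst //= lebesgue_measure_itv /= lte_fin.
    have -> : (- pi < pi :> R) by have := pi_gt0 R; lra.
    by rewrite -EFinD /=; ring.
  - suff [] : cintegrable `[- pi, pi] (fun y : R => q (c + cexp (l +i* y))) by [].
    apply: cintegrable_continuous => y _.
    apply: (@continuous_v R (fun w => q (c + cexp w)) l y).
    apply: derivable_continuousC.
    apply: (@derivable_compC R q (fun w => c + cexp w)).
      by apply: derivableCD; [exact: derivableC_cst|exact: derivable_cexp].
    by apply: dq; rewrite addrC addKr nrm_cexp /= -er' ler_expR.
  - apply: continuous_compact_integrable; first exact: segment_compact.
    by apply: continuous_subspaceT => t; exact: cvg_cst.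
have := @circ_const q c (ln m) (ln r) lmr; rewrite er' => /(_ dq).
move=> /(congr1 (@complex.Re R)) /=.
pose k0 := complex.Re (q c) - e * r ^+ 2 / 2.
pose k1 := complex.Re (q c) - e * r ^+ 2.
have [i1 [i2 i3]] := circR (ln m) k0 lmr.
have [j1 [j2 j3]] := circR (ln r) k1 (lexx _).
have lo : k0 * (2 * pi) <=
  \int[lebesgue_measure]_(y in `[- pi, pi]) complex.Re (q (c + cexp (ln m +i* y))).
  rewrite -i1; apply: le_Rintegral => // y _.
  have hy : nrm (c + cexp (ln m +i* y) - c) < d.
    by rewrite addrC addKr nrm_cexp /= em; lra.
  have := le_lt_trans (ler_Re_nrm _) (hd _ hy); rewrite raddfB /= ltr_norml /k0.
  lra.
have hi : \int[lebesgue_measure]_(y in `[- pi, pi]) complex.Re (q (c + cexp (ln r +i* y)))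
  <= k1 * (2 * pi).
  rewrite -j1; apply: le_Rintegral => // y _.
  have hy : nrm (c + cexp (ln r +i* y) - c) = r.
    by rewrite addrC addKr nrm_cexp /= er'.
  by have := hq (c + cexp (ln r +i* y)); rewrite hy => /(_ (lexx _)).
move=> heq; move: lo; rewrite heq => lo; have := le_trans lo hi.
have pi2 : 0 < 2 * pi :> R by rewrite mulr_gt0 ?pi_gt0.
rewrite (ler_pM2r pi2) /k0 /k1; clear -er; lra.
Qed.

Lemma rect_max (phi : C -> R) (a b c d : R) : a <= b -> c <= d ->
  on_rect a b c d (fun z => {for z, continuous phi}) ->
  exists x y, [/\ a <= x <= b, c <= y <= d &
    on_rect a b c d (fun z => phi z <= phi (x +i* y))].
Proof.
move=> ab cd cphi.
pose A : set (R * R) := `[a, b]%classic `*` `[c, d]%classic.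
pose F (p : R * R) := phi (p.1 +i* p.2).
have cA : compact A by apply: compact_setX; exact: segment_compact.
have A0 : A !=set0.
  by exists (a, c); split; rewrite /= in_itv /= lexx ?ab ?cd.
have cF : {within A, continuous F}.
  apply: continuous_in_subspaceT => -[x y] /set_mem[/=].
  rewrite !in_itv /= => hx hy.
  have hc : {for (x, y), continuous (fun p : R * R => (p.1 +i* p.2 : C))}.
    have -> : (fun p : R * R => (p.1 +i* p.2 : C)) =
       (fun p : R * R => line 0 1 p.1 + line 0 'i%C p.2).
      apply/funext => -[u v] /=; rewrite /line !add0r.
      by split_ReIm; ring.
    apply: (@continuousD R[i] C (R * R)%type (fun p => line 0 1 p.1)
      (fun p => line 0 'i%C p.2)).
      apply: (@continuous_comp (R * R)%type R C (fun p => p.1) (line 0 1)).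
        exact: cvg_fst.
      exact: continuous_line.
    apply: (@continuous_comp (R * R)%type R C (fun p => p.2) (line 0 'i%C)).
      exact: cvg_snd.
    exact: continuous_line.
  apply: (@continuous_comp (R * R)%type C R (fun p => (p.1 +i* p.2 : C)) phi).
    exact: hc.
  exact: cphi.
have [[x y] /set_mem[/= hx hy] hmax] := compact_EVT_max A0 cA cF.
move: hx hy; rewrite !in_itv /= => hx hy.
exists x, y; split => // u v hu hv.
have := hmax (u, v); apply; rewrite inE; split; by rewrite /= in_itv.
Qed.

Lemma ler_sqr_bound (u v : R) : - v <= u <= v -> u ^+ 2 <= v ^+ 2.
Proof.
by move=> huv; rewrite -subr_ge0 subr_sqr mulr_ge0 //; lra.
Qed.

(** An interior maximum of |f| + e |z - w|^2 would make the real part of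
    u f + 2 e conj (z1 - w) (z - z1), for a suitable unit u, drop at least
    quadratically away from z1. *)
Lemma max_modulus f (a b c d M : R) :
  on_rect a b c d (fun z => derivable f z 1) ->
  on_rect a b c d (fun z =>
    complex.Re z = a \/ complex.Re z = b \/ complex.Im z = c \/ complex.Im z = d ->
    nrm (f z) <= M) ->
  on_rect a b c d (fun z => nrm (f z) <= M).
Proof.
move=> df bM x0 y0 hx0 hy0.
have ab : a <= b by lra.
have cd : c <= d by lra.
set w : C := x0 +i* y0.
rewrite leNgt; apply/negP => Mw.
pose D := (b - a) ^+ 2 + (d - c) ^+ 2.
have D0 : 0 <= D by rewrite addr_ge0 // sqr_ge0.
pose e := (nrm (f w) - M) / (2 * (D + 1)).
have e0 : 0 < e by rewrite divr_gt0 ?subr_gt0 // mulr_gt0 // ltr_wpDl.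
have eD : e * D < nrm (f w) - M.
  rewrite /e mulrAC ltr_pdivrMr ?mulr_gt0 ?ltr_wpDl //.
  by rewrite ltr_pM2l ?subr_gt0 //; lra.
pose phi z := nrm (f z) + e * nrm (z - w) ^+ 2.
have cphi : on_rect a b c d (fun z => {for z, continuous phi}).
  move=> x y hx hy.
  have cn : {for (x +i* y : C), continuous (fun z : C => nrm (z - w))}.
    apply: (@continuous_comp C C R (fun z => z - w)); last exact: continuous_nrm.
    apply: derivable_continuousC.
    by apply: derivableCB; [exact: derivableC_id|exact: derivableC_cst].
  apply: (@continuousD R R C (fun z => nrm (f z)) (fun z => e * nrm (z - w) ^+ 2)).
    apply: (@continuous_comp C C R f); last exact: continuous_nrm.
    by apply: derivable_continuousC; exact: df.
  apply: (@continuousM R C (fun=> e)); first exact: (@cst_continuous C R e).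
  exact: (@continuousM R C _ _ _ cn cn).
have [x1 [y1 [hx1 hy1 hmax]]] := rect_max ab cd cphi.
set z1 : C := x1 +i* y1 in hmax.
have hw : nrm (f w) <= phi z1.
  have := hmax x0 y0 hx0 hy0; rewrite {1}/phi -/w subrr nrm0 expr0n /= mulr0 addr0.
  by [].
have z1D : nrm (z1 - w) ^+ 2 <= D.
  by rewrite sqr_nrm /= /D; apply: lerD; apply: ler_sqr_bound; lra.
have inner : ~ (complex.Re z1 = a \/ complex.Re z1 = b \/ complex.Im z1 = c \/ complex.Im z1 = d).
  move=> /(bM x1 y1 hx1 hy1); rewrite -/z1 => hM.
  have : e * nrm (z1 - w) ^+ 2 <= e * D by rewrite ler_pM2l.
  by move: hw; rewrite /phi; lra.
have [ax bx cy dy] : [/\ a < x1, x1 < b, c < y1 & y1 < d].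
  split; rewrite lt_neqAle; apply/andP; split; try lra;
    apply/eqP => hh; apply: inner; rewrite /=.
  - by left.
  - by right; left.
  - by right; right; left.
  - by right; right; right.
pose r := Num.min (Num.min (x1 - a) (b - x1)) (Num.min (y1 - c) (d - y1)).
have r0 : 0 < r by rewrite !lt_min !subr_gt0 ax bx cy dy.
have near_rect z : nrm (z - z1) <= r -> exists x y, [/\ z = x +i* y, a <= x <= b & c <= y <= d].
  case: z => x y hz; exists x, y.
  have := le_trans (ler_Re_nrm _) hz; have := le_trans (ler_Im_nrm _) hz.
  rewrite /= !ler_norml /r !le_min => /andP[].
  have m1 : r <= x1 - a by rewrite /r !ge_min lexx.
  have m2 : r <= b - x1 by rewrite /r !ge_min lexx !orbT.
  have m3 : r <= y1 - c by rewrite /r !ge_min lexx !orbT.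
  have m4 : r <= d - y1 by rewrite /r !ge_min lexx !orbT.
  rewrite -/r; split => //; lra.
(* u = 0 when f z1 = 0, which is just as good. *)
pose u : C := (f z1)^*%C / (nrm (f z1))%:C.
have nu : nrm u <= 1.
  rewrite /u nrmM nrmV nrmJ nrmR ger0_norm ?nrm_ge0 //.
  by have [->|n0] := eqVneq (nrm (f z1)) 0; rewrite ?mul0r // divff.
have uf : u * f z1 = (nrm (f z1))%:C.
  have [f0|f0] := eqVneq (f z1) 0; first by rewrite /u f0 mulr0 nrm0.
  have n0 : (nrm (f z1))%:C != 0 by rewrite -nrmE normr_eq0.
  by rewrite /u mulrAC [_ * f z1]mulrC -sqr_normc nrmE expr2 mulfK.
pose k : C := 2%:R * e%:C * (z1 - w)^*%C.
pose q (z : C) : C := u * f z + k * (z - z1).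
apply: (@no_strict_max q z1 r e r0 e0).
  move=> z /near_rect[x [y [-> hx hy]]].
  apply: (@derivableCD R (fun z => u * f z) (fun z => k * (z - z1))).
    apply: (@derivableCM R (fun=> u) f); [exact: derivableC_cst|exact: df].
  apply: (@derivableCM R (fun=> k) (fun z => z - z1)); first exact: derivableC_cst.
  by apply: derivableCB; [exact: derivableC_id|exact: derivableC_cst].
move=> z /near_rect[x [y [zE hx hy]]].
have := hmax x y hx hy; rewrite -zE => hz.
have h1 : complex.Re (u * f z) <= nrm (f z).
  apply: le_trans (ler_norm _) _; apply: le_trans (ler_Re_nrm _) _.
  by rewrite nrmM ler_piMl ?nrm_ge0.
have qz1 : complex.Re (q z1) = nrm (f z1) by rewrite /q uf subrr mulr0 addr0.
have qz : complex.Re (q z) = complex.Re (u * f z) +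
   e * (nrm (z - w) ^+ 2 - nrm (z1 - w) ^+ 2 - nrm (z - z1) ^+ 2).
  rewrite !sqr_nrm /q zE /z1 /w [complex.Re (_ + _)]raddfD /=; congr (_ + _).
  by ring.
by rewrite qz qz1; move: hz; rewrite /phi; lra.
Qed.

(** If h vanishes near c, then h / (z - c)^n is differentiable at c as well,
    and the maximum principle bounds h w by a multiple of (|w - c| / L)^n. *)
Theorem vanishing_near h c (L rho : R) : 0 < L -> 0 < rho ->
  on_rect (complex.Re c - L) (complex.Re c + L) (complex.Im c - L) (complex.Im c + L)
    (fun z => derivable h z 1) ->
  (forall z, nrm (z - c) < rho -> h z = 0) ->
  forall w, nrm (w - c) < L -> h w = 0.
Proof.
move=> L0 rho0 dh h0 w wL.
set a := complex.Re c - L in dh; set b := complex.Re c + L in dh.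
set a' := complex.Im c - L in dh; set b' := complex.Im c + L in dh.
have [wc|wc] := eqVneq w c; first by apply: h0; rewrite wc subrr nrm0.
have ab : a <= b by rewrite /a /b; lra.
have ab' : a' <= b' by rewrite /a' /b'; lra.
have cnh : on_rect a b a' b' (fun z => {for z, continuous (fun z => nrm (h z))}).
  move=> x y hx hy.
  apply: (@continuous_comp C C R h); last exact: continuous_nrm.
  by apply: derivable_continuousC; exact: dh.
have [x1 [y1 [_ _ hM]]] := rect_max ab ab' cnh.
set M := nrm (h (x1 +i* y1)) in hM.
pose fn n z := h z * (L%:C ^+ n * ((z - c) ^+ n)^-1).
have key n : nrm (h w) <= M * (nrm (w - c) / L) ^+ n.
  have wn0 : 0 < nrm (w - c) by rewrite nrm_gt0 subr_eq0.
  have dfn : on_rect a b a' b' (fun z => derivable (fn n) z 1).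
    move=> x y hx hy; have [zc|zc] := eqVneq (x +i* y : C) c.
      have dz : derivable (fun=> 0 : C) (x +i* y : C) 1 by exact: derivableC_cst.
      have nz : \forall z \near (x +i* y : C), (0 : C) = fn n z.
        apply/near_nrmP; exists rho => // z; rewrite zc => /h0 hz.
        by rewrite /fn hz mul0r.
      exact: near_eq_derivable nz dz.
    apply: derivableCM; first exact: dh.
    apply: derivableCM; first exact: derivableC_cst.
    apply: derivableCV; first by rewrite expf_neq0 // subr_eq0.
    apply: derivableCX; apply: derivableCB; [exact: derivableC_id|exact: derivableC_cst].
  have bfn : on_rect a b a' b' (fun z =>
    complex.Re z = a \/ complex.Re z = b \/ complex.Im z = a' \/ complex.Im z = b' ->
    nrm (fn n z) <= M).
    move=> x y hx hy /= hb.
    have hL : L <= nrm ((x +i* y : C) - c).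
      have t1 := ler_Re_nrm ((x +i* y : C) - c).
      have t2 := ler_Im_nrm ((x +i* y : C) - c).
      move: t1 t2; rewrite !raddfB /= !ler_norml.
      by case: hb => [|[|[|]]] ->; rewrite /a /b /a' /b'; lra.
    rewrite /fn nrmM; apply: (@le_trans _ _ (nrm (h (x +i* y)) * 1)).
      apply: ler_wpM2l; first exact: nrm_ge0.
      have n0 : 0 < nrm ((x +i* y : C) - c) by exact: lt_le_trans hL.
      rewrite nrmM nrmV !nrmX nrmR (gtr0_norm L0) ler_pdivrMr ?exprn_gt0 // mul1r.
      by rewrite lerXn2r ?nnegrE // ?nrm_ge0 // ltW.
    by rewrite mulr1; exact: hM.
  have := max_modulus dfn bfn; case: w wc wL wn0 => x y wc wL wn0.
  move=> /(_ x y) hw; rewrite mulrC expr_div_n.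
  rewrite -ler_pdivrMl ?divr_gt0 ?exprn_gt0 // invf_div.
  apply: le_trans (hw _ _).
  - rewrite /fn nrmM nrmM nrmV !nrmX nrmR (gtr0_norm L0) mulrC; exact: lexx.
  - have := le_lt_trans (ler_Re_nrm _) wL; rewrite raddfB /= ltr_norml /a /b; lra.
  - have := le_lt_trans (ler_Im_nrm _) wL; rewrite raddfB /= ltr_norml /a' /b'; lra.
apply/eqP; rewrite -nrm_eq0 eq_le nrm_ge0 andbT.
have t1 : `|nrm (w - c) / L| < 1.
  by rewrite ger0_norm ?divr_ge0 ?nrm_ge0 // ?ltW // ltr_pdivrMr // mul1r.
have cv : M * (nrm (w - c) / L) ^+ n @[n --> \oo] --> M * 0.
  by apply: cvgM; [exact: cvg_cst|exact: cvg_expr].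
rewrite mulr0 in cv.
rewrite -(cvg_lim _ cv) //; apply: limr_ge; first by apply/cvg_ex; exists 0.
by near=> n; exact: key.
Unshelve. all: by end_near.
Qed.

End IdentityTheorem.

(** * Exponential decay and Taylor remainders *)

Section ExponentialBounds.
Variable R : realType.
Local Notation C := (R[i]^o).
Local Notation mu := (@lebesgue_measure R).
Implicit Types (a k : R) (f : R -> C).

Lemma integral_expR_tail a k : 0 < k ->
  mu.-integrable `[a, +oo[ (EFin \o (fun t : R => expR (- (k * t)))) /\
  \int[mu]_(t in `[a, +oo[) expR (- (k * t)) = expR (- (k * a)) / k.
Proof.
move=> k0; pose P (t : R) := - (expR (- (k * t)) / k).
have dE (t : R) : is_derive t (1 : R) (fun t : R => expR (- (k * t))) (- k * expR (- (k * t))).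
  have dk : is_derive t (1 : R) (fun t : R => - (k * t)) (- k).
    by apply: is_derive_eq; rewrite /GRing.scale /= ?mulr1 ?mulr0 ?addr0.
  exact: is_derive_eq (is_derive1_comp (is_derive_expR _) dk) (mulrC _ _).
have dP (t : R) : is_derive t (1 : R) P (expR (- (k * t))).
  rewrite /P; apply: is_derive_eq.
  by rewrite /GRing.scale /= mulr0 add0r; field; rewrite gt_eqF.
have cE (t : R) : {for t, continuous (fun t : R => expR (- (k * t)))}.
  by apply: differentiable_continuous; apply/derivable1_diffP; have := dE t.
have cP (t : R) : {for t, continuous P}.
  by apply: differentiable_continuous; apply/derivable1_diffP; have := dP t.
have Pl : P x @[x --> +oo] --> (0 : R).
  rewrite -oppr0; apply: cvgN; rewrite -(mul0r k^-1); apply: cvgM; last exact: cvg_cst.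
  apply: (@cvg_comp _ _ _ (fun x : R => k * x) (fun y => expR (- y)) _ +oo); last exact: cvgr_expR.
  by apply: gt0_cvgMry => //; exact: cvg_id.
have hI := @ge0_continuous_FTC2y R (fun t => expR (- (k * t))) P a 0.
have {}hI : (\int[mu]_(x in `[a, +oo[) (expR (- (k * x)))%:E = 0%:E - (P a)%:E)%E.
  apply: hI => //.
  - by apply: continuous_in_subspaceT => x _; exact: cE.
  - by apply: cvg_at_right_filter; exact: cP.
  - by move=> x _; rewrite derive1E; case: (dP x).
split.
  apply/integrableP; split.
    apply/measurable_EFinP; apply: subspace_continuous_measurable_fun => //.
    by apply: continuous_in_subspaceT => x _; exact: cE.
  under eq_integral => t _ do rewrite /= ger0_norm ?expR_ge0 //.
  by rewrite hI -EFinD ltry.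
by rewrite /Rintegral hI -EFinD /= /P sub0r opprK.
Qed.

Lemma cintegrable_expR a k (M : R) f : 0 < k ->
  (forall t, a <= t -> {for t, continuous f}) ->
  (forall t, a <= t -> nrm (f t) <= M * expR (- (k * t))) ->
  cintegrable `[a, +oo[ f /\
  nrm (cintegral `[a, +oo[ f) <= M * expR (- (k * a)) / k.
Proof.
move=> k0 cf fM.
have [i1 i2] := integral_expR_tail a k0.
have i3 : mu.-integrable `[a, +oo[ (EFin \o (fun t : R => M * expR (- (k * t)))).
  by apply: eq_integrable (integrableZl _ M i1).
have fM' t : `[a, +oo[%classic t -> nrm (f t) <= M * expR (- (k * t)).
  by rewrite /= in_itv /= andbT; exact: fM.
have hf : cintegrable `[a, +oo[ f.
  apply: cintegrable_dominated i3 fM' => //;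
    apply: subspace_continuous_measurable_fun => //;
    apply: continuous_in_subspaceT => t /set_mem /=; rewrite in_itv /= andbT => ht.
    by have [] := continuous_ReIm (cf t ht).
  by have [] := continuous_ReIm (cf t ht).
split=> //; apply: le_trans (cintegral_nrm_le _ hf i3 fM') _ => //.
by rewrite RintegralZl // i2 mulrA.
Qed.

Lemma expR_ge_sqr (x : R) : 0 <= x -> x ^+ 2 / 2 <= expR x.
Proof.
by move=> x0; have := @expR_ge1Dxn R x 1 x0; rewrite (_ : 2`! = 2)%N //; lra.
Qed.

Lemma expRN_le_inv2 (x : R) : 0 < x -> expR (- x) <= 2 / x ^+ 2.
Proof.
move=> x0; rewrite expRN -[leRHS]invf_div lef_pV2 ?posrE ?expR_gt0 //.
  exact/expR_ge_sqr/ltW.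
by rewrite divr_gt0 // exprn_gt0.
Qed.

Lemma nrm_small_eq0 (z : C) (D a : R) :
  (forall N, a <= N -> 0 < N -> nrm z <= D / N) -> z = 0.
Proof.
move=> h; apply/eqP; rewrite -nrm_eq0 eq_le nrm_ge0 andbT.
apply/ler_addgt0Pl => e e0; rewrite addr0.
pose N := Num.max (Num.max a 1) (D / e).
have N1 : 1 <= N by rewrite /N !le_max lexx !orbT.
have N0 : 0 < N by apply: lt_le_trans N1.
have aN : a <= N by rewrite /N !le_max lexx.
have DN : D / e <= N by rewrite /N le_max lexx orbT.
apply: le_trans (h N aN N0) _.
by rewrite ler_pdivrMr // mulrC -ler_pdivrMr.
Qed.

(** The integral around [b, N] x [0, N] vanishes, and the sides through
    (N, N) tend to 0 like 1 / N. *)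
Lemma rotate_ray (F : C -> C) (b k p M : R) : 0 < b -> 0 < k -> 0 < p -> 0 <= M ->
  (forall x y : R, b <= x -> 0 <= y -> derivable F (x +i* y : C) 1) ->
  (forall x y : R, b <= x -> 0 <= y ->
    nrm (F (x +i* y)) <= M * expR (- (k * x)) * expR (- (p * y))) ->
  [/\ cintegrable `[b, +oo[ (fun x => F x%:C),
      cintegrable `[0, +oo[ (fun y => F (b +i* y)) &
      cintegral `[b, +oo[ (fun x => F x%:C) =
      'i%C * cintegral `[0, +oo[ (fun y => F (b +i* y))].
Proof.
move=> b0 k0 p0 M0 dF FM.
have cFh (y : R) : 0 <= y -> forall x, b <= x -> {for x, continuous (fun x => F (x +i* y))}.
  by move=> y0 x bx; apply: continuous_h; apply: derivable_continuousC; exact: dF.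
have cFv (x : R) : b <= x -> forall y, 0 <= y -> {for y, continuous (fun y => F (x +i* y))}.
  by move=> bx y y0; apply: continuous_v; apply: derivable_continuousC; exact: dF.
have bh x : b <= x -> nrm (F (x%:C)) <= M * expR (- (k * x)).
  by move=> bx; have := FM x 0 bx (lexx _); rewrite mulr0 oppr0 expR0 mulr1.
have kb y : 0 <= y -> nrm (F (b +i* y)) <= M * expR (- (k * b)) * expR (- (p * y)).
  by move=> y0; exact: FM.
have [ih nh] := @cintegrable_expR b k M (fun x => F x%:C) k0 (cFh 0 (lexx _)) bh.
have [iv nv] := @cintegrable_expR 0 p _ (fun y => F (b +i* y)) p0 (cFv b (lexx _)) kb.
split => //; apply/eqP; rewrite -subr_eq0; apply/eqP.
pose D := 2 * M / k ^+ 3 / b + 2 * M / k ^+ 2 + 2 * M / p ^+ 2 + 2 * M / p ^+ 3 / b.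
apply: (@nrm_small_eq0 _ D b) => N bN N0.
have le1 (c x : R) : 0 < c -> 0 <= x -> expR (- (c * x)) <= 1.
  by move=> c0 x0; rewrite expR_le1 oppr_le0 mulr_ge0 // ltW.
have eN (c : R) : 0 < c -> expR (- (c * N)) <= 2 / c ^+ 2 / N ^+ 2.
  move=> c0; apply: le_trans (expRN_le_inv2 _) _; first by rewrite mulr_gt0.
  by rewrite exprMn invfM mulrA.
have NN : 0 <= N by exact: ltW.
have r0 : rint F b N 0 N = 0.
  by apply: (goursat bN NN) => x y /andP[bx _] /andP[y0 _]; exact: dF.
have hE : hint F 0 b N - 'i%C * vint F b 0 N = hint F N b N - 'i%C * vint F N 0 N.
  apply/eqP; rewrite -subr_eq0 -r0 /rint; apply/eqP; ring.
rewrite (@cintegral_split R _ _ N (fun x => F x%:C)) ?bnd_simp //.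
rewrite (@cintegral_split R _ _ N (fun y => F (b +i* y))) ?bnd_simp //.
set T1 := cintegral `[N, +oo[ _; set T2 := cintegral `[N, +oo[ _.
rewrite -/(hint F 0 b N) -/(vint F b 0 N).
have -> : hint F 0 b N + T1 - 'i%C * (vint F b 0 N + T2) =
   T1 - 'i%C * T2 + (hint F N b N - 'i%C * vint F N 0 N).
  by rewrite -hE; ring.
have n1 : nrm T1 <= M * expR (- (k * N)) / k.
  apply: (@cintegrable_expR N k M (fun x => F x%:C) k0 _ _).2 => x Nx.
    by apply: (cFh 0) => //; exact: le_trans Nx.
  by apply: bh; exact: le_trans Nx.
have n2 : nrm T2 <= M * expR (- (k * b)) * expR (- (p * N)) / p.
  apply: (@cintegrable_expR N p _ (fun y => F (b +i* y)) p0 _ _).2 => y Ny.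
    by apply: cFv => //; exact: le_trans Ny.
  by apply: kb; exact: le_trans Ny.
have n3 : nrm (hint F N b N) <= M * expR (- (p * N)) * (N - b).
  apply: cintegral_nrm_le_segment => // x; rewrite in_itv /= => /andP[bx xN].
    exact: cFh.
  apply: le_trans (FM x N bx NN) _.
  by rewrite ler_wpM2r ?expR_ge0 // ler_piMr // le1 // (le_trans _ bx) // ltW.
have n4 : nrm (vint F N 0 N) <= M * expR (- (k * N)) * (N - 0).
  apply: cintegral_nrm_le_segment => // y; rewrite in_itv /= => /andP[y0 yN].
    exact: cFv.
  apply: le_trans (FM N y bN y0) _.
  by rewrite ler_piMr ?le1 // mulr_ge0 ?expR_ge0.
have ek := eN k k0; have ep := eN p p0.
apply: le_trans (nrmD _ _) _.
apply: le_trans (lerD (nrmB _ _) (nrmB _ _)) _; rewrite !nrmM nrm_i !mul1r.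
have N2 : N ^- 2 <= (b * N)^-1.
  by rewrite lef_pV2 ?posrE ?mulr_gt0 ?exprn_gt0 // expr2 ler_pM2r.
have k3 : 0 <= 2 * M / k ^+ 3 by rewrite divr_ge0 ?mulr_ge0 ?exprn_ge0 // ltW.
have p3 : 0 <= 2 * M / p ^+ 3 by rewrite divr_ge0 ?mulr_ge0 ?exprn_ge0 // ltW.
have -> : D / N = 2 * M / k ^+ 3 * (b * N)^-1 + 2 * M / p ^+ 3 * (b * N)^-1 +
   (2 * M / p ^+ 2 / N + 2 * M / k ^+ 2 / N).
  by rewrite /D; field; rewrite !gt_eqF.
apply: lerD; apply: lerD.
- apply: le_trans n1 _; apply: (@le_trans _ _ (M * (2 / k ^+ 2 / N ^+ 2) / k)).
    by rewrite ler_pM2r ?invr_gt0 // ler_wpM2l.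
  have -> : M * (2 / k ^+ 2 / N ^+ 2) / k = 2 * M / k ^+ 3 * N ^- 2.
    by field; rewrite !gt_eqF.
  exact: ler_wpM2l k3 _ _ N2.
- apply: le_trans n2 _; apply: (@le_trans _ _ (M * (2 / p ^+ 2 / N ^+ 2) / p)).
    rewrite ler_pM2r ?invr_gt0 //; apply: ler_pM; rewrite ?mulr_ge0 ?expR_ge0 //.
    by rewrite ler_piMr // le1 // ltW.
  have -> : M * (2 / p ^+ 2 / N ^+ 2) / p = 2 * M / p ^+ 3 * N ^- 2.
    by field; rewrite !gt_eqF.
  exact: ler_wpM2l p3 _ _ N2.
- apply: le_trans n3 _; apply: (@le_trans _ _ (M * (2 / p ^+ 2 / N ^+ 2) * N)).
    apply: ler_pM; rewrite ?subr_ge0 ?mulr_ge0 ?expR_ge0 //.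
      by rewrite ler_wpM2l.
    by rewrite gerBl ltW.
  by rewrite le_eqVlt; apply/orP; left; apply/eqP; field; rewrite !gt_eqF.
- apply: le_trans n4 _; rewrite subr0.
  apply: (@le_trans _ _ (M * (2 / k ^+ 2 / N ^+ 2) * N)).
    by rewrite ler_pM2r // ler_wpM2l.
  by rewrite le_eqVlt; apply/orP; left; apply/eqP; field; rewrite !gt_eqF.
Qed.

(** The fundamental theorem of calculus on the segment from 0 to w. *)
Lemma nrm_primitive_le (F P : C -> C) (w : C) (M : R) :
  (forall z, is_derive z (1 : C) P (F z)) -> (forall z, derivable F z 1) ->
  (forall z, nrm z <= nrm w -> nrm (F z) <= M) ->
  nrm (P w - P 0) <= M * nrm w.
Proof.
move=> dP dF FM.
have cF (z : C) : {for z, continuous F} by exact/derivable_continuousC.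
have := @cintegral_line R 0 1 0 w F P ler01 (fun t _ => cF _) (fun t _ => dP _).
rewrite /line !add0r mul0r mul1r => <-; rewrite nrmM mulrC.
apply: ler_wpM2r; first exact: nrm_ge0.
rewrite -[leRHS]mulr1 -[X in M * X](subr0 1).
have hl : (fun t : R => F (t%:C * w)) = (fun t => F (line 0 w t)).
  by apply/funext => t; rewrite /line add0r.
under eq_cintegral do rewrite add0r.
apply: cintegral_nrm_le_segment => // t; rewrite in_itv /= => /andP[t0 t1].
  by rewrite hl; apply: continuous_on_line.
by apply: FM; rewrite nrmM nrmR ger0_norm // ler_piMl // nrm_ge0.
Qed.

Lemma nrm_cexp_le (z : C) (r : R) : nrm z <= r -> nrm (cexp z) <= expR r.
Proof.
move=> zr; rewrite nrm_cexp ler_expR; apply: le_trans zr.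
exact: le_trans (ler_norm _) (ler_Re_nrm _).
Qed.

Lemma is_deriveCB (f g : C -> C) (z df dg : C) : is_derive z (1 : C) f df ->
  is_derive z (1 : C) g dg -> is_derive z (1 : C) (fun w => f w - g w) (df - dg).
Proof. by move=> hf hg; exact: is_deriveB. Qed.

Lemma is_deriveCXn (n : nat) (k z : C) :
  is_derive z (1 : C) (fun w : C => k * w ^+ n.+1) (k * (n.+1%:R * z ^+ n)).
Proof.
have h : is_derive z (1 : C) (fun w : C => w ^+ n.+1) (n.+1%:R * z ^+ n).
  apply: DeriveDef; first exact: exprn_derivable.
  by rewrite exp_derive /GRing.scale /= mulr1.
have hk : is_derive z (1 : C) (fun=> k) (0 : C) by exact: is_derive_cst.
apply: is_derive_eq (is_deriveM hk h) _.
by rewrite /GRing.scale /= mulr0 addr0.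
Qed.

(** The exponential minus the first n terms of its Taylor series. *)
Fixpoint exp_rest (n : nat) (w : C) : C :=
  if n is m.+1 then exp_rest m w - w ^+ m / (m`!)%:R else cexp w.

Lemma exp_rest0 n : exp_rest n.+1 0 = 0.
Proof.
elim: n => [|n IH] /=; first by rewrite cexp0 expr0 divr1 subrr.
by rewrite -/(exp_rest n.+1 0) IH expr0n /= mul0r subr0.
Qed.

Lemma is_derive_exp_rest n (z : C) : is_derive z (1 : C) (exp_rest n.+1) (exp_rest n z).
Proof.
elim: n => [|n IH].
  rewrite /=; have := is_deriveCB (is_derive_cexp z) (@is_derive_cst _ _ _ (1 : C) z (1 : C)).
  rewrite subr0; congr (is_derive _ _ _ _).
  by apply/funext => w; rewrite expr0 divr1.
have := is_deriveCB IH (is_deriveCXn n ((n.+1)`!%:R^-1) z).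
rewrite [X in is_derive _ _ _ X](_ : _ = exp_rest n.+1 z); last first.
  rewrite /=; congr (_ - _); rewrite factS natrM invfM.
  have n0 : (n.+1%:R : C) != 0 by rewrite (@pnatr_eq0 R[i]).
  by rewrite [_^-1 / _]mulrC -mulrA mulKf // mulrC.
by congr (is_derive _ _ _ _); apply/funext => w; rewrite /= [_^-1 * _]mulrC.
Qed.

Lemma derivable_exp_rest n (z : C) : derivable (exp_rest n) z 1.
Proof.
case: n => [|n]; first exact: derivable_cexp.
by have := is_derive_exp_rest n z.
Qed.

(** By induction, as each remainder is a primitive of the one before and
    vanishes at 0. *)
Lemma exp_rest_le n (w : C) : nrm (exp_rest n w) <= nrm w ^+ n * expR (nrm w).
Proof.
suff key r z : nrm z <= r -> nrm (exp_rest n z) <= r ^+ n * expR r by exact: key.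
elim: n r z => [|n IH] r z zr; first by rewrite mul1r; exact: nrm_cexp_le.
have r0 : 0 <= r := le_trans (nrm_ge0 _) zr.
rewrite -[exp_rest n.+1 z]subr0 -(exp_rest0 n).
apply: le_trans (@nrm_primitive_le (exp_rest n) (exp_rest n.+1) z (r ^+ n * expR r)
  (@is_derive_exp_rest n) (@derivable_exp_rest n)
  (fun u hu => IH r u (le_trans hu zr))) _.
by rewrite exprSr [leRHS]mulrAC ler_wpM2l // mulr_ge0 ?expR_ge0 // exprn_ge0.
Qed.

End ExponentialBounds.

(** * The hyperbolic sine *)

Section HyperbolicSine.
Variable R : realType.
Local Notation C := (R[i]^o).
Implicit Types (x y u v : R) (z w t : C).

Definition csinh t : C := (cexp t - cexp (- t)) / 2%:R.

Lemma csinhN t : csinh (- t) = - csinh t.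
Proof. by rewrite /csinh opprK; field. Qed.

Lemma csinhR u : csinh u%:C = (rsinh u)%:C.
Proof.
rewrite /csinh /rsinh /cexp /= oppr0 sin0 cos0.
by split_ReIm; field.
Qed.

Lemma csinhE u v : csinh (u +i* v) =
  (rsinh u * cos v) +i* ((expR u + expR (- u)) / 2 * sin v).
Proof.
rewrite /csinh /rsinh /cexp /= cosN sinN.
by split_ReIm; field.
Qed.

Lemma csinhJ t : csinh (t^*%C) = (csinh t)^*%C.
Proof.
case: t => u v.
by rewrite -[(u +i* v)^*%C]/(u +i* (- v)) !csinhE cosN sinN mulrN.
Qed.

Lemma csinh_i v : csinh (0 +i* v) = 'i%C * (sin v)%:C.
Proof.
rewrite csinhE /rsinh oppr0 expR0.
by split_ReIm; field.
Qed.

Lemma sqr_nrm_csinh u v : nrm (csinh (u +i* v)) ^+ 2 = rsinh u ^+ 2 + sin v ^+ 2.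
Proof.
rewrite csinhE sqr_nrm /= !exprMn cos2sin2 /rsinh expRN.
by field; rewrite gt_eqF ?expR_gt0.
Qed.

Lemma nrm_csinh_ge_re u v : `|rsinh u| <= nrm (csinh (u +i* v)).
Proof.
rewrite -(@ler_pXn2r _ 2) ?nnegrE ?nrm_ge0 // sqr_nrm_csinh real_normK ?num_real //.
by rewrite lerDl sqr_ge0.
Qed.

Lemma nrm_csinh_ge_im u v : `|sin v| <= nrm (csinh (u +i* v)).
Proof.
rewrite -(@ler_pXn2r _ 2) ?nnegrE ?nrm_ge0 // sqr_nrm_csinh real_normK ?num_real //.
by rewrite lerDr sqr_ge0.
Qed.

Lemma rsinhN u : rsinh (- u) = - rsinh u.
Proof. by rewrite /rsinh opprK -mulNr opprB. Qed.

Lemma rsinh_ge u : 0 <= u -> u / 2 <= rsinh u.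
Proof.
move=> u0; have h1 := expR_ge1Dx u.
have h2 : expR (- u) <= 1 by rewrite expR_le1 oppr_le0.
by rewrite /rsinh; lra.
Qed.

Lemma rsinh_ge_expR u0 u : u0 <= u -> (1 - expR (- (2 * u0))) / 2 * expR u <= rsinh u.
Proof.
move=> uu; have h : expR (- u) <= expR (- (2 * u0)) * expR u.
  by rewrite -expRD ler_expR; lra.
by rewrite /rsinh; lra.
Qed.

Lemma rsinh_neq0 u : u != 0 -> rsinh u != 0.
Proof.
move=> u0; have [up|un|u0'] := ltgtP u 0; last by rewrite u0' eqxx in u0.
  rewrite -[u]opprK rsinhN oppr_eq0 gt_eqF //.
  by apply: lt_le_trans (rsinh_ge _); lra.
by rewrite gt_eqF //; apply: lt_le_trans (rsinh_ge _); lra.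
Qed.

Lemma csinh_neq0 u v : (u != 0) || (sin v != 0) -> csinh (u +i* v) != 0.
Proof.
move=> h; rewrite -nrm_gt0; case/orP: h => h.
  by apply: lt_le_trans (nrm_csinh_ge_re _ _); rewrite normr_gt0 rsinh_neq0.
by apply: lt_le_trans (nrm_csinh_ge_im _ _); rewrite normr_gt0.
Qed.

Lemma derivable_csinh t : derivable csinh t 1.
Proof.
apply: derivableCM; last exact: derivableC_cst.
apply: derivableCB; first exact: derivable_cexp.
apply: (@derivable_compC R (@cexp R) (fun w => - w)); last exact: derivable_cexp.
exact/derivableCN/derivableC_id.
Qed.

(** sinh t = t + t^3 csinh3 t; the value 1/6 at 0 makes csinh3 entire. *)
Definition csinh3 t : C :=
  if t == 0 then 6%:R^-1 else (exp_rest 3 t - exp_rest 3 (- t)) / (2%:R * t ^+ 3).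

Lemma csinh3E t : csinh t = t * (1 + t ^+ 2 * csinh3 t).
Proof.
rewrite /csinh3; case: eqVneq => [->|t0].
  by rewrite mul0r /csinh oppr0 subrr mul0r.
by rewrite /csinh /= !expr0 !expr1 !factS fact0 /=; field.
Qed.

Lemma csinh3_at0 t : t != 0 ->
  csinh3 t - 6%:R^-1 = (exp_rest 5 t - exp_rest 5 (- t)) / (2%:R * t ^+ 3).
Proof.
move=> t0; rewrite /csinh3 (negbTE t0) [exp_rest 5]lock /= -lock.
rewrite /= !expr0 !expr1 !factS fact0 /=; field => //.
Qed.

Lemma derivable_csinh3 t : derivable csinh3 t 1.
Proof.
have [->|t0] := eqVneq t 0.
  suff h : is_derive (0 : C) (1 : C) csinh3 (0 : C) by [].
  apply/is_deriveCP => e e0; exists (Num.min 1 (e / expR 1)).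
    by rewrite lt_min ltr01 divr_gt0 ?expR_gt0.
  move=> w; rewrite !subr0 mul0r subr0 lt_min => /andP[w1 we].
  have [->|w0] := eqVneq w 0; first by rewrite subrr nrm0 mulr0.
  have wn : 0 < nrm w by rewrite nrm_gt0.
  rewrite {2}/csinh3 eqxx csinh3_at0 // nrmM nrmV nrmM nrmX.
  have -> : nrm (2%:R : C) = 2.
    exact: nrm_nat.
  rewrite ler_pdivrMr ?mulr_gt0 ?exprn_gt0 //.
  have b5 (v : C) : nrm v = nrm w -> nrm (exp_rest 5 v) <= nrm w ^+ 5 * expR 1.
    move=> vw; apply: le_trans (exp_rest_le _ _) _; rewrite vw.
    by rewrite ler_wpM2l ?exprn_ge0 ?nrm_ge0 // ler_expR ltW.
  have h1 := b5 w erefl; have h2 := b5 (- w) (nrmN w).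
  apply: le_trans (nrmB _ _) _; apply: le_trans (lerD h1 h2) _.
  have -> : nrm w ^+ 5 * expR 1 + nrm w ^+ 5 * expR 1 =
     2 * nrm w ^+ 4 * (nrm w * expR 1) by ring.
  have -> : e * nrm w * (2 * nrm w ^+ 3) = 2 * nrm w ^+ 4 * e by ring.
  rewrite ler_pM2l ?mulr_gt0 ?exprn_gt0 //.
  by rewrite -ler_pdivlMr ?expR_gt0 // ltW.
have nz : \forall w \near t, (exp_rest 3 w - exp_rest 3 (- w)) / (2%:R * w ^+ 3) = csinh3 w.
  apply/near_nrmP; exists (nrm t); first by rewrite nrm_gt0.
  move=> w wt; rewrite /csinh3; case: eqVneq wt => // ->.
  by rewrite sub0r nrmN ltxx.
apply: near_eq_derivable nz _.
apply: (@derivableCM R (fun w => exp_rest 3 w - exp_rest 3 (- w)) (fun w => (2%:R * w ^+ 3)^-1)).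
  apply: derivableCB; first exact: derivable_exp_rest.
  apply: (@derivable_compC R (exp_rest 3) (fun w => - w)); last exact: derivable_exp_rest.
  exact/derivableCN/derivableC_id.
apply: (@derivableCV R (fun w => 2%:R * w ^+ 3)).
  by rewrite mulf_neq0 ?expf_neq0 // (@pnatr_eq0 R[i]).
apply: (@derivableCM R (fun=> 2%:R) (fun w => w ^+ 3)); first exact: derivableC_cst.
exact/derivableCX/derivableC_id.
Qed.

(** The entire function sinh t / t. *)
Definition csinhc t : C := 1 + t ^+ 2 * csinh3 t.

Lemma csinhcE t : csinh t = t * csinhc t.
Proof. exact: csinh3E. Qed.

Lemma csinhc0 : csinhc 0 = 1.
Proof. by rewrite /csinhc expr0n mul0r addr0. Qed.

Lemma derivable_csinhc t : derivable csinhc t 1.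
Proof.
apply: derivableCD; first exact: derivableC_cst.
apply: (@derivableCM R (fun w => w ^+ 2) csinh3); last exact: derivable_csinh3.
exact/derivableCX/derivableC_id.
Qed.

Lemma csinhc_neq0 t : (t = 0) \/ (csinh t != 0) -> csinhc t != 0.
Proof.
case=> [->|]; first by rewrite csinhc0 oner_neq0.
by rewrite csinhcE mulf_eq0 negb_or => /andP[].
Qed.

Lemma csinhD_ipi t : csinh (t + 'i%C * pi%:C) = - csinh t.
Proof.
rewrite /csinh opprD !cexpD cexpN [cexp (- ('i%C * _))]cexpN.
have -> : cexp ('i%C * pi%:C) = -1 :> C.
  have -> : 'i%C * pi%:C = 0 +i* pi :> C.
    by split_ReIm; ring.
  rewrite /cexp /= expR0 cospi sinpi.
  by split_ReIm; ring.
have h := cexp_neq0 t; field => //.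
Qed.

End HyperbolicSine.

(** * Simple poles *)

Section Poles.
Variable R : realType.
Local Notation C := (R[i]^o).

(** The divided difference of f at p, with value f' at p itself, is
    continuous at p. *)
Lemma dd_continuous (f : C -> C) (p : C) : derivable f p 1 -> exists G : C -> C,
  {for p, continuous G} /\ forall z, z != p -> G z = (f z - f p) / (z - p).
Proof.
move=> /derivableP; set d := 'D_1 f p => /is_deriveCP hd.
exists (fun z => if z == p then d else (f z - f p) / (z - p)); split; last first.
  by move=> z /negbTE ->.
apply/continuousCP => e e0; have [|r r0 {}hd] := hd (e / 2); first by rewrite divr_gt0.
exists r => // z zr; rewrite eqxx; have [_|zp] := eqVneq z p.
  by rewrite subrr nrm0.
have zp0 : z - p != 0 by rewrite subr_eq0.
have -> : (f z - f p) / (z - p) - d = (f z - f p - d * (z - p)) / (z - p) by field.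
rewrite nrmM nrmV; apply: (@le_lt_trans _ _ (e / 2)).
  by rewrite ler_pdivrMr ?nrm_gt0 //; exact: hd.
by rewrite ltr_pdivrMr // ltr_pMr // ltr1n.
Qed.

Lemma derivable_dd (f G : C -> C) (p z : C) : z != p -> derivable f z 1 ->
  (forall w, w != p -> G w = (f w - f p) / (w - p)) -> derivable G z 1.
Proof.
move=> zp df hG.
have nz : \forall w \near z, (f w - f p) / (w - p) = G w.
  apply/near_nrmP; exists (nrm (z - p)); first by rewrite nrm_gt0 subr_eq0.
  move=> w wz; rewrite hG //; apply: contraTneq wz => ->.
  by rewrite nrmBC ltxx.
apply: near_eq_derivable nz _.
apply: (@derivableCM R (fun w => f w - f p) (fun w => (w - p)^-1)).
  by apply: derivableCB; [exact: df|exact: derivableC_cst].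
apply: (@derivableCV R (fun w => w - p)); first by rewrite subr_eq0.
by apply: derivableCB; [exact: derivableC_id|exact: derivableC_cst].
Qed.

(** Cauchy's formula on a rectangle: the divided difference of f at p has only
    one exceptional point. *)
Lemma rint_simple_pole (f : C -> C) (p : C) (x0 x1 y0 y1 : R) :
  x0 < complex.Re p < x1 -> y0 < complex.Im p < y1 ->
  on_rect x0 x1 y0 y1 (fun z => derivable f z 1) ->
  rint (fun z => f z / (z - p)) x0 x1 y0 y1 =
  f p * rint (fun z => (z - p)^-1) x0 x1 y0 y1.
Proof.
move=> hx hy df.
have x01 : x0 <= x1 by lra.
have y01 : y0 <= y1 by lra.
have dfp : derivable f p 1 by case: p hx hy => a c /= hx hy; apply: df; lra.
have [G [cG hG]] := dd_continuous dfp.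
have bp : on_boundary x0 x1 y0 y1 (fun z => z != p).
  move=> x y xx yy hb; apply/eqP => /(congr1 (fun w : C => (complex.Re w, complex.Im w))).
  by case=> /= ex ey; move: hb => /=; rewrite ex ey; case=> [|[|[|]]]; lra.
have d1 (z : C) : z != p -> derivable (fun z => (z - p)^-1) z 1.
  move=> zp; apply: (@derivableCV R (fun w => w - p)); first by rewrite subr_eq0.
  by apply: derivableCB; [exact: derivableC_id|exact: derivableC_cst].
have c1 : on_boundary x0 x1 y0 y1 (fun z => {for z, continuous (fun z => (z - p)^-1)}).
  by move=> x y xx yy hb; apply/derivable_continuousC/d1/bp.
have c2 : on_boundary x0 x1 y0 y1 (fun z => {for z, continuous (fun z => f z / (z - p))}).
  move=> x y xx yy hb; apply: derivable_continuousC.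
  by apply: derivableCM; [exact: df|exact/d1/bp].
have c3 : on_boundary x0 x1 y0 y1 (fun z => {for z, continuous (fun z => f p * (z - p)^-1)}).
  move=> x y xx yy hb; apply: derivable_continuousC.
  by apply: derivableCM; [exact: derivableC_cst|exact/d1/bp].
have := @goursat_but_one R G x0 x1 y0 y1 p x01 y01 cG.
have hd : on_rect x0 x1 y0 y1 (fun z => z != p -> derivable G z 1).
  by move=> x y xx yy zp; apply: derivable_dd zp _ hG; exact: df.
move=> /(_ hd).
rewrite (@eq_rint R G (fun z => f z / (z - p) - f p * (z - p)^-1)) //; last first.
  by move=> x y xx yy hb; rewrite hG ?bp // mulrBl.
rewrite (rintB x01 y01 c2 c3) (rintZ (f p) x01 y01 c1) => /eqP.
by rewrite subr_eq0 => /eqP.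
Qed.

(** The real and imaginary parts are derivatives of an arctangent and of half a
    logarithm. *)
Lemma cintegral_inv_vertical (b c lo hi : R) : 0 < b -> lo < hi ->
  cintegral `[lo, hi] (fun y => (b +i* (y - c))^-1 : C) =
  (atan ((hi - c) / b) - atan ((lo - c) / b)) +i*
  ((ln (b ^+ 2 + (lo - c) ^+ 2) - ln (b ^+ 2 + (hi - c) ^+ 2)) / 2).
Proof.
move=> b0 lh.
have den (y : R) : 0 < b ^+ 2 + (y - c) ^+ 2.
  by rewrite ltr_pwDl ?exprn_gt0 ?sqr_ge0.
have dsub (y : R) : is_derive y (1 : R) (fun y : R => y - c) 1.
  by apply: is_derive_eq; rewrite subr0.
have dsq (y : R) : is_derive y (1 : R) (fun y : R => b ^+ 2 + (y - c) ^+ 2) (2 * (y - c)).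
  have h := is_deriveX 2 (dsub y).
  have h' : is_derive y (1 : R) (fun=> b ^+ 2) 0 by exact: is_derive_cst.
  apply: is_derive_eq (is_deriveD h' h) _.
  by rewrite add0r /GRing.scale /= mulr1 expr1 mulr_natl.
have cden (y : R) : {for y, continuous (fun y : R => (b ^+ 2 + (y - c) ^+ 2)^-1)}.
  apply: (@continuousV R R (fun y : R => b ^+ 2 + (y - c) ^+ 2)); first by rewrite gt_eqF.
  by apply: differentiable_continuous; apply/derivable1_diffP; have := dsq y.
have csub (y : R) : {for y, continuous (fun y : R => y - c)}.
  by apply: differentiable_continuous; apply/derivable1_diffP; have := dsub y.
have -> : cintegral `[lo, hi] (fun y => (b +i* (y - c))^-1 : C) =
  (\int[lebesgue_measure]_(y in `[lo, hi]) (b * (b ^+ 2 + (y - c) ^+ 2)^-1)) +i*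
  (\int[lebesgue_measure]_(y in `[lo, hi]) (- (y - c) * (b ^+ 2 + (y - c) ^+ 2)^-1)).
  rewrite /cintegral; congr (_ +i* _); apply: eq_Rintegral => y _ /=.
  by rewrite mulNr.
congr (_ +i* _).
- apply: (@Rintegral_primitive R lo hi _ (fun y => atan ((y - c) / b))) => //.
    move=> y _; apply: (@continuousM R R (fun=> b)); last exact: cden.
    exact: (@cst_continuous R R b).
  move=> y _.
  have dd : is_derive y (1 : R) (fun y : R => (y - c) / b) b^-1.
    have h' : is_derive y (1 : R) (fun=> b^-1) 0 by exact: is_derive_cst.
    apply: is_derive_eq (is_deriveM (dsub y) h') _.
    by rewrite /GRing.scale /= mulr0 add0r mulr1.
  apply: is_derive_eq (is_derive1_comp (is_derive1_atan _) dd) _.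
  by have := den y => dn; field; rewrite (gt_eqF b0) gt_eqF.
- rewrite (@Rintegral_primitive R lo hi _ (fun y => - (ln (b ^+ 2 + (y - c) ^+ 2) / 2))) //.
  + by field.
  + move=> y _; apply: (@continuousM R R (fun y => - (y - c))); last exact: cden.
    exact: (@continuousN R R).
  move=> y _.
  have h := @is_derive1_comp R (@ln R) (fun y => b ^+ 2 + (y - c) ^+ 2) y _ _
    (is_derive1_ln (den y)) (dsq y).
  have h' : is_derive y (1 : R) (fun=> 2^-1 : R) 0 by exact: is_derive_cst.
  apply: is_derive_eq (is_deriveN (is_deriveM h h')) _.
  by rewrite /GRing.scale /= mulr0 add0r; have := den y => dn; field; rewrite gt_eqF.
Qed.

End Poles.

(** * The kernel and its principal part at the origin *)

Section Kernel.
Variable R : realType.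
Local Notation C := (R[i]^o).
Variables ap am : R.
Implicit Types (x y : R) (z t : C).

(** Up to the factor (4 i)^-1, and up to a principal part at 0, g z is the
    integral of gker z over the real line. *)
Definition kern (t : C) : C := (t * (csinh (ap%:C * t) * csinh (am%:C * t)))^-1.
Definition gker (z t : C) : C := cexp (2%:R * 'i%C * t * z) * kern t.

Lemma kernN t : kern (- t) = - kern t.
Proof. by rewrite /kern !mulrN !csinhN mulrNN mulNr invrN. Qed.

Lemma kernJ t : kern (t^*%C) = (kern t)^*%C.
Proof.
rewrite /kern conjc_inv; congr (_^-1).
have e (a : R) : a%:C * t^*%C = (a%:C * t)^*%C :> C.
  by case: t => u v; split_ReIm; ring.
rewrite !e !csinhJ {e}.
case: t (csinh _) (csinh _) => u v [u1 v1] [u2 v2].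
by split_ReIm; ring.
Qed.

(** The reflection in the imaginary axis exchanges the two vertical half-lines
    of the contour. *)
Lemma gker_refl z x y : gker z (- x +i* y) = - (gker (z^*%C) (x +i* y))^*%C.
Proof.
rewrite /gker.
have -> : (- x +i* y : C) = - ((x +i* y : C)^*%C).
  by apply/eqP; rewrite eq_complex /= opprK !eqxx.
rewrite kernN kernJ; set E := cexp _; rewrite mulrN {}/E; congr (- _).
have -> : cexp (2%:R * 'i%C * - ((x +i* y : C)^*%C) * z) =
  (cexp (2%:R * 'i%C * (x +i* y) * z^*%C))^*%C :> C.
  rewrite -cexpJ; congr (cexp _); case: z => p q.
  by split_ReIm; ring.
case: (cexp _) (kern _) => u v [u1 v1].
by split_ReIm; ring.
Qed.

Lemma scaleCc (a : R) x y : a%:C * (x +i* y) = (a * x) +i* (a * y) :> C.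
Proof. by split_ReIm; ring. Qed.

Definition regular t := t * (csinh (ap%:C * t) * csinh (am%:C * t)) != 0.

Hypotheses (hap : 0 < ap) (ham : 0 < am).

Lemma regular_re x y : x != 0 -> regular (x +i* y).
Proof.
move=> x0; rewrite /regular !scaleCc; apply: mulf_neq0; last apply: mulf_neq0.
- by apply: contraNneq x0 => /(congr1 (@complex.Re R)) /= ->.
- by apply: csinh_neq0; rewrite mulf_neq0 // gt_eqF.
- by apply: csinh_neq0; rewrite mulf_neq0 // gt_eqF.
Qed.

Lemma regular_im x y : 0 < y -> sin (ap * y) != 0 -> sin (am * y) != 0 ->
  regular (x +i* y).
Proof.
move=> y0 s1 s2; rewrite /regular !scaleCc; apply: mulf_neq0; last apply: mulf_neq0.
- by apply: contraTneq y0 => /(congr1 (@complex.Im R)) /= ->; rewrite ltxx.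
- by apply: csinh_neq0; rewrite s1 orbT.
- by apply: csinh_neq0; rewrite s2 orbT.
Qed.

Lemma derivable_csinhZ (a : R) t : derivable (fun t => csinh (a%:C * t)) t 1.
Proof.
apply: (@derivable_compC R (@csinh R) (fun t => a%:C * t)); last exact: derivable_csinh.
by apply: (@derivableCM R (fun=> a%:C)); [exact: derivableC_cst|exact: derivableC_id].
Qed.

Lemma derivable_csinhcZ (a : R) t : derivable (fun t => csinhc (a%:C * t)) t 1.
Proof.
apply: (@derivable_compC R (@csinhc R) (fun t => a%:C * t)); last exact: derivable_csinhc.
by apply: (@derivableCM R (fun=> a%:C)); [exact: derivableC_cst|exact: derivableC_id].
Qed.

Lemma derivable_expZ z t : derivable (fun t => cexp (2%:R * 'i%C * t * z)) t 1.
Proof.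
apply: (@derivable_compC R (@cexp R) (fun t => 2%:R * 'i%C * t * z)); last exact: derivable_cexp.
apply: (@derivableCM R (fun t => 2%:R * 'i%C * t) (fun=> z)); last exact: derivableC_cst.
by apply: (@derivableCM R (fun=> 2%:R * 'i%C)); [exact: derivableC_cst|exact: derivableC_id].
Qed.

Lemma derivable_gker z t : regular t -> derivable (gker z) t 1.
Proof.
move=> rt; apply: (@derivableCM R (fun t => cexp (2%:R * 'i%C * t * z)) kern).
  exact: derivable_expZ.
apply: (@derivableCV R (fun t => t * (csinh (ap%:C * t) * csinh (am%:C * t)))) => //.
apply: (@derivableCM R (fun t => t)); first exact: derivableC_id.
by apply: derivableCM; exact: derivable_csinhZ.
Qed.

Lemma nrm_expZ z x y : nrm (cexp (2%:R * 'i%C * (x +i* y) * z)) =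
  expR (- (2 * y * complex.Re z) - 2 * x * complex.Im z).
Proof.
by rewrite nrm_cexp; congr expR; case: z => p q /=; ring.
Qed.

Lemma nrm_kern_re x y : 0 < x -> nrm (kern (x +i* y)) <= 4 / (ap * am * x ^+ 3).
Proof.
move=> x0; rewrite /kern nrmV nrmM nrmM !scaleCc.
have h1 : x <= nrm (x +i* y : C) by apply: le_trans (ler_norm x) (ler_Re_nrm (x +i* y)).
have h (a : R) : 0 < a -> a * x / 2 <= nrm (csinh ((a * x) +i* (a * y))).
  move=> a0; apply: le_trans (nrm_csinh_ge_re _ _); apply: le_trans (ler_norm _).
  by apply: rsinh_ge; rewrite mulr_ge0 // ltW.
have -> : 4 / (ap * am * x ^+ 3) = (x * ((ap * x / 2) * (am * x / 2)))^-1.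
  by field; rewrite !gt_eqF.
have p1 : 0 < ap * x / 2 by rewrite divr_gt0 // mulr_gt0.
have p2 : 0 < am * x / 2 by rewrite divr_gt0 // mulr_gt0.
have p0 : 0 < x * (ap * x / 2 * (am * x / 2)) by rewrite !mulr_gt0.
have hh : x * (ap * x / 2 * (am * x / 2)) <=
   nrm (x +i* y : C) * (nrm (csinh ((ap * x) +i* (ap * y))) * nrm (csinh ((am * x) +i* (am * y)))).
  apply: ler_pM => //; [exact: ltW|by rewrite mulr_ge0 // ltW|].
  by apply: ler_pM; [exact: ltW|exact: ltW|exact: h|exact: h].
by rewrite lef_pV2 ?posrE //; exact: lt_le_trans hh.
Qed.

(** This decay compensates the growth of the exponential in the strip
    |Im z| < (ap + am) / 2. *)
Lemma nrm_kern_expR x0 : 0 < x0 -> exists2 M : R, 0 < M &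
  forall x y, x0 <= x -> nrm (kern (x +i* y)) <= M * expR (- ((ap + am) * x)).
Proof.
move=> x00.
pose c (a : R) := (1 - expR (- (2 * (a * x0)))) / 2.
have c0 (a : R) : 0 < a -> 0 < c a.
  by move=> a0; rewrite divr_gt0 // subr_gt0 expR_lt1 oppr_lt0 !mulr_gt0.
have cp := c0 _ hap; have cm := c0 _ ham.
exists (x0 * (c ap * c am))^-1; first by rewrite invr_gt0 mulr_gt0 // mulr_gt0.
move=> x y xx; rewrite /kern nrmV nrmM nrmM !scaleCc.
have xp : 0 < x by exact: lt_le_trans xx.
have h1 : x0 <= nrm (x +i* y : C).
  by apply: le_trans xx _; apply: le_trans (ler_norm x) (ler_Re_nrm (x +i* y)).
have h (a : R) : 0 < a -> c a * expR (a * x) <= nrm (csinh ((a * x) +i* (a * y))).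
  move=> a0; apply: le_trans (nrm_csinh_ge_re _ _); apply: le_trans (ler_norm _).
  by apply: rsinh_ge_expR; rewrite ler_pM2l.
rewrite expRN -invfM mulrDl expRD.
have -> : x0 * (c ap * c am) * (expR (ap * x) * expR (am * x)) =
  x0 * ((c ap * expR (ap * x)) * (c am * expR (am * x))) by ring.
have p1 : 0 < c ap * expR (ap * x) by rewrite mulr_gt0 ?expR_gt0.
have p2 : 0 < c am * expR (am * x) by rewrite mulr_gt0 ?expR_gt0.
have p0 : 0 < x0 * (c ap * expR (ap * x) * (c am * expR (am * x))) by rewrite mulr_gt0 // mulr_gt0.
have hh : x0 * (c ap * expR (ap * x) * (c am * expR (am * x))) <=
   nrm (x +i* y : C) * (nrm (csinh ((ap * x) +i* (ap * y))) * nrm (csinh ((am * x) +i* (am * y)))).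
  apply: ler_pM => //; [exact: ltW|by rewrite mulr_ge0 // ltW|].
  by apply: ler_pM; [exact: ltW|exact: ltW|exact: h|exact: h].
by rewrite lef_pV2 ?posrE //; exact: lt_le_trans hh.
Qed.

(** The value 1/6 at 0 makes the quotient continuous. *)
Definition cexp3 (w : C) : C := if w == 0 then 6%:R^-1 else exp_rest 3 w / w ^+ 3.

Lemma continuous_cexp3_0 : {for (0 : C), continuous cexp3}.
Proof.
apply/continuousCP => e e0; exists (Num.min 1 (e / expR 1)).
  by rewrite lt_min ltr01 divr_gt0 ?expR_gt0.
move=> w; rewrite subr0 lt_min => /andP[w1 we]; rewrite {2}/cexp3 eqxx.
have [->|w0] := eqVneq w 0; first by rewrite /cexp3 eqxx subrr nrm0.
have wn : 0 < nrm w by rewrite nrm_gt0.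
have -> : cexp3 w - 6%:R^-1 = exp_rest 4 w / w ^+ 3.
  rewrite /cexp3 (negbTE w0) [exp_rest 4]lock /= -lock.
  by rewrite /= !expr0 !expr1 !factS fact0 /=; field.
rewrite nrmM nrmV nrmX; apply: (@le_lt_trans _ _ (nrm w * expR 1)).
  rewrite ler_pdivrMr ?exprn_gt0 //; apply: le_trans (exp_rest_le _ _) _.
  have -> : nrm w * expR 1 * nrm w ^+ 3 = nrm w ^+ 4 * expR 1 by ring.
  by rewrite ler_wpM2l ?exprn_ge0 ?nrm_ge0 // ler_expR ltW.
by rewrite -ltr_pdivlMr ?expR_gt0.
Qed.

(** The principal part of gker z at 0. *)
Definition pol0 z t : C := ((ap * am)^-1)%:C * (t ^- 3 + 2%:R * 'i%C * z * t ^- 2 -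
  (2%:R * z ^+ 2 + ((ap ^+ 2 + am ^+ 2) / 6)%:C) * t^-1).

Lemma derivable_pol0 z t : t != 0 -> derivable (pol0 z) t 1.
Proof.
move=> t0; have dX n : derivable (fun t : C => t ^- n) t 1.
  by apply: (@derivableCV R (fun t : C => t ^+ n)); [rewrite expf_neq0|exact/derivableCX/derivableC_id].
apply: (@derivableCM R (fun=> ((ap * am)^-1)%:C)); first exact: derivableC_cst.
apply: (@derivableCB R (fun t => t ^- 3 + 2%:R * 'i%C * z * t ^- 2)
  (fun t => (2%:R * z ^+ 2 + ((ap ^+ 2 + am ^+ 2) / 6)%:C) * t^-1)).
  apply: (@derivableCD R (fun t => t ^- 3)); first exact: dX.
  by apply: (@derivableCM R (fun=> 2%:R * 'i%C * z)); [exact: derivableC_cst|exact: dX].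
apply: (@derivableCM R (fun=> 2%:R * z ^+ 2 + ((ap ^+ 2 + am ^+ 2) / 6)%:C)).
  exact: derivableC_cst.
by apply: (@derivableCV R (fun t : C => t)); [exact: t0|exact: derivableC_id].
Qed.

(** With D the product of the two functions sinh (a t) / (a t), the quotient
    exp (c t) / (t^3 D t) is exp (c t) / t^3 minus P t exp (c t) / (t D t). The
    Taylor remainder of the exponential and a divided difference at 0 then give
    the continuous part. *)
Lemma gker_laurent0 z : exists H : C -> C, {for (0 : C), continuous H} /\
  forall t, t != 0 -> H t = gker z t - pol0 z t.
Proof.
pose c : C := 2%:R * 'i%C * z.
pose D t := csinhc (ap%:C * t) * csinhc (am%:C * t).
pose P t : C := ap%:C ^+ 2 * csinh3 (ap%:C * t) + am%:C ^+ 2 * csinh3 (am%:C * t) +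
   (ap%:C * am%:C) ^+ 2 * t ^+ 2 * (csinh3 (ap%:C * t) * csinh3 (am%:C * t)).
have DP t : D t = 1 + t ^+ 2 * P t by rewrite /D /P /csinhc; ring.
have D0 : D 0 = 1 by rewrite DP expr0n mul0r addr0.
have dD t : derivable D t 1 by apply: derivableCM; exact: derivable_csinhcZ.
have d3 (a : R) t : derivable (fun t => csinh3 (a%:C * t)) t 1.
  apply: (@derivable_compC R (@csinh3 R) (fun t => a%:C * t)); last exact: derivable_csinh3.
  by apply: (@derivableCM R (fun=> a%:C)); [exact: derivableC_cst|exact: derivableC_id].
have dP t : derivable P t 1.
  apply: derivableCD; first apply: derivableCD.
  - by apply: derivableCM; [exact: derivableC_cst|exact: d3].
  - by apply: derivableCM; [exact: derivableC_cst|exact: d3].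
  apply: derivableCM; last by apply: derivableCM; exact: d3.
  apply: derivableCM; first exact: derivableC_cst.
  exact/derivableCX/derivableC_id.
pose W t : C := P t / D t * cexp (2%:R * 'i%C * t * z).
have dW : derivable W 0 1.
  apply: derivableCM; last exact: derivable_expZ.
  apply: derivableCM; first exact: dP.
  by apply: derivableCV; [rewrite D0 oner_neq0|exact: dD].
have [G [cG hG]] := dd_continuous dW.
have W0 : W 0 = ((ap ^+ 2 + am ^+ 2) / 6)%:C.
  rewrite /W D0 /P !mulr0 mul0r cexp0 mulr1 divr1 expr0n mulr0 mul0r addr0 /csinh3 eqxx.
  by rewrite rmorphM rmorphD !rmorphXn fmorphV /= rmorph_nat mulrDl.
pose H0 t : C := ((ap * am)^-1)%:C * (c ^+ 3 * cexp3 (c * t) - G t).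
have cH0 : {for (0 : C), continuous H0}.
  apply: (@continuousM R[i] C (fun=> ((ap * am)^-1)%:C)).
    exact: (@cst_continuous C C).
  apply: (@continuousB R[i] C C (fun t => c ^+ 3 * cexp3 (c * t)) G); last exact: cG.
  apply: (@continuousM R[i] C (fun=> c ^+ 3)).
    exact: (@cst_continuous C C).
  apply: (@continuous_comp C C C (fun t => c * t) cexp3); last first.
    by rewrite mulr0; exact: continuous_cexp3_0.
  apply: derivable_continuousC.
  by apply: (@derivableCM R (fun=> c)); [exact: derivableC_cst|exact: derivableC_id].
(* At a zero of D, which is a pole of gker z, H0 t is not the difference of the
   two conventional values. *)
exists (fun t => if D t == 0 then gker z t - pol0 z t else H0 t); split; last first.
  move=> t t0; case: eqVneq => // Dt.
  have apC : ap%:C != 0 :> C by rewrite (inj_eq (@complexI R)) gt_eqF.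
  have amC : am%:C != 0 :> C by rewrite (inj_eq (@complexI R)) gt_eqF.
  have gE : gker z t = ((ap * am)^-1)%:C * (cexp (c * t) / (t ^+ 3 * D t)).
    rewrite /gker /kern !csinhcE.
    have -> : 2%:R * 'i%C * t * z = c * t by rewrite /c; ring.
    have -> : t * (ap%:C * t * csinhc (ap%:C * t) * (am%:C * t * csinhc (am%:C * t))) =
      (ap%:C * am%:C) * (t ^+ 3 * D t) by rewrite /D; ring.
    rewrite invfM mulrCA; congr (_ * _).
    by rewrite -rmorphM fmorphV.
  have cE : c ^+ 3 * cexp3 (c * t) = (cexp (c * t) - (1 + c * t + c ^+ 2 * t ^+ 2 / 2%:R)) / t ^+ 3.
    have e3 : exp_rest 3 (c * t) = cexp (c * t) - (1 + c * t + c ^+ 2 * t ^+ 2 / 2%:R).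
      by rewrite /= !expr0 !expr1 !factS fact0 /=; field.
    rewrite -e3 /cexp3 mulf_eq0 (negbTE t0) orbF; have [c0|c0] := eqVneq c 0.
      have -> : exp_rest 3 (c * t) = 0 by rewrite c0 mul0r exp_rest0.
      by rewrite c0 expr0n /= !mul0r.
    by field; rewrite t0.
  have GE : G t = (P t / D t * cexp (c * t) - ((ap ^+ 2 + am ^+ 2) / 6)%:C) / t.
    rewrite hG // W0 subr0 /W; congr ((_ * cexp _ - _) / _); rewrite /c; ring.
  rewrite gE /pol0 -mulrBr /H0 cE GE; congr (_ * _).
  have -> : P t = (D t - 1) / t ^+ 2 by rewrite DP; field.
  set k := ((_ + _) / 6)%:C; rewrite /c; set E := cexp _.
  have ii : 'i%C ^+ 2 = -1 :> C by exact: sqr_i.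
  have -> : (2%:R * 'i%C * z) ^+ 2 = - 4%:R * z ^+ 2 :> C.
    by rewrite !exprMn ii; ring.
  by field; rewrite Dt t0.
have cD0 := derivable_continuousC (dD 0).
move: cD0 => /continuousCP /(_ 1 ltr01)[d d0 hd].
have Dn w : nrm w < d -> D w != 0.
  move=> wd; apply/eqP => Dw; have := hd w; rewrite subr0 => /(_ wd).
  by rewrite Dw D0 sub0r nrmN nrm1 ltxx.
apply/continuousCP => e e0.
move/continuousCP: cH0 => /(_ e e0)[d' d'0 hd'].
exists (Num.min d d'); first by rewrite lt_min d0.
move=> w; rewrite lt_min => /andP[w1 w2]; rewrite subr0 in w1.
rewrite (negbTE (Dn w w1)) (negbTE (Dn 0 _)) ?nrm0 //; exact: hd'.
Qed.

End Kernel.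

(** * Integrals over unions and half-lines *)

Section HalfLine.
Variable R : realType.
Local Notation C := (R[i]^o).
Local Notation mu := (@lebesgue_measure R).

Lemma cintegrable_setU (A B : set (measurableTypeR R)) (f : R -> C) :
  measurable A -> measurable B -> [disjoint A & B] ->
  cintegrable A f -> cintegrable B f -> cintegrable (A `|` B) f.
Proof.
move=> mA mB AB.
have aux (h : R -> R) : mu.-integrable A (EFin \o h) -> mu.-integrable B (EFin \o h) ->
    mu.-integrable (A `|` B) (EFin \o h).
  move=> /integrableP[mhA hA] /integrableP[mhB hB].
  have mh : measurable_fun (A `|` B) (EFin \o h) by apply/measurable_funU.
  apply/integrableP; split=> //.
  rewrite ge0_integral_setU //; first exact: lte_add_pinfty.
  exact: measurableT_comp.
by move=> [f1 f2] [g1 g2]; split; exact: aux.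
Qed.

Lemma cintegral_reflect (b : R) (f : R -> C) : 0 <= b ->
  {in `[- b, 0], forall t, {for t, continuous f}} ->
  cintegral `[- b, 0] f = cintegral `[0, b] (fun t => f (- t)).
Proof.
move=> b0 cf.
have aux (h : R -> R) : {within `[- b, 0], continuous h} ->
  \int[mu]_(t in `[- b, 0]) h t = \int[mu]_(t in `[0, b]) h (- t).
  move=> ch; rewrite /Rintegral; congr fine.
  by have := @integration_by_substitution_oppr R h 0 b b0; rewrite oppr0; apply.
rewrite /cintegral; congr (_ +i* _); apply: aux; apply: continuous_in_subspaceT => t /set_mem ht.
  by have [] := continuous_ReIm (cf t ht).
by have [] := continuous_ReIm (cf t ht).
Qed.

Lemma cintegral_inv_sqr (b : R) : 0 < b ->
  cintegrable `[b, +oo[ (fun t => (t%:C) ^- 2) /\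
  cintegral `[b, +oo[ (fun t => (t%:C) ^- 2) = (b^-1)%:C.
Proof.
move=> b0.
have E : (fun t : R => (t%:C) ^- 2 : C) = (fun t => (t ^- 2)%:C).
  by apply/funext => t; rewrite fmorphV rmorphXn.
pose P (t : R) := - t^-1.
have dP (t : R) : 0 < t -> is_derive t (1 : R) P (t ^- 2).
  move=> t0; rewrite /P.
  have h : is_derive t (1 : R) (fun t : R => t^-1) (- t ^- 2).
    apply: DeriveDef; first by apply: derivableV; [rewrite gt_eqF|exact: derivable_id].
    by rewrite deriveV ?gt_eqF // derive_id /GRing.scale /= mulr1.
  by apply: is_derive_eq; rewrite opprK.
have cE (t : R) : 0 < t -> {for t, continuous (fun t : R => t ^- 2)}.
  move=> t0; apply: (@continuousV R R (fun t => t ^+ 2)).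
    by rewrite expf_neq0 // gt_eqF.
  exact: exprn_continuous.
have cP (t : R) : 0 < t -> {for t, continuous P}.
  move=> /dP h; apply: differentiable_continuous; apply/derivable1_diffP; exact: ex_derive.
have Pl : P x @[x --> +oo] --> (0 : R).
  rewrite -oppr0; apply: cvgN.
  apply: (proj1 (@cvgrVy _ _ _ _ (fun x : R => x^-1) _)).
    by near=> x; rewrite invr_gt0; near: x; exact: nbhs_pinfty_gt.
  rewrite (_ : unstable.inv_fun _ = id); first exact: cvg_id.
  by apply/funext => x; exact: invrK.
have hI := @ge0_continuous_FTC2y R (fun t => t ^- 2) P b 0.
have {}hI : (\int[mu]_(x in `[b, +oo[) (x ^- 2)%:E = 0%:E - (P b)%:E)%E.
  apply: hI => //.
  - by move=> x bx; rewrite invr_ge0 exprn_ge0 // (le_trans _ bx) // ltW.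
  - apply: continuous_in_subspaceT => x /set_mem; rewrite /= in_itv /= andbT => bx.
    by apply: cE; exact: lt_le_trans bx.
  - by move=> x bx; have := dP x (lt_trans b0 bx).
  - by apply: cvg_at_right_filter; exact: cP.
  - move=> x; rewrite in_itv /= andbT => bx; rewrite derive1E.
    by case: (dP x (lt_trans b0 bx)).
have iE : mu.-integrable `[b, +oo[ (EFin \o (fun t : R => t ^- 2)).
  apply/integrableP; split.
    apply/measurable_EFinP; apply: subspace_continuous_measurable_fun => //.
    apply: continuous_in_subspaceT => x /set_mem; rewrite /= in_itv /= andbT => bx.
    by apply: cE; exact: lt_le_trans bx.
  under eq_integral => t _ do rewrite /= ger0_norm ?invr_ge0 ?sqr_ge0 //.
  by rewrite hI -EFinD ltry.
rewrite E; split.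
  split => //=; apply: eq_integrable (integrable0 mu _) => //.
rewrite /cintegral /= Rintegral_cst // mul0r /Rintegral hI -EFinD /= /P sub0r opprK.
by [].
Unshelve. all: by end_near. Qed.

End HalfLine.

(** * Turns and half-turns around a pole *)

Section ThreeSides.
Variable R : realType.
Local Notation C := (R[i]^o).
Implicit Types (f g P : C -> C).

(** The integral over the left, top and right sides, from the lower left to the
    lower right corner: a detour around a pole on the lower side. *)
Definition stint f (x0 x1 y0 y1 : R) : C :=
  'i%C * vint f x0 y0 y1 + hint f y1 x0 x1 - 'i%C * vint f x1 y0 y1.

Lemma rint_stint f (x0 x1 y0 y1 : R) :
  rint f x0 x1 y0 y1 = hint f y0 x0 x1 - stint f x0 x1 y0 y1.
Proof. by rewrite /rint /stint; ring. Qed.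

Definition on_three x0 x1 y0 y1 (Q : C -> Prop) :=
  on_rect x0 x1 y0 y1 (fun z => complex.Re z = x0 \/ complex.Re z = x1 \/
    complex.Im z = y1 -> Q z).

Local Notation cont3 x0 x1 y0 y1 f :=
  (on_three x0 x1 y0 y1 (fun z : C => {for z, continuous f})).

Lemma on_three_sides x0 x1 y0 y1 (Q : C -> Prop) : x0 <= x1 -> y0 <= y1 ->
  on_three x0 x1 y0 y1 Q ->
  [/\ forall y, y0 <= y <= y1 -> Q (x0 +i* y), forall x, x0 <= x <= x1 -> Q (x +i* y1) &
      forall y, y0 <= y <= y1 -> Q (x1 +i* y)].
Proof.
move=> hx hy hQ; split => t ht; apply: hQ => //=; rewrite ?lexx ?hx ?hy //.
- by left.
- by right; right.
- by right; left.
Qed.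

Lemma cintegrable_three f x0 x1 y0 y1 : x0 <= x1 -> y0 <= y1 -> cont3 x0 x1 y0 y1 f ->
  [/\ cintegrable `[y0, y1] (fun y => f (x0 +i* y)),
      cintegrable `[x0, x1] (fun x => f (x +i* y1)) &
      cintegrable `[y0, y1] (fun y => f (x1 +i* y))].
Proof.
move=> hx hy /(on_three_sides hx hy)[h1 h2 h3].
split; apply: cintegrable_continuous => t; rewrite in_itv /= => ht.
- by apply: continuous_v; exact: h1.
- by apply: continuous_h; exact: h2.
- by apply: continuous_v; exact: h3.
Qed.

Lemma stintD f g x0 x1 y0 y1 : x0 <= x1 -> y0 <= y1 ->
  cont3 x0 x1 y0 y1 f -> cont3 x0 x1 y0 y1 g ->
  stint (fun z => f z + g z) x0 x1 y0 y1 = stint f x0 x1 y0 y1 + stint g x0 x1 y0 y1.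
Proof.
move=> hx hy /(cintegrable_three hx hy)[f1 f2 f3] /(cintegrable_three hx hy)[g1 g2 g3].
rewrite /stint /hint /vint !cintegralD //; ring.
Qed.

Lemma stintB f g x0 x1 y0 y1 : x0 <= x1 -> y0 <= y1 ->
  cont3 x0 x1 y0 y1 f -> cont3 x0 x1 y0 y1 g ->
  stint (fun z => f z - g z) x0 x1 y0 y1 = stint f x0 x1 y0 y1 - stint g x0 x1 y0 y1.
Proof.
move=> hx hy /(cintegrable_three hx hy)[f1 f2 f3] /(cintegrable_three hx hy)[g1 g2 g3].
rewrite /stint /hint /vint !cintegralB //; ring.
Qed.

Lemma stintZ f (k : C) x0 x1 y0 y1 : x0 <= x1 -> y0 <= y1 ->
  cont3 x0 x1 y0 y1 f ->
  stint (fun z => k * f z) x0 x1 y0 y1 = k * stint f x0 x1 y0 y1.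
Proof.
move=> hx hy /(cintegrable_three hx hy)[f1 f2 f3].
rewrite /stint /hint /vint !cintegralZl //; ring.
Qed.

Lemma eq_stint f g x0 x1 y0 y1 : x0 <= x1 -> y0 <= y1 ->
  on_three x0 x1 y0 y1 (fun z => f z = g z) ->
  stint f x0 x1 y0 y1 = stint g x0 x1 y0 y1.
Proof.
move=> hx hy /(on_three_sides hx hy)[h1 h2 h3]; rewrite /stint /hint /vint.
rewrite (@eq_cintegral _ _ _ _ (fun t tab => h1 t _)) ?(@eq_cintegral _ _ _ _ (fun t tab => h2 t _))
  ?(@eq_cintegral _ _ _ _ (fun t tab => h3 t _)) //;
  by move: tab; rewrite /= in_itv.
Qed.

Lemma stint_primitive f P x0 x1 y0 y1 : x0 <= x1 -> y0 <= y1 ->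
  cont3 x0 x1 y0 y1 f ->
  on_three x0 x1 y0 y1 (fun z => is_derive z 1 P (f z)) ->
  stint f x0 x1 y0 y1 = P (x1 +i* y0) - P (x0 +i* y0).
Proof.
move=> hx hy /(on_three_sides hx hy)[c1 c2 c3] /(on_three_sides hx hy)[d1 d2 d3].
have itv (Q : R -> Prop) (a b : R) : (forall t, a <= t <= b -> Q t) -> {in `[a, b], forall t, Q t}.
  by move=> h t; rewrite in_itv /=; exact: h.
rewrite /stint (hint_primitive hx (itv _ _ _ c2) (itv _ _ _ d2)).
rewrite (vint_primitive hy (itv _ _ _ c1) (itv _ _ _ d1)).
rewrite (vint_primitive hy (itv _ _ _ c3) (itv _ _ _ d3)); ring.
Qed.

Lemma is_derive_invX (n : nat) (z : C) : z != 0 ->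
  is_derive z (1 : C) (fun w : C => - (n.+1%:R)^-1 * w ^- n.+1) (z ^- n.+2).
Proof.
move=> z0.
have h := is_deriveCXn n 1 z.
have h' : is_derive z (1 : C) (fun w : C => w ^+ n.+1) (n.+1%:R * z ^+ n).
  by move: h; rewrite mul1r; congr (is_derive _ _ _ _); apply/funext => w; rewrite mul1r.
have zn : z ^+ n.+1 != 0 by rewrite expf_neq0.
have dX : derivable (fun w : C => w ^+ n.+1) z 1 by exact/derivableCX/derivableC_id.
have hV : is_derive z (1 : C) (fun w : C => w ^- n.+1) (- (z ^+ n.+1) ^- 2 * (n.+1%:R * z ^+ n)).
  apply: DeriveDef; first exact: (@derivableCV R (fun w => w ^+ n.+1) z zn dX).
  by rewrite (@deriveV R[i] C (fun w : C => w ^+ n.+1) z 1 zn dX) (@derive_val _ _ _ _ _ _ _ h') scaleCE.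
have hk : is_derive z (1 : C) (fun=> (- (n.+1%:R)^-1 : C)) (0 : C) by exact: is_derive_cst.
apply: is_derive_eq (is_deriveM hk hV) _.
have n0 : (n.+1%:R : C) != 0 by rewrite (@pnatr_eq0 R[i]).
rewrite /GRing.scale /= mulr0 addr0 !exprS; field.
by rewrite expf_neq0 // z0 /= nat1r n0.
Qed.

Lemma inv_left (x y : R) : (- x +i* y)^-1 = - ((x +i* y)^-1)^*%C :> C.
Proof.
have -> : (- x +i* y) = - ((x +i* y)^*%C) :> C by apply/eqP; rewrite eq_complex /= opprK !eqxx.
by rewrite invrN conjc_inv.
Qed.

Lemma inv_top (x y : R) : (x +i* y)^-1 = - 'i%C * ((y +i* x)^-1)^*%C :> C.
Proof.
have -> : (x +i* y) = 'i%C * ((y +i* x)^*%C) :> C.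
  by split_ReIm; ring.
rewrite invfM conjc_inv; congr (_ * _).
by rewrite -[LHS]mulr1 -[X in _ * X](opprK 1) -(sqr_i R) mulrN expr2 mulKf // -nrm_eq0 nrm_i oner_eq0.
Qed.

Lemma inv_bottom (x y : R) : (x +i* - y)^-1 = 'i%C * (y +i* x)^-1 :> C.
Proof.
have -> : (y +i* x) = 'i%C * (x +i* - y) :> C.
  by split_ReIm; ring.
by rewrite invfM mulrA divff ?mul1r // -nrm_eq0 nrm_i oner_eq0.
Qed.

Lemma cintegrable_inv_vertical (b c lo hi : R) : 0 < b ->
  cintegrable `[lo, hi] (fun y => (b +i* (y - c))^-1 : C).
Proof.
move=> b0; have sub (y : R) : (b +i* (y - c)) = b +i* y - (0 +i* c) :> C.
  by apply/eqP; rewrite eq_complex /= subr0 !eqxx.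
apply: (@eq_cintegrable R _ (fun y => (b +i* y - (0 +i* c))^-1)) => // [y _|].
  by rewrite sub.
apply: cintegrable_continuous => y _.
apply: (@continuous_v R (fun t => (t - (0 +i* c))^-1)).
apply: derivable_continuousC; apply: (@derivableCV R (fun t => t - (0 +i* c))).
  rewrite -sub; apply: contraTneq b0 => /(congr1 (@complex.Re R)) /= ->; by rewrite ltxx.
by apply: derivableCB; [exact: derivableC_id|exact: derivableC_cst].
Qed.

(** All the half-sides are rotated or reflected copies of one segment, over
    which the integral of the inverse has the arctangent of 1 as real part. *)
Lemma stint_inv (b : R) : 0 < b ->
  stint (fun t => t^-1) (- b) b 0 b = - ('i%C * pi%:C).
Proof.
move=> b0; rewrite /stint /hint /vint.
have E : (fun y : R => (b +i* (y - 0))^-1 : C) = (fun y => (b +i* y)^-1).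
  by apply/funext => y; rewrite subr0.
have h1 := cintegral_inv_vertical 0 b0 b0.
rewrite subr0 subrr mul0r divff ?gt_eqF // atan0 atan1 E in h1.
have bb : - b < b by lra.
have h2 := cintegral_inv_vertical 0 b0 bb.
rewrite !subr0 mulNr divff ?gt_eqF // atanN atan1 sqrrN subrr mul0r E in h2.
have i1 := @cintegrable_inv_vertical b 0 0 b b0; rewrite E in i1.
have i2 := @cintegrable_inv_vertical b 0 (- b) b b0; rewrite E in i2.
rewrite (@eq_cintegral R _ (fun y => (- b +i* y)^-1) (fun y => - ((b +i* y)^-1)^*%C)); last first.
  by move=> y _; rewrite inv_left.
rewrite (@eq_cintegral R _ (fun x => (x +i* b)^-1) (fun x => - 'i%C * ((b +i* x)^-1)^*%C)); last first.
  by move=> x _; rewrite inv_top.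
rewrite cintegralN //; last exact: cintegrableJ.
rewrite cintegralZl //; last exact: cintegrableJ.
rewrite !cintegralJ // h1 h2.
by split_ReIm; field.
Qed.

Lemma rint_inv (b : R) : 0 < b ->
  rint (fun t => (t - (0 +i* (2 * b)))^-1) (- b) b b (3 * b) = 2%:R * 'i%C * pi%:C.
Proof.
move=> b0; rewrite /rint /hint /vint.
have bb : - b < b by lra.
have b3 : b < 3 * b by lra.
have E : (fun y : R => (b +i* (y - 0))^-1 : C) = (fun y => (b +i* y)^-1).
  by apply/funext => y; rewrite subr0.
have h2 := cintegral_inv_vertical 0 b0 bb.
rewrite !subr0 mulNr divff ?gt_eqF // atanN atan1 sqrrN subrr mul0r E in h2.
have h3 := cintegral_inv_vertical (2 * b) b0 b3.
have e1 : 3 * b - 2 * b = b by ring.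
have e2 : b - 2 * b = - b by ring.
rewrite e1 e2 mulNr divff ?gt_eqF // atanN atan1 sqrrN subrr mul0r in h3.
have i2 := @cintegrable_inv_vertical b 0 (- b) b b0; rewrite E in i2.
have i3 := @cintegrable_inv_vertical b (2 * b) b (3 * b) b0.
have sub (x y u : R) : (x +i* y - (0 +i* u)) = x +i* (y - u) :> C.
  by apply/eqP; rewrite eq_complex /= subr0 !eqxx.
rewrite (@eq_cintegral R _ (fun x => (x +i* b - _)^-1) (fun x => 'i%C * (b +i* x)^-1)); last first.
  by move=> x _; rewrite sub e2 inv_bottom.
rewrite (@eq_cintegral R _ (fun x => (x +i* (3 * b) - _)^-1) (fun x => - 'i%C * ((b +i* x)^-1)^*%C)); last first.
  by move=> x _; rewrite sub e1 inv_top.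
rewrite (@eq_cintegral R _ (fun y => (- b +i* y - _)^-1) (fun y => - ((b +i* (y - 2 * b))^-1)^*%C)); last first.
  by move=> y _; rewrite sub inv_left.
rewrite (@eq_cintegral R _ (fun y => (b +i* y - _)^-1) (fun y => (b +i* (y - 2 * b))^-1)); last first.
  by move=> y _; rewrite sub.
rewrite cintegralN //; last exact: cintegrableJ.
rewrite !cintegralZl //; last exact: cintegrableJ.
rewrite !cintegralJ // h2 h3.
by split_ReIm; field.
Qed.

End ThreeSides.

(** * The closed form in the half-strip *)

Section StripFormula.
Variable R : realType.
Local Notation C := (R[i]^o).
Local Notation mu := (@lebesgue_measure R).
Variables ap am : R.
Hypotheses (hap : 0 < ap) (ham : 0 < am) (hlt : am <= ap / 2).
Local Notation gk := (gker ap am).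
Local Notation p0 := (pol0 ap am).
Implicit Types (x y : R) (z t : C).

(** The zeros i k pi / ap of sinh (ap t) lie at the heights 2 k quarter, half-way
    between the odd multiples of quarter where the contours cross. *)
Definition quarter : R := pi / (2 * ap).
Local Notation b := quarter.

Definition ray z (r : R) : C := 'i%C * cintegral `[r, +oo[ (fun y => gk z (b +i* y)).

(** The integral of gk z over the contour that comes down the line Re t = - b to
    the height r, crosses to Re t = b and goes up again; the first half-line is
    written as the reflection of the last one. *)
Definition staple z (r : R) : C :=
  ray z r - (ray (z^*%C) r)^*%C + hint (gk z) r (- b) b.

Lemma quarter_gt0 : 0 < b.
Proof. by rewrite divr_gt0 ?pi_gt0 // mulr_gt0. Qed.
Local Notation b0 := quarter_gt0.
Local Hint Resolve quarter_gt0 : core.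

Lemma mul_quarter : ap * b = pi / 2.
Proof. by rewrite /quarter; field; rewrite gt_eqF. Qed.
Local Notation apb := mul_quarter.

Lemma mul_am_quarter : am * b <= pi / 4.
Proof.
apply: (@le_trans _ _ (ap / 2 * b)); first by rewrite ler_pM2r.
by rewrite mulrAC apb; lra.
Qed.
Local Notation amb := mul_am_quarter.

Lemma quarter_sym : - b <= b. Proof. by have := b0; lra. Qed.
Local Notation bb := quarter_sym.

Lemma regular_half x y : - b <= x <= b -> 0 <= y <= b -> (x +i* y : C) != 0 ->
  regular ap am (x +i* y).
Proof.
move=> hx /andP[y0 yb] nz; have [x0|x0] := eqVneq x 0; last exact: regular_re.
have {}y0 : 0 < y.
  rewrite lt_neqAle y0 andbT; apply: contraNneq nz => <-; rewrite x0; exact: eqxx.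
have h1 : ap * y <= pi / 2 by rewrite -apb ler_pM2l.
have h2 : am * y <= pi / 4 by apply: le_trans amb; rewrite ler_pM2l.
apply: regular_im => //; rewrite gt_eqF //; apply: sin_gt0_pi; rewrite mulr_gt0 //=.
  by apply: le_lt_trans h1 _; have := pi_gt0 R; lra.
by apply: le_lt_trans h2 _; have := pi_gt0 R; lra.
Qed.

Lemma sin_am_neq0 y : 0 < y <= 3 * b -> sin (am * y) != 0.
Proof.
move=> /andP[y0 yb]; rewrite gt_eqF //; apply: sin_gt0_pi; rewrite mulr_gt0 //=.
apply: (@le_lt_trans _ _ (3 * (am * b))).
  by rewrite mulrCA ler_pM2l.
by have := amb; have := pi_gt0 R; lra.
Qed.

Lemma regular_square x y : - b <= x <= b -> b <= y <= 3 * b ->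
  (x +i* y : C) != 0 +i* (2 * b) -> regular ap am (x +i* y).
Proof.
move=> hx /andP[yb yb3] nz; have [x0|x0] := eqVneq x 0; last exact: regular_re.
have y0 : 0 < y by exact: lt_le_trans b0 yb.
apply: regular_im => //; last by apply: sin_am_neq0; rewrite y0.
have [y2|y2|y2] := ltgtP y (2 * b).
- rewrite gt_eqF //; apply: sin_gt0_pi; rewrite mulr_gt0 //=.
  have -> : pi = ap * (2 * b) by rewrite mulrCA apb; field.
  by rewrite ltr_pM2l.
- have e : ap * y = ap * (y - 2 * b) + pi by rewrite mulrBr mulrCA [2 * (ap * b)]mulrC apb; field.
  rewrite e sinDpi oppr_eq0 gt_eqF //; apply: sin_gt0_pi; rewrite mulr_gt0 ?subr_gt0 //=.
  apply: (@le_lt_trans _ _ (ap * b)); last by rewrite apb; have := pi_gt0 R; lra.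
  by rewrite ler_pM2l //; have := b0; lra.
- by rewrite x0 y2 eqxx in nz.
Qed.

Lemma derivable_gker_re z x y : x != 0 -> derivable (gk z) (x +i* y : C) 1.
Proof. by move=> x0; apply: derivable_gker; exact: regular_re. Qed.

Lemma continuous_gker_v z x y : x != 0 -> {for y, continuous (fun y => gk z (x +i* y))}.
Proof.
by move=> x0; apply: continuous_v; apply: derivable_continuousC; exact: derivable_gker_re.
Qed.

Lemma nrm_gker_ray z y : nrm (gk z (b +i* y)) <=
  4 / (ap * am * b ^+ 3) * expR (2 * b * `|complex.Im z|) * expR (- (2 * complex.Re z * y)).
Proof.
rewrite nrmM nrm_expZ mulrC -[leRHS]mulrA; apply: ler_pM; rewrite ?nrm_ge0 ?expR_ge0 //.
  exact: nrm_kern_re.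
rewrite -expRD ler_expR; have h : - complex.Im z <= `|complex.Im z| by rewrite -normrN ler_norm.
have : b * - complex.Im z <= b * `|complex.Im z| by rewrite ler_pM2l.
lra.
Qed.

Lemma ray_integrable z (r : R) : 0 < complex.Re z ->
  cintegrable `[r, +oo[ (fun y => gk z (b +i* y)) /\
  nrm (ray z r) <= 4 / (ap * am * b ^+ 3) * expR (2 * b * `|complex.Im z|) *
    expR (- (2 * complex.Re z * r)) / (2 * complex.Re z).
Proof.
move=> z0; rewrite /ray nrmM nrm_i mul1r.
apply: (@cintegrable_expR R r (2 * complex.Re z)); first by rewrite mulr_gt0.
  by move=> y _; apply: continuous_gker_v; rewrite gt_eqF.
by move=> y _; exact: nrm_gker_ray.
Qed.

Lemma ray_split z (r r' : R) : 0 < complex.Re z -> r <= r' ->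
  ray z r = 'i%C * vint (gk z) b r r' + ray z r'.
Proof.
move=> z0 rr; rewrite /ray -mulrDr; congr (_ * _).
apply: cintegral_split; rewrite ?bnd_simp //.
by have [] := ray_integrable r z0.
Qed.

Lemma vint_refl z (r r' : R) : r <= r' ->
  'i%C * vint (gk z) (- b) r r' = ('i%C * vint (gk (z^*%C)) b r r')^*%C.
Proof.
move=> rr.
have hi : cintegrable `[r, r'] (fun y => gk (z^*%C) (b +i* y)).
  by apply: cintegrable_continuous => y _; apply: continuous_gker_v; rewrite gt_eqF.
have -> : vint (gk z) (- b) r r' = - (vint (gk (z^*%C)) b r r')^*%C.
  rewrite /vint -cintegralJ // -cintegralN //; last exact: cintegrableJ.
  by apply: eq_cintegral => y _; exact: gker_refl.
case: (vint _ _ _ _) => u v.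
by split_ReIm; ring.
Qed.

Lemma Re_conj z : complex.Re (z^*%C) = complex.Re z. Proof. by case: z. Qed.
Lemma Im_conj z : complex.Im (z^*%C) = - complex.Im z. Proof. by case: z. Qed.

(** The side of the added rectangle at Re t = - b is the reflection of the one
    at Re t = b. *)
Lemma staple_step z (r r' : R) : 0 < complex.Re z -> r <= r' ->
  staple z r = staple z r' + rint (gk z) (- b) b r r'.
Proof.
move=> z0 rr; rewrite /staple (ray_split z0 rr).
have z0' : 0 < complex.Re (z^*%C) by rewrite Re_conj.
rewrite (ray_split z0' rr) /rint mulrBr (vint_refl z rr).
have conjD (u v : C) : (u + v)^*%C = u^*%C + v^*%C by rewrite -rmorphD.
rewrite conjD; ring.
Qed.

(** At p = i pi / ap the function sinh (ap t) is - ap (t - p) times an entire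
    function, and the other factors of the kernel have no zero in the square. *)
Lemma rint_residue z : rint (gk z) (- b) b b (3 * b) =
  2%:R * 'i%C * pi%:C * (cexp (- ((2 * pi / ap)%:C * z)) / (pi * sin (pi * am / ap))%:C).
Proof.
set p : C := 0 +i* (2 * b).
pose N t : C := - cexp (2%:R * 'i%C * t * z) *
  (t * (ap%:C * csinhc (ap%:C * (t - p)) * csinh (am%:C * t)))^-1.
have app : ap%:C * p = 'i%C * pi%:C.
  rewrite /p scaleCc mulr0 mulrCA apb.
  by split_ReIm; field.
have sE t : csinh (ap%:C * t) = - (ap%:C * (t - p) * csinhc (ap%:C * (t - p))).
  rewrite -csinhcE; have -> : ap%:C * t = ap%:C * (t - p) + 'i%C * pi%:C.
    by rewrite -app; ring.
  by rewrite csinhD_ipi.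
have gE t : gk z t = N t / (t - p).
  rewrite /gker /kern sE /N.
  have -> : t * (- (ap%:C * (t - p) * csinhc (ap%:C * (t - p))) * csinh (am%:C * t)) =
    - (t * (ap%:C * csinhc (ap%:C * (t - p)) * csinh (am%:C * t)) * (t - p)) by ring.
  by rewrite invrN invfM; set E := cexp _; set u := _^-1; set v := _^-1; ring.
have dN : on_rect (- b) b b (3 * b) (fun t => derivable N t 1).
  move=> x y hx hy; set t : C := x +i* y.
  have y0 : 0 < y by case/andP: hy => hy _; exact: lt_le_trans b0 hy.
  have sm : csinh (am%:C * t) != 0.
    rewrite /t scaleCc; apply: csinh_neq0; rewrite sin_am_neq0 ?orbT //.
    by case/andP: hy => _ ->; rewrite y0.
  have sp : csinhc (ap%:C * (t - p)) != 0.
    apply: csinhc_neq0; have [->|tp] := eqVneq t p; first by left; rewrite subrr mulr0.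
    right; have := regular_square hx hy tp; rewrite /regular mulf_eq0 negb_or => /andP[_].
    by rewrite mulf_eq0 negb_or -/t sE => /andP[]; rewrite oppr_eq0 -csinhcE.
  have t0 : t != 0.
    by apply: contraTneq y0 => /(congr1 (@complex.Im R)) /= ->; rewrite ltxx.
  have apC : ap%:C != 0 :> C by rewrite (inj_eq (@complexI R)) gt_eqF.
  apply: (@derivableCM R (fun t => - cexp (2%:R * 'i%C * t * z))
    (fun t => (t * (ap%:C * csinhc (ap%:C * (t - p)) * csinh (am%:C * t)))^-1)).
    by apply: derivableCN; exact: derivable_expZ.
  apply: (@derivableCV R (fun t => t * (ap%:C * csinhc (ap%:C * (t - p)) * csinh (am%:C * t)))).
    by apply: mulf_neq0 => //; apply: mulf_neq0 => //; exact: mulf_neq0.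
  apply: (@derivableCM R (fun t => t)); first exact: derivableC_id.
  apply: (@derivableCM R (fun t => ap%:C * csinhc (ap%:C * (t - p)))); last exact: derivable_csinhZ.
  apply: (@derivableCM R (fun=> ap%:C)); first exact: derivableC_cst.
  apply: (@derivable_compC R (fun t => csinhc (ap%:C * t)) (fun t => t - p)); last exact: derivable_csinhcZ.
  by apply: derivableCB; [exact: derivableC_id|exact: derivableC_cst].
have hp : - b < complex.Re p < b by rewrite /= oppr_lt0 b0.
have hp' : b < complex.Im p < 3 * b by rewrite /=; apply/andP; split; have := b0; lra.
have b3 : b <= 3 * b by have := b0; lra.
rewrite (@eq_rint R (gk z) (fun t => N t / (t - p)) _ _ _ _ quarter_sym b3 (fun x y _ _ _ => gE _)).
rewrite (rint_simple_pole hp hp' dN) (rint_inv b0) mulrC; congr (_ * _).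
rewrite /N subrr mulr0 csinhc0 mulr1.
have -> : 2%:R * 'i%C * p * z = - ((2 * pi / ap)%:C * z).
  rewrite -[p](mulKf (_ : ap%:C != 0)) ?(inj_eq (@complexI R)) ?gt_eqF // app.
  have -> : (2 * pi / ap)%:C = 2%:R * pi%:C * (ap%:C)^-1 :> C.
    by rewrite !rmorphM fmorphV /= rmorph_nat.
  have ii : 'i%C * 'i%C = -1 :> C by rewrite -expr2; exact: sqr_i.
  have -> : 2%:R * 'i%C * ((ap%:C)^-1 * ('i%C * pi%:C)) * z =
    ('i%C * 'i%C) * (2%:R * pi%:C * (ap%:C)^-1 * z) by ring.
  by rewrite ii mulN1r.
have -> : am%:C * p = 0 +i* (am * (2 * b)) by rewrite /p scaleCc mulr0.
rewrite csinh_i /p.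
have -> : am * (2 * b) = pi * am / ap by rewrite /quarter; field; rewrite gt_eqF.
rewrite mulNr -mulrN; congr (_ * _); rewrite -invrN; congr (_^-1).
have pE : pi = ap * (2 * b) by rewrite mulrCA apb; field.
by rewrite {2}pE; split_ReIm; ring.
Qed.

Lemma three_neq0 : on_three (- b) b 0 b (fun t : C => t != 0).
Proof.
move=> x y hx hy hb; apply/eqP => /(congr1 (fun w : C => (complex.Re w, complex.Im w))) /= [ex ey].
by move: hb; rewrite /= ex ey; case=> [|[|]]; have := b0; lra.
Qed.

Lemma cont3_gker z : on_three (- b) b 0 b (fun t => {for t, continuous (gk z)}).
Proof.
move=> x y hx hy hb; apply: derivable_continuousC; apply: derivable_gker.
by apply: regular_half => //; exact: three_neq0.
Qed.

Lemma cont3_pol0 z : on_three (- b) b 0 b (fun t => {for t, continuous (p0 z)}).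
Proof.
move=> x y hx hy hb; apply: derivable_continuousC; apply: derivable_pol0.
exact: three_neq0.
Qed.

Lemma cont3_invX n : on_three (- b) b 0 b (fun t : C => {for t, continuous (fun t : C => t ^- n)}).
Proof.
move=> x y hx hy hb; apply: derivable_continuousC.
apply: (@derivableCV R (fun t : C => t ^+ n)); last exact/derivableCX/derivableC_id.
by rewrite expf_neq0 //; exact: three_neq0.
Qed.

Lemma stint_invX n : stint (fun t : C => t ^- n.+2) (- b) b 0 b =
  - (n.+1%:R)^-1 * (b%:C ^- n.+1 - (- b)%:C ^- n.+1).
Proof.
rewrite (@stint_primitive R _ (fun w : C => - (n.+1%:R)^-1 * w ^- n.+1) _ _ _ _ bb
  (ltW b0) (@cont3_invX n.+2)) ?mulrBr //.
by move=> x y hx hy hb; apply: is_derive_invX; exact: three_neq0.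
Qed.

Lemma stint_pol0 z : stint (p0 z) (- b) b 0 b =
  ((ap * am)^-1)%:C * (- (4%:R * 'i%C * z / b%:C) +
    'i%C * pi%:C * (2%:R * z ^+ 2 + ((ap ^+ 2 + am ^+ 2) / 6)%:C)).
Proof.
set k := ((ap ^+ 2 + am ^+ 2) / 6)%:C.
have cst (c : C) n : on_three (- b) b 0 b (fun t : C => {for t, continuous (fun t : C => c * t ^- n)}).
  move=> x y hx hy hb; apply: (@continuousM R[i] C (fun=> c)).
    exact: (@cst_continuous C C).
  exact: (@cont3_invX n x y hx hy hb).
rewrite (@eq_stint R (p0 z) (fun t => ((ap * am)^-1)%:C *
  (t ^- 3 + (2%:R * 'i%C * z * t ^- 2 + - (2%:R * z ^+ 2 + k) * t ^- 1)))
  _ _ _ _ bb (ltW b0)); last first.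
  by move=> x y _ _ _; rewrite /pol0 -/k expr1 mulNr addrA.
have c1 : on_three (- b) b 0 b (fun t : C => {for t, continuous (fun t : C =>
   (2%:R * 'i%C * z * t ^- 2 + - (2%:R * z ^+ 2 + k) * t ^- 1 : C))}).
  move=> x y hx hy hb; apply: (@continuousD R[i] C C (fun t => 2%:R * 'i%C * z * t ^- 2)).
    exact: (cst _ 2 x y hx hy hb).
  exact: (cst _ 1 x y hx hy hb).
have c0 : on_three (- b) b 0 b (fun t : C => {for t, continuous (fun t : C =>
   (t ^- 3 + (2%:R * 'i%C * z * t ^- 2 + - (2%:R * z ^+ 2 + k) * t ^- 1) : C))}).
  move=> x y hx hy hb; apply: (@continuousD R[i] C C (fun t => t ^- 3)).
    exact: (@cont3_invX 3 x y hx hy hb).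
  exact: (c1 x y hx hy hb).
have b0' := ltW b0.
rewrite (stintZ _ bb b0' c0) (stintD bb b0' (@cont3_invX 3) c1) (stintD bb b0' (cst _ 2) (cst _ 1)).
rewrite (stintZ _ bb b0' (@cont3_invX 2)) (stintZ _ bb b0' (@cont3_invX 1)) !stint_invX.
rewrite (_ : stint (fun t : C => t ^- 1) (- b) b 0 b = - ('i%C * pi%:C)); last first.
  by rewrite -(stint_inv b0); congr (stint _ _ _ _ _); apply/funext => t; rewrite expr1.
have bC : b%:C != 0 :> C by rewrite (inj_eq (@complexI R)) gt_eqF.
rewrite rmorphN /=; congr (_ * _); field => //.
Qed.

(** The two exponentials of the sine are those of the kernel at t and - t. *)
Lemma g_integrandE z (t : R) : 0 < t -> g_integrand ap am z t =
  (4%:R * 'i%C)^-1 * (gk z t%:C + gk z (- t%:C)) -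
  ((ap * am)^-1)%:C * z * t%:C ^- 2.
Proof.
move=> t0; rewrite /g_integrand /csin /gker kernN.
have kE : kern ap am t%:C = ((t * (rsinh (ap * t) * rsinh (am * t)))^-1)%:C.
  rewrite /kern -[ap%:C * t%:C]rmorphM -[am%:C * t%:C]rmorphM !csinhR.
  by rewrite -!rmorphM fmorphV.
have -> : (0 +i* 1) * (2 * t%:C * z) = 2%:R * 'i%C * t%:C * z :> C by ring.
have -> : 2%:R * 'i%C * - t%:C * z = - (2%:R * 'i%C * t%:C * z) :> C by ring.
set E := cexp _; set E' := cexp _; rewrite kE.
have s1 : rsinh (ap * t) != 0 by rewrite rsinh_neq0 // gt_eqF // mulr_gt0.
have s2 : rsinh (am * t) != 0 by rewrite rsinh_neq0 // gt_eqF // mulr_gt0.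
set S1 := rsinh (ap * t) in kE s1 *; set S2 := rsinh (am * t) in kE s2 *.
clearbody S1 S2.
have nz (x : R) : x != 0 -> x%:C != 0 :> C by rewrite (inj_eq (@complexI R)).
have c1 := nz _ s1; have c2 := nz _ s2.
have c3 := nz _ (lt0r_neq0 t0); have c4 := nz _ (lt0r_neq0 hap).
have c5 := nz _ (lt0r_neq0 ham).
have ci : 'i%C != 0 :> C by rewrite -nrm_eq0 nrm_i oner_eq0.
rewrite !fmorphV !rmorphM /= rmorph_nat -['i%C]/(0 +i* 1) in ci *.
by field; rewrite ?ci ?c1 ?c2 ?c3 ?c4 ?c5.
Qed.

(** The width of the strip is exactly the decay rate of the kernel. *)
Lemma rotate_gker z : 0 < complex.Re z -> `|complex.Im z| < a_ ap am ->
  cintegrable `[b, +oo[ (fun x => gk z x%:C) /\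
  cintegral `[b, +oo[ (fun x => gk z x%:C) = ray z 0.
Proof.
move=> z0 za; have [M M0 hM] := nrm_kern_expR hap ham b0.
pose k := ap + am - 2 * `|complex.Im z|.
have k0 : 0 < k by move: za; rewrite /k /a_; lra.
have p0' : 0 < 2 * complex.Re z by rewrite mulr_gt0.
have [||i1 _ e] := @rotate_ray R (gk z) b k (2 * complex.Re z) M b0 k0 p0' (ltW M0).
- move=> x y bx y0; apply: derivable_gker_re; rewrite gt_eqF //; exact: lt_le_trans b0 bx.
- move=> x y bx y0; rewrite nrmM nrm_expZ; have x0 : 0 < x by exact: lt_le_trans b0 bx.
  have -> : M * expR (- (k * x)) * expR (- (2 * complex.Re z * y)) =
     expR (- (2 * complex.Re z * y) + 2 * `|complex.Im z| * x) * (M * expR (- ((ap + am) * x))).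
    rewrite mulrCA -expRD -[LHS]mulrA -expRD; congr (_ * expR _).
    by rewrite /k; ring.
  apply: ler_pM; rewrite ?expR_ge0 ?nrm_ge0 //; last exact: hM.
  rewrite ler_expR; have h : - complex.Im z <= `|complex.Im z| by rewrite -normrN ler_norm.
  have : x * - complex.Im z <= x * `|complex.Im z| by rewrite ler_pM2l.
  lra.
by split.
Qed.

Lemma gker_neg z (t : R) : gk z (- t%:C) = - (gk (z^*%C) t%:C)^*%C.
Proof.
rewrite -[t%:C]/(t +i* 0) -gker_refl; congr (gk z _).
by apply/eqP; rewrite eq_complex /= oppr0 !eqxx.
Qed.

(** Beyond b the half-line is rotated. Before b the function H, which is
    gk z without its principal part, has the same integral over [- b, b] and over
    the detour above 0; on the detour the principal part has explicit
    primitives, except for half a turn of 1 / t. *)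
Lemma strip_formula_low z : 0 < complex.Re z -> `|complex.Im z| < a_ ap am ->
  g_strip ap am z + (chi_ ap am)%:C + (alpha_ ap am)%:C * z ^+ 2 / 4 =
  (4%:R * 'i%C)^-1 * staple z b.
Proof.
move=> z0 za.
have z0' : 0 < complex.Re (z^*%C) by rewrite Re_conj.
have za' : `|complex.Im (z^*%C)| < a_ ap am by rewrite Im_conj normrN.
have [r1 r2] := rotate_gker z0 za; have [r1' r2'] := rotate_gker z0' za'.
have [H [cH hH]] := gker_laurent0 hap ham z.
have b0' := ltW b0.
have ci : 'i%C != 0 :> C by rewrite -nrm_eq0 nrm_i oner_eq0.
pose A3 : C := ((ap * am)^-1)%:C.
(* G1 is the integrand beyond b, with gk z (- t) written as a reflection. *)
have [q1 q2] := cintegral_inv_sqr b0.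
pose G1 (t : R) : C := (4%:R * 'i%C)^-1 * (gk z t%:C + - (gk (z^*%C) t%:C)^*%C) - A3 * z * t%:C ^- 2.
have mb : measurable (`[b, +oo[%classic : set (measurableTypeR R)) by exact: measurable_itv.
have iJ := cintegrableN mb (cintegrableJ mb r1').
have iS := cintegrableD mb r1 iJ.
have iS4 := cintegrableZl (4%:R * 'i%C)^-1 mb iS.
have iq := cintegrableZl (A3 * z) mb q1.
have iG1 : cintegrable `[b, +oo[ G1 by exact: cintegrableB mb iS4 iq.
have eG1 (t : R) : `[b, +oo[%classic t -> G1 t = g_integrand ap am z t.
  rewrite /= in_itv /= andbT => bt; rewrite g_integrandE ?(lt_le_trans b0 bt) //.
  by rewrite /G1 gker_neg.
have vG1 : cintegral `[b, +oo[ G1 =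
   (4%:R * 'i%C)^-1 * (ray z 0 - (ray (z^*%C) 0)^*%C) - A3 * z / b%:C.
  rewrite (cintegralB mb iS4 iq) (cintegralZl _ mb iS) (cintegralD mb r1 iJ).
  rewrite (cintegralN mb (cintegrableJ mb r1')) (cintegralJ mb r1').
  by rewrite (cintegralZl _ mb q1) r2 r2' q2 fmorphV.
(* G0 extends the integrand continuously to 0, as (4 i)^-1 times the sum of the
   principal parts at t and - t is the subtracted term in t^-2. *)
pose G0 (t : R) : C := (4%:R * 'i%C)^-1 * (H t%:C + H (- t%:C)).
have dH (x y : R) : - b <= x <= b -> 0 <= y <= b -> (x +i* y : C) != 0 -> derivable H (x +i* y : C) 1.
  move=> hx hy nz.
  have nh : \forall w \near (x +i* y : C), gk z w - p0 z w = H w.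
    apply/near_nrmP; exists (nrm (x +i* y : C)); first by rewrite nrm_gt0.
    move=> w wn; rewrite hH //; apply: contraTneq wn => ->.
    by rewrite sub0r nrmN ltxx.
  apply: near_eq_derivable nh _; apply: derivableCB; last exact: derivable_pol0.
  by apply: derivable_gker; exact: regular_half.
have cHr (x : R) : - b <= x <= b -> {for x, continuous (fun x : R => H (x +i* 0))}.
  move=> hx; apply: continuous_h; have [->|x0] := eqVneq x 0; first exact: cH.
  apply: derivable_continuousC; apply: dH => //; first by rewrite lexx.
  by apply: contraNneq x0 => /(congr1 (@complex.Re R)) /= ->.
have iH1 : cintegrable `[0, b] (fun t : R => H t%:C).
  apply: cintegrable_continuous => t; rewrite in_itv /= => /andP[t0 tb].
  by apply: cHr; rewrite tb andbT; apply: le_trans t0; rewrite oppr_le0.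
have negE (t : R) : (- t)%:C = - t%:C :> C by rewrite rmorphN.
have iH2 : cintegrable `[0, b] (fun t : R => H (- t%:C)).
  apply: cintegrable_continuous => t; rewrite in_itv /= => /andP[t0 tb].
  have -> : (fun t : R => H (- t%:C)) = (fun t : R => H ((- t) +i* 0)).
    by apply/funext => s; rewrite -negE.
  have cn : {for - t, continuous (fun x : R => H (x +i* 0))}.
    by apply: cHr; rewrite lerN2 tb; apply: (@le_trans _ _ 0) => //; rewrite oppr_le0.
  exact: (@continuous_comp R R C (fun x : R => - x) (fun x : R => H (x +i* 0)) t
    (@oppr_continuous _ R t) cn).
have m0 : measurable (`[0, b]%classic : set (measurableTypeR R)) by exact: measurable_itv.
have m0' : measurable (`]0, b]%classic : set (measurableTypeR R)) by exact: measurable_itv.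
have iG0 : cintegrable `[0, b] G0 by exact: cintegrableZl m0 (cintegrableD m0 iH1 iH2).
have pol_even (t : C) : t != 0 -> p0 z t + p0 z (- t) = A3 * (4%:R * 'i%C * z * t ^- 2).
  move=> t0; rewrite /pol0 -/A3; have nt0 : - t != 0 by rewrite oppr_eq0.
  by move: ((_ / 6)%:C : C) => k; rewrite -!mulrDr; congr (_ * _); field; rewrite ?nt0 ?t0.
have eG0 (t : R) : `]0, b]%classic t -> G0 t = g_integrand ap am z t.
  rewrite /= in_itv /= => /andP[t0 tb]; rewrite g_integrandE // /G0.
  have tC : t%:C != 0 :> C by rewrite (inj_eq (@complexI R)) gt_eqF.
  rewrite !hH ?oppr_eq0 //.
  have -> : gk z t%:C - p0 z t%:C + (gk z (- t%:C) - p0 z (- t%:C)) =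
     gk z t%:C + gk z (- t%:C) - (p0 z t%:C + p0 z (- t%:C)) by ring.
  have alg (u A w : C) : w != 0 -> (4%:R * 'i%C)^-1 * (u - A * (4%:R * 'i%C * z * w ^- 2)) =
      (4%:R * 'i%C)^-1 * u - A * z * w ^- 2.
    by move=> w0; field; rewrite w0 ci.
  by rewrite pol_even // alg.
have vH : cintegral `[0, b] (fun t : R => H t%:C) + cintegral `[0, b] (fun t : R => H (- t%:C)) =
    stint (gk z) (- b) b 0 b - stint (p0 z) (- b) b 0 b.
  have hh : hint H 0 (- b) b = stint H (- b) b 0 b.
    apply/eqP; rewrite -subr_eq0 -rint_stint; apply/eqP.
    apply: (@goursat_but_one R H (- b) b 0 b 0 bb b0' cH) => x y hx hy nz.
    exact: dH.
  have eH : on_three (- b) b 0 b (fun t => H t = gk z t - p0 z t).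
    by move=> x y hx hy hb; rewrite hH //; exact: three_neq0.
  rewrite (eq_stint bb b0' eH) (stintB bb b0' (@cont3_gker z) (@cont3_pol0 z)) in hh.
  have nb0 : - b <= 0 by rewrite oppr_le0.
  have cc : {in `[- b, b], forall t : R, {for t, continuous (fun x : R => H (x +i* 0))}}.
    by move=> t; rewrite in_itv /=; exact: cHr.
  have c1 : {in `[- b, 0], forall t : R, {for t, continuous (fun x : R => H (x +i* 0))}}.
    by move=> t; rewrite in_itv /= => /andP[t0 tb]; apply: cHr; rewrite t0 (le_trans tb).
  rewrite -hh /hint (cintegral_segment_split nb0 b0' cc) (cintegral_reflect b0' c1) addrC.
  by congr (_ + _); apply: eq_cintegral => t _; rewrite -negE.
have iG0' : cintegrable `]0, b] G0.
  have sub : (`]0, b]%classic : set R) `<=` `[0, b]%classic.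
    by apply: subset_itvr; rewrite bnd_simp.
  by case: iG0 => g1 g2; split; [exact: integrableS m0 m0' sub g1|exact: integrableS m0 m0' sub g2].
have vG0 : cintegral `]0, b] G0 =
   (4%:R * 'i%C)^-1 * (stint (gk z) (- b) b 0 b - stint (p0 z) (- b) b 0 b).
  have -> : cintegral `]0, b] G0 = cintegral `[0, b] G0.
    case: iG0' => g1 g2; rewrite /cintegral.
    by rewrite (Rintegral_itv_obnd_cbnd g1) (Rintegral_itv_obnd_cbnd g2).
  by rewrite (cintegralZl _ m0 (cintegrableD m0 iH1 iH2)) (cintegralD m0 iH1 iH2) vH.
have U : `]0, +oo[%classic = `]0, b]%classic `|` `]b, +oo[%classic :> set R.
  by rewrite -itv_bndbnd_setU ?bnd_simp.
have igs : cintegrable `]0, +oo[ (g_integrand ap am z).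
  rewrite U; apply: cintegrable_setU.
  - exact: measurable_itv.
  - exact: measurable_itv.
  - apply/disj_setPS => y [/=]; rewrite 2!in_itv/= => /andP[_ yx] /andP[].
    by rewrite ltNge yx.
  - exact: eq_cintegrable m0' eG0 iG0'.
  - have iG1' : cintegrable `[b, +oo[ (g_integrand ap am z) by exact: eq_cintegrable mb eG1 iG1.
    have sub : (`]b, +oo[%classic : set R) `<=` `[b, +oo[%classic.
      by apply: subset_itvr; rewrite bnd_simp.
    have mb' : measurable (`]b, +oo[%classic : set (measurableTypeR R)) by exact: measurable_itv.
    by case: iG1' => g1 g2; split; [exact: integrableS mb mb' sub g1|exact: integrableS mb mb' sub g2].
rewrite /g_strip (@cintegral_split R _ _ b) ?bnd_simp //.
rewrite -(eq_cintegral eG0) -(eq_cintegral eG1) vG0 vG1 stint_pol0 -/A3.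
have st : staple z b = ray z 0 - (ray (z^*%C) 0)^*%C + stint (gk z) (- b) b 0 b.
  rewrite /staple (ray_split z0 b0') (ray_split z0' b0') /stint (vint_refl z b0').
  have conjD (u v : C) : (u + v)^*%C = u^*%C + v^*%C by rewrite -rmorphD.
  by rewrite conjD; ring.
rewrite st.
have bC : b%:C != 0 :> C by rewrite (inj_eq (@complexI R)) gt_eqF.
have rE (x : R) (n : nat) : (x / n%:R)%:C = x%:C / n%:R :> C by rewrite rmorphM fmorphV rmorph_nat.
have chiE : (chi_ ap am)%:C = A3 * pi%:C * ((ap ^+ 2 + am ^+ 2) / 6)%:C / 4%:R.
  have -> : chi_ ap am = (ap * am)^-1 * pi * ((ap ^+ 2 + am ^+ 2) / 6) / 4%:R.
    by rewrite /chi_; move: pi => P; field; rewrite !gt_eqF.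
  by rewrite [LHS](rE _ 4%N); congr (_ * _); rewrite /A3 -!rmorphM.
have alE : (alpha_ ap am)%:C = 2%:R * A3 * pi%:C.
  have -> : alpha_ ap am = 2%:R * (ap * am)^-1 * pi by rewrite /alpha_ mulrAC.
  by rewrite /A3; move: (ap * am)^-1 => c; rewrite !rmorphM rmorph_nat.
rewrite chiE alE; move: (((_ + _) / 6)%:C : C) (pi%:C : C) (ray z 0) ((ray _ 0)^*%C) (stint _ _ _ _ _) => k P r1k r2k sk.
have alg (A w u : C) : w != 0 ->
  (4%:R * 'i%C)^-1 * (sk - A * (- (4%:R * 'i%C * z / w) + 'i%C * P * (2%:R * z ^+ 2 + k))) +
   ((4%:R * 'i%C)^-1 * (r1k - r2k) - A * z / w) + A * P * k / 4%:R +
   2%:R * A * P * z ^+ 2 / 4%:R = (4%:R * 'i%C)^-1 * (r1k - r2k + sk).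
  by move=> w0; field; rewrite w0 ci.
exact: alg.
Qed.

(** Lifting the crossing over the pole at i pi / ap adds its residue, the
    leading exponential. *)
Lemma strip_formula z : 0 < complex.Re z -> `|complex.Im z| < a_ ap am ->
  g_strip ap am z + (chi_ ap am)%:C + (alpha_ ap am)%:C * z ^+ 2 / 4 =
  cexp (- ((2 * pi / ap)%:C * z)) / (2 * sin (pi * am / ap))%:C +
  (4%:R * 'i%C)^-1 * staple z (3 * b).
Proof.
move=> z0 za; rewrite (strip_formula_low z0 za).
have b3 : b <= 3 * b by have := b0; lra.
rewrite (staple_step z0 b3) rint_residue mulrDr addrC; congr (_ + _).
have ci : 'i%C != 0 :> C by rewrite -nrm_eq0 nrm_i oner_eq0.
have pC : pi%:C != 0 :> C by rewrite (inj_eq (@complexI R)) gt_eqF // pi_gt0.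
have sC : (sin (pi * am / ap))%:C != 0 :> C.
  rewrite (inj_eq (@complexI R)).
  have -> : pi * am / ap = am * (2 * b) by rewrite /quarter; field; rewrite gt_eqF.
  by apply: sin_am_neq0; have := b0; lra.
rewrite [(2 * sin _)%:C]rmorphM [(pi * sin _)%:C]rmorphM /= [(2 : R)%:C]rmorph_nat; set E := cexp _.
move: E (pi%:C : C) pC ((sin _)%:C : C) sC => E P pC S sC.
by field; rewrite ?ci ?pC ?sC.
Qed.

End StripFormula.

(** * Differentiation under the integral sign *)

Section Holomorphy.
Variable R : realType.
Local Notation C := (R[i]^o).
Local Notation mu := (@lebesgue_measure R).

(** A quadratic bound of the first order remainder of the integrand suffices. *)
Lemma derivable_cintegral (D : set R) (F : C -> R -> C) (F1 : R -> C) (h : R -> R) (z : C) (r : R) :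
  measurable (D : set (measurableTypeR R)) -> 0 < r ->
  (forall w, nrm (w - z) < r -> cintegrable D (F w)) -> cintegrable D F1 ->
  mu.-integrable D (EFin \o h) ->
  (forall w t, nrm (w - z) < r -> D t ->
    nrm (F w t - F z t - (w - z) * F1 t) <= nrm (w - z) ^+ 2 * h t) ->
  derivable (fun w => cintegral D (F w)) z 1.
Proof.
move=> mD r0 iF iF1 ih hF.
suff : is_derive z (1 : C) (fun w => cintegral D (F w)) (cintegral D F1) by [].
apply/is_deriveCP => e e0.
pose I := \int[mu]_(t in D) h t; pose c := `|I| + 1.
have c0 : 0 < c by rewrite ltr_wpDl.
exists (Num.min r (e / c)); first by rewrite lt_min r0 divr_gt0.
move=> w; rewrite lt_min => /andP[wr we].
have zz : nrm (z - z) < r by rewrite subrr nrm0.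
have i1 := iF w wr; have i2 := iF z zz; have i3 := cintegrableZl (w - z) mD iF1.
have i12 := cintegrableB mD i1 i2.
have -> : cintegral D (F w) - cintegral D (F z) - cintegral D F1 * (w - z) =
    cintegral D (fun t => F w t - F z t - (w - z) * F1 t).
  by rewrite (cintegralB mD i12 i3) (cintegralB mD i1 i2) (cintegralZl _ mD iF1) [_ * (w - z)]mulrC.
have ih2 : mu.-integrable D (EFin \o (fun t => nrm (w - z) ^+ 2 * h t)).
  exact: eq_integrable (integrableZl mD (nrm (w - z) ^+ 2) ih).
apply: le_trans (cintegral_nrm_le mD (cintegrableB mD i12 i3) ih2 (fun t => hF w t wr)) _.
rewrite RintegralZl // expr2 mulrAC; apply: ler_wpM2r; first exact: nrm_ge0.
apply: (@le_trans _ _ (nrm (w - z) * c)).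
  by rewrite ler_wpM2l ?nrm_ge0 // /c; apply: le_trans (ler_norm _) _; rewrite lerDl.
by rewrite -ler_pdivlMr //; exact: ltW.
Qed.

Lemma derivableC_conj (f : C -> C) (z : C) : derivable f (z^*%C) 1 ->
  derivable (fun w : C => (f (w^*%C))^*%C : C) z 1.
Proof.
have conjB (u v : C) : (u - v)^*%C = u^*%C - v^*%C by rewrite -rmorphB.
have conjM (u v : C) : (u * v)^*%C = u^*%C * v^*%C by rewrite -rmorphM.
have conjJ (u : C) : (u^*%C)^*%C = u by case: u => p q /=; rewrite opprK.
move=> /derivableP; set d := 'D_1 f _ => /is_deriveCP hd.
suff : is_derive z (1 : C) (fun w : C => (f (w^*%C))^*%C : C) (d^*%C) by [].
apply/is_deriveCP => e e0; have [r r0 h] := hd e e0; exists r => // w wr.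
have e1 : nrm (w^*%C - z^*%C) = nrm (w - z) by rewrite -conjB nrmJ.
have := h (w^*%C); rewrite e1 => /(_ wr); rewrite -[X in X <= _]nrmJ !conjB conjM conjB !conjJ.
exact.
Qed.

Variables ap am : R.
Local Notation gk := (gker ap am).

Lemma gkerB z w (t : C) : gk w t = cexp (2%:R * 'i%C * t * (w - z)) * gk z t.
Proof.
rewrite /gker mulrA -cexpD; congr (cexp _ * _); ring.
Qed.

(** The remainder of exp W after two terms is at most |W|^2 exp |W|, where
    W = 2 i t (w - z), and powers of |t| are absorbed by exp (rho |t|). *)
Lemma derivable_gker_integral (D : set R) (p : R -> C) (h : R -> R) (z : C) (rho : R) :
  measurable (D : set (measurableTypeR R)) -> 0 < rho ->
  (forall t, D t -> {for t, continuous p}) -> (forall t, D t -> regular ap am (p t)) ->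
  mu.-integrable D (EFin \o h) ->
  (forall t, D t -> nrm (gk z (p t)) * expR (4 * rho * nrm (p t)) <= h t) ->
  derivable (fun w => cintegral D (fun t => gk w (p t))) z 1.
Proof.
move=> mD rho0 cp rp ih hb.
have cg w (t : R) : D t -> {for t, continuous (fun t : R => gk w (p t))}.
  move=> Dt; apply: (@continuous_comp R C C p (gk w) t (cp t Dt)).
  by apply: derivable_continuousC; apply: derivable_gker => //; exact: rp.
have dom (f : R -> C) (k : R) : (forall t, D t -> {for t, continuous f}) ->
    (forall t, D t -> nrm (f t) <= k * h t) -> cintegrable D f.
  move=> cf fb; have ih2 : mu.-integrable D (EFin \o (fun t => k * h t)).
    exact: eq_integrable (integrableZl mD k ih).
  apply: (cintegrable_dominated mD _ _ ih2 fb); apply: subspace_continuous_measurable_fun => //;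
    apply: continuous_in_subspaceT => t /set_mem /= Dt.
    by have [] := continuous_ReIm (cf t Dt).
  by have [] := continuous_ReIm (cf t Dt).
have n2 t (w : C) : nrm (2%:R * 'i%C * p t * (w - z)) = 2 * nrm (p t) * nrm (w - z).
  by rewrite nrmM [nrm (_ * p t)]nrmM [nrm (2%:R * _)]nrmM nrm_nat nrm_i mulr1.
have up t : nrm (p t) <= rho^-1 * expR (rho * nrm (p t)).
  rewrite ler_pdivlMl //; apply: le_trans (expR_ge1Dx _).
  by rewrite lerDr.
have u0 t : 0 <= nrm (p t) by exact: nrm_ge0.
have gb t (k : R) : D t -> k <= 4 -> nrm (gk z (p t)) * expR (k * rho * nrm (p t)) <= h t.
  move=> Dt k4; apply: le_trans (hb t Dt); apply: ler_wpM2l; first exact: nrm_ge0.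
  by rewrite ler_expR ler_wpM2r // ler_wpM2r // ltW.
pose F1 t := 2%:R * 'i%C * p t * gk z (p t).
apply: (@derivable_cintegral D (fun w t => gk w (p t)) F1 (fun t => 8 / rho ^+ 2 * h t) z rho) => //.
- move=> w wr; apply: (dom _ 1); first by move=> t Dt; exact: cg.
  move=> t Dt; rewrite mul1r (gkerB z) nrmM mulrC.
  apply: le_trans (gb t 2 Dt _); last by lra.
  apply: ler_wpM2l; first exact: nrm_ge0.
  apply: nrm_cexp_le; rewrite n2 mulrAC; apply: ler_wpM2r => //.
  by rewrite ler_wpM2l // ltW.
- apply: (dom _ (2 / rho)).
    move=> t Dt; apply: (@continuousM R[i] R (fun t => 2%:R * 'i%C * p t)); last exact: cg.
    apply: (@continuousM R[i] R (fun=> 2%:R * 'i%C)); last exact: cp.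
    exact: cvg_cst.
  move=> t Dt; rewrite /F1 nrmM [nrm (_ * p t)]nrmM [nrm (2%:R * _)]nrmM nrm_nat nrm_i mulr1.
  have -> : 2 * nrm (p t) * nrm (gk z (p t)) = 2 * (nrm (gk z (p t)) * nrm (p t)) by ring.
  rewrite -mulrA; apply: ler_wpM2l => //.
  apply: (@le_trans _ _ (nrm (gk z (p t)) * (rho^-1 * expR (rho * nrm (p t))))).
    by rewrite ler_wpM2l ?nrm_ge0.
  rewrite mulrCA; apply: ler_wpM2l; first by rewrite invr_ge0 ltW.
  by have := gb t 1 Dt; rewrite mul1r; apply; lra.
- exact: eq_integrable (integrableZl mD (8 / rho ^+ 2) ih).
- move=> w t wr Dt; rewrite (gkerB z w) /F1.
  set W := 2%:R * 'i%C * p t * (w - z).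
  have -> : cexp W * gk z (p t) - gk z (p t) - (w - z) * (2%:R * 'i%C * p t * gk z (p t)) =
     gk z (p t) * exp_rest 2 W.
    by rewrite /= expr0 expr1 !divr1 /W; ring.
  rewrite nrmM; apply: (@le_trans _ _ (nrm (gk z (p t)) *
    ((2 * nrm (p t) * nrm (w - z)) ^+ 2 * expR (2 * nrm (p t) * rho)))).
    apply: ler_wpM2l; first exact: nrm_ge0.
    apply: le_trans (exp_rest_le 2 W) _; rewrite {}/W n2; apply: ler_wpM2l; first exact: sqr_ge0.
    by rewrite ler_expR ler_wpM2l ?mulr_ge0 // ltW.
  have u2 : nrm (p t) ^+ 2 <= 2 / rho ^+ 2 * expR (rho * nrm (p t)).
    have := @expR_ge_sqr R (rho * nrm (p t)) (mulr_ge0 (ltW rho0) (u0 t)).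
    by rewrite -[2 / _]invf_div ler_pdivlMl ?divr_gt0 ?exprn_gt0 // exprMn mulrAC.
  have -> : nrm (gk z (p t)) * ((2 * nrm (p t) * nrm (w - z)) ^+ 2 * expR (2 * nrm (p t) * rho)) =
     nrm (w - z) ^+ 2 * (4 * (nrm (gk z (p t)) * expR (2 * nrm (p t) * rho) * nrm (p t) ^+ 2)).
    by ring.
  apply: ler_wpM2l; first exact: sqr_ge0.
  apply: (@le_trans _ _ (4 * (nrm (gk z (p t)) * expR (2 * nrm (p t) * rho) *
      (2 / rho ^+ 2 * expR (rho * nrm (p t)))))).
    by rewrite ler_wpM2l // ler_wpM2l // mulr_ge0 ?nrm_ge0 ?expR_ge0.
  have -> : 4 * (nrm (gk z (p t)) * expR (2 * nrm (p t) * rho) *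
      (2 / rho ^+ 2 * expR (rho * nrm (p t)))) =
     8 / rho ^+ 2 * (nrm (gk z (p t)) * (expR (2 * nrm (p t) * rho) * expR (rho * nrm (p t)))).
    by ring.
  rewrite -expRD; apply: ler_wpM2l; first by rewrite divr_ge0 // sqr_ge0.
  have -> : 2 * nrm (p t) * rho + rho * nrm (p t) = 3 * rho * nrm (p t) by ring.
  by apply: gb => //; lra.
Qed.

End Holomorphy.

(** * The closed form in the right half-plane *)

Section RightHalfPlane.
Variable R : realType.
Local Notation C := (R[i]^o).
Local Notation mu := (@lebesgue_measure R).
Variables ap am : R.
Hypotheses (hap : 0 < ap) (ham : 0 < am) (hlt : am <= ap / 2).
Local Notation gk := (gker ap am).
Local Notation b := (quarter ap).
Local Notation b0 := (quarter_gt0 hap).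

Lemma regular_top (x : R) : - b <= x <= b -> regular ap am (x +i* (3 * b)).
Proof.
have h := b0.
move=> hx; apply: regular_square => //; first by apply/andP; split; lra.
by apply/eqP => /(congr1 (@complex.Im R)) /= e; lra.
Qed.

Lemma derivable_ray (z : C) : 0 < complex.Re z ->
  derivable (fun w => ray ap am w (3 * b)) z 1.
Proof.
move=> z0; rewrite /ray; apply: (@derivableCM R (fun=> 'i%C)); first exact: derivableC_cst.
set c := complex.Re z in z0 *; set M := 4 / (ap * am * b ^+ 3) * expR (2 * b * `|complex.Im z|).
have M0 : 0 <= M.
  by rewrite mulr_ge0 ?expR_ge0 // divr_ge0 // ltW // mulr_gt0 ?exprn_gt0 ?b0 // mulr_gt0.
have c8 : 0 < c / 8 by rewrite divr_gt0.
have k0 : 0 < 3 / 2 * c by rewrite mulr_gt0.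
have mD : measurable (`[3 * b, +oo[%classic : set (measurableTypeR R)) by exact: measurable_itv.
have [i1 _] := integral_expR_tail (3 * b) k0.
apply: (@derivable_gker_integral R ap am `[3 * b, +oo[ (fun y => b +i* y)
  (fun y => M * expR (c / 2 * b) * expR (- (3 / 2 * c * y))) z (c / 8)) => //.
- by move=> y _; apply: (@continuous_v R (fun w => w)); exact: cvg_id.
- by move=> y _; apply: regular_re => //; rewrite gt_eqF ?b0.
- exact: eq_integrable (integrableZl mD (M * expR (c / 2 * b)) i1).
- move=> y; rewrite /= in_itv /= andbT => y3.
  have y0 : 0 <= y by have := b0; lra.
  have nb : nrm (b +i* y : C) <= b + y.
    by apply: le_trans (nrm_le _) _; rewrite /= !ger0_norm // ltW ?b0.
  apply: (@le_trans _ _ (M * expR (- (2 * c * y)) * expR (c / 2 * (b + y)))).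
    apply: ler_pM; rewrite ?nrm_ge0 ?expR_ge0 //; first exact: nrm_gker_ray.
    have -> : 4 * (c / 8) = c / 2 by field.
    by rewrite ler_expR ler_wpM2l // divr_ge0 // ltW.
  rewrite -mulrA -expRD -[leRHS]mulrA -expRD; apply: ler_wpM2l => //.
  by rewrite ler_expR; lra.
Qed.

Lemma derivable_hint_top (z : C) : derivable (fun w => hint (gk w) (3 * b) (- b) b) z 1.
Proof.
rewrite /hint.
have mD : measurable (`[- b, b]%classic : set (measurableTypeR R)) by exact: measurable_itv.
have cp (x : R) : {for x, continuous (fun x : R => x +i* (3 * b) : C)}.
  by apply: (@continuous_h R (fun w => w)); exact: cvg_id.
apply: (@derivable_gker_integral R ap am `[- b, b] (fun x => x +i* (3 * b))
  (fun x => nrm (gk z (x +i* (3 * b))) * expR (4 * 1 * nrm (x +i* (3 * b) : C))) z 1) => //.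
  by move=> x; rewrite /= in_itv /=; exact: regular_top.
apply: continuous_compact_integrable; first exact: segment_compact.
apply: continuous_in_subspaceT => x /set_mem /=; rewrite in_itv /= => hx.
apply: (@continuousM R R (fun x => nrm (gk z (x +i* (3 * b)))) (fun x => expR (4 * 1 * nrm (x +i* (3 * b) : C)))).
  apply: (@continuous_comp R C R (fun x => gk z (x +i* (3 * b))) (@nrm R)); last exact: continuous_nrm.
  apply: (@continuous_comp R C C (fun x : R => x +i* (3 * b)) (gk z)); first exact: cp.
  by apply: derivable_continuousC; apply: derivable_gker => //; exact: regular_top.
apply: (@continuous_comp R R R (fun x => 4 * 1 * nrm (x +i* (3 * b) : C)) (@expR R)); last exact: continuous_expR.
apply: (@continuousM R R (fun=> 4 * 1)); first exact: cvg_cst.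
apply: (@continuous_comp R C R (fun x : R => x +i* (3 * b)) (@nrm R)); first exact: cp.
exact: continuous_nrm.
Qed.

Lemma derivable_staple (z : C) : 0 < complex.Re z ->
  derivable (fun w => staple ap am w (3 * b)) z 1.
Proof.
move=> z0; rewrite /staple.
apply: (@derivableCD R (fun w => ray ap am w (3 * b) - (ray ap am (w^*%C) (3 * b))^*%C)); last first.
  exact: derivable_hint_top.
apply: (@derivableCB R (fun w => ray ap am w (3 * b))); first exact: derivable_ray.
apply: (@derivableC_conj R (fun w => ray ap am w (3 * b))); apply: derivable_ray.
by rewrite Re_conj.
Qed.

Definition right_formula (z : C) : C :=
  cexp (- ((2 * pi / ap)%:C * z)) / (2 * sin (pi * am / ap))%:C +
  (4%:R * 'i%C)^-1 * staple ap am z (3 * b).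

Lemma derivable_right_formula (z : C) : 0 < complex.Re z -> derivable right_formula z 1.
Proof.
move=> z0; rewrite /right_formula.
apply: (@derivableCD R (fun z => cexp (- ((2 * pi / ap)%:C * z)) / (2 * sin (pi * am / ap))%:C)).
  apply: (@derivableCM R (fun z => cexp (- ((2 * pi / ap)%:C * z)))); last exact: derivableC_cst.
  apply: (@derivable_compC R (@cexp R) (fun z => - ((2 * pi / ap)%:C * z))); last exact: derivable_cexp.
  apply: derivableCN; apply: (@derivableCM R (fun=> (2 * pi / ap)%:C)); first exact: derivableC_cst.
  exact: derivableC_id.
apply: (@derivableCM R (fun=> (4%:R * 'i%C)^-1)); first exact: derivableC_cst.
exact: derivable_staple.
Qed.

(** A disc centred far out on the positive real axis contains z; in the square
    around it the two sides are holomorphic, and near its centre, which lies in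
    the strip, they agree. *)
Lemma g_R_right_formula (g : C -> C) (z : C) : is_g ap am g -> 0 < complex.Re z ->
  g_R ap am g z = right_formula z.
Proof.
move=> [gs gh] z0.
(* N is large enough for |z - N| < N, that is |z|^2 < 2 N Re z. *)
pose N := nrm z ^+ 2 / complex.Re z + 1.
have N0 : 0 < N by rewrite ltr_wpDl // divr_ge0 ?sqr_ge0 // ltW.
pose h w := g_R ap am g w - right_formula w.
have zN : nrm (z - N%:C) < N.
  rewrite -(@ltr_pXn2r _ 2) ?nnegrE ?nrm_ge0 ?ltW // sqr_nrm.
  have -> : complex.Re (z - N%:C) = complex.Re z - N by case: (z).
  have -> : complex.Im (z - N%:C) = complex.Im z by case: (z) => p q /=; rewrite oppr0 addr0.
  have : complex.Re z * N = nrm z ^+ 2 + complex.Re z by rewrite /N mulrDr mulr1; congr (_ + _); field; rewrite gt_eqF.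
  rewrite sqr_nrm.
  have : 0 <= complex.Im z ^+ 2 by exact: sqr_ge0.
  have := sqr_ge0 (complex.Re z).
  rewrite -subr_gt0 => h1 h2 h3.
  have -> : N ^+ 2 - ((complex.Re z - N) ^+ 2 + complex.Im z ^+ 2) =
     2 * (complex.Re z * N) - complex.Re z ^+ 2 - complex.Im z ^+ 2 by ring.
  lra.
pose L := (nrm (z - N%:C) + N) / 2.
have n0 := nrm_ge0 (z - N%:C).
have zL : nrm (z - N%:C) < L by rewrite /L; lra.
have LN : L < N by rewrite /L; lra.
have L0 : 0 < L by apply: le_lt_trans zL.
have a0 : 0 < a_ ap am by rewrite /a_ divr_gt0 // addr_gt0.
have rho0 : 0 < Num.min N (a_ ap am) by rewrite lt_min N0.
apply/eqP; rewrite -subr_eq0; apply/eqP; rewrite -/(h z).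
apply: (@vanishing_near R h N%:C L (Num.min N (a_ ap am)) L0 rho0 _ _ z zL).
- move=> x y /= /andP[hx _] _; have x0 : 0 < x by lra.
  apply: (@derivableCB R (g_R ap am g)); last exact: derivable_right_formula.
  apply: (@derivableCD R (fun w => g w + (chi_ ap am)%:C)).
    apply: (@derivableCD R g); last exact: derivableC_cst.
    by apply: gh => -[/= e _]; rewrite e ltxx in x0.
  apply: (@derivableCM R (fun w => (alpha_ ap am)%:C * w ^+ 2)); last exact: derivableC_cst.
  apply: (@derivableCM R (fun=> (alpha_ ap am)%:C)); first exact: derivableC_cst.
  exact/derivableCX/derivableC_id.
- move=> w; rewrite lt_min => /andP[wN wa].
  have w0 : 0 < complex.Re w.
    have := le_lt_trans (ler_Re_nrm _) wN; have -> : complex.Re (w - N%:C) = complex.Re w - N by case: (w).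
    by rewrite ltr_norml; lra.
  have wi : `|complex.Im w| < a_ ap am.
    have := le_lt_trans (ler_Im_nrm _) wa.
    by have -> : complex.Im (w - N%:C) = complex.Im w by case: (w) => p q /=; rewrite oppr0 addr0.
  by rewrite /h /g_R gs // strip_formula // subrr.
Qed.

End RightHalfPlane.

(** * The limit of the closed form *)

Section Asymptotics.
Variable R : realType.
Local Notation C := (R[i]^o).
Implicit Types (x y e lam : R) (z w : C).

Lemma sin_small e : 0 < e -> exists2 r : R, 0 < r &
  forall x, 0 < x < r -> `|sin x - x| <= e * x.
Proof.
move=> e0; have ds : is_derive (0 : R) (1 : R) (@sin R) (1 : R).
  by apply: (is_derive_eq (is_derive_sin (0 : R))); exact: cos0.
have [r r0 h] := is_derive_littleo ds e0; exists r => // x /andP[x0 xr].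
have xn : `|x| = x by rewrite ger0_norm // ltW.
by have := h x; rewrite xn addr0 sin0 subr0 mul1r; exact.
Qed.

(** The limit of the coefficient am^lam / (2 sin (pi am / ap)) of the leading
    exponential. *)
Definition lead (lam : R) (ap : R) : R := if lam == 1 then ap / (2 * pi) else 0.

(** sin x is within e1 x of x; for lam > 1 there remains a factor
    am^(lam - 1). *)
Lemma lead_limit ap lam e : 0 < ap -> 1 <= lam -> 0 < e -> exists2 d : R, 0 < d &
  forall am, 0 < am < d ->
    `|expR (lam * ln am) / (2 * sin (pi * am / ap)) - lead lam ap| <= e.
Proof.
move=> hap hlam e0; pose q := pi / ap.
have q0 : 0 < q by rewrite divr_gt0 ?pi_gt0.
pose e1 := Num.min (1 / 2) (e * q).
have e10 : 0 < e1 by rewrite lt_min divr_gt0 // mulr_gt0.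
have [r r0 hr] := sin_small e10.
have half : e1 <= 1 / 2 by rewrite ge_min lexx.
have eq1 : e1 <= e * q by rewrite ge_min lexx orbT.
have key am : 0 < am < r / q -> `|sin (q * am) - q * am| <= e1 * (q * am) /\
    q * am / 2 <= sin (q * am).
  move=> /andP[a0 ar]; have h : `|sin (q * am) - q * am| <= e1 * (q * am).
    by apply: hr; rewrite mulr_gt0 //= mulrC -ltr_pdivlMr.
  split=> //; have h2 : e1 * (q * am) <= 1 / 2 * (q * am) by rewrite ler_wpM2r // mulr_ge0 // ltW.
  by have := le_trans h h2; rewrite ler_norml; lra.
have qE am : pi * am / ap = q * am by rewrite /q mulrAC.
rewrite /lead; case: eqVneq => [->|l1].
  exists (r / q); first by rewrite divr_gt0.
  move=> am har; have /andP[a0 _] := har; have [k1 k2] := key am har.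
  rewrite mul1r lnK ?posrE // qE.
  have qa : 0 < q * am by rewrite mulr_gt0.
  have s0 : 0 < sin (q * am) by apply: lt_le_trans k2; rewrite divr_gt0.
  have -> : ap / (2 * pi) = (2 * q)^-1.
    by rewrite /q; move: (pi : R) (pi_gt0 R) => P P0; field; rewrite !gt_eqF.
  have -> : am / (2 * sin (q * am)) - (2 * q)^-1 = - (sin (q * am) - q * am) / (2 * q * sin (q * am)).
    by field; rewrite !gt_eqF.
  have q2 : 0 < 2 * q by rewrite mulr_gt0.
  have D0 : 0 < 2 * q * sin (q * am) by rewrite mulr_gt0.
  rewrite normrM normrN normfV (gtr0_norm D0) (ler_pdivrMr _ _ D0); apply: le_trans k1 _.
  have h1 : e1 * (q * am) <= e * q * (q * am) by rewrite ler_wpM2r // ltW.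
  have h2 : e * q * (q * am) <= e * q * (2 * sin (q * am)).
    have k3 : q * am <= 2 * sin (q * am) by lra.
    by have eq0 : 0 <= e * q; [exact/ltW/mulr_gt0|exact: ler_wpM2l].
  by apply: le_trans h1 (le_trans h2 _); rewrite le_eqVlt; apply/orP; left; apply/eqP; ring.
have l0 : 0 < lam - 1 by rewrite subr_gt0 lt_def l1.
exists (Num.min (r / q) (expR (ln (e * q) / (lam - 1)))).
  by rewrite lt_min expR_gt0 divr_gt0.
move=> am; rewrite lt_min => /andP[a0 /andP[ar ae]].
have [|_ k2] := key am; first by rewrite a0.
have qa : 0 < q * am by rewrite mulr_gt0.
have s0 : 0 < sin (q * am) by apply: lt_le_trans k2; rewrite divr_gt0.
rewrite subr0 qE ger0_norm; last by rewrite divr_ge0 ?expR_ge0 // mulr_ge0 // ltW.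
rewrite ler_pdivrMr ?mulr_gt0 //.
have -> : lam * ln am = (lam - 1) * ln am + ln am by ring.
rewrite expRD lnK ?posrE //.
have h : expR ((lam - 1) * ln am) <= e * q.
  have q1 : 0 < e * q by exact: mulr_gt0.
  have -> : e * q = expR (ln (e * q)) by rewrite lnK ?posrE.
  rewrite ler_expR mulrC -ler_pdivlMr //.
  by rewrite -[leRHS]expRK ler_ln ?posrE ?expR_gt0 // ltW.
apply: (@le_trans _ _ (e * q * am)); first by rewrite ler_wpM2r // ltW.
by rewrite -mulrA ler_wpM2l //; [exact: ltW|lra].
Qed.

Variable ap : R.
Hypothesis hap : 0 < ap.
Local Notation b := (quarter ap).
Local Notation b0 := (quarter_gt0 hap).

Section Bounds.
Variable am : R.
Hypotheses (ham : 0 < am) (hlt : am <= ap / 2).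
Local Notation gk := (gker ap am).

(** The height 3 pi / (2 ap) lies half-way between two zeros of sinh (ap t),
    which has modulus at least 1 there. *)
Lemma nrm_gker_top z x : - b <= x <= b -> 3 * b * am / 2 <= sin (3 * b * am) ->
  nrm (gk z (x +i* (3 * b))) <=
  2 / (9 * b ^+ 2 * am) * (expR (- (6 * b * complex.Re z)) * expR (2 * b * `|complex.Im z|)).
Proof.
move=> hx hs; have bp := b0.
have h1 : 1 <= nrm (csinh ((ap * x) +i* (ap * (3 * b)))).
  apply: le_trans (nrm_csinh_ge_im _ _).
  have -> : ap * (3 * b) = pi / 2 + pi.
    by rewrite mulrCA mul_quarter //; field.
  by rewrite sinDpi sin_pihalf normrN normr1.
have h2 : 3 * b * am / 2 <= nrm (csinh ((am * x) +i* (am * (3 * b)))).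
  apply: le_trans (nrm_csinh_ge_im _ _); apply: le_trans (ler_norm _).
  by rewrite [am * _]mulrC.
have h3 : 3 * b <= nrm (x +i* (3 * b) : C).
  by apply: le_trans (ler_Im_nrm _); rewrite /= ler_norm.
rewrite nrmM mulrC; apply: ler_pM; rewrite ?nrm_ge0 //.
  rewrite /kern nrmV nrmM nrmM !scaleCc -[2 / _]invf_div lef_pV2; first last.
  - by rewrite posrE divr_gt0 // mulr_gt0 // mulr_gt0 // exprn_gt0.
  - rewrite posrE; apply: mulr_gt0; first by apply: lt_le_trans h3; rewrite mulr_gt0.
    apply: mulr_gt0; first exact: lt_le_trans h1.
    by apply: lt_le_trans h2; rewrite divr_gt0 // mulr_gt0 // mulr_gt0.
  apply: (@le_trans _ _ (3 * b * (1 * (3 * b * am / 2)))).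
    by rewrite le_eqVlt; apply/orP; left; apply/eqP; field.
  have p0 : 0 <= 3 * b by rewrite mulr_ge0 // ltW.
  have p1 : 0 <= 3 * b * am / 2 by rewrite divr_ge0 // mulr_ge0 // ltW.
  apply: ler_pM => //; first by rewrite mul1r.
  by apply: ler_pM.
rewrite nrm_expZ -expRD ler_expR.
have /andP[hx1 hx2] := hx.
have : `|x * complex.Im z| <= b * `|complex.Im z|.
  by rewrite normrM ler_wpM2r // ler_norml hx1.
rewrite ler_norml => /andP[h4 h5]; lra.
Qed.

Lemma nrm_staple_le z : 1 <= complex.Re z -> 3 * b * am / 2 <= sin (3 * b * am) ->
  nrm (staple ap am z (3 * b)) <= (4 / (ap * b ^+ 3) + 4 / (9 * b)) *
    expR (2 * b * `|complex.Im z|) * (expR (- (6 * b * complex.Re z)) / am).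
Proof.
move=> z1 hs; have bp := b0; have z0 : 0 < complex.Re z by lra.
have z0' : 0 < complex.Re (z^*%C) by rewrite Re_conj.
have [_ r1] := @ray_integrable R ap am hap ham z (3 * b) z0.
have [_ r2] := @ray_integrable R ap am hap ham (z^*%C) (3 * b) z0'.
rewrite Re_conj Im_conj normrN in r2.
set E := expR (2 * b * _) in r1 r2 *; set X := expR (- (6 * b * complex.Re z)).
have E0 : 0 <= E by exact: expR_ge0.
have X0 : 0 <= X by exact: expR_ge0.
have XE : expR (- (2 * complex.Re z * (3 * b))) = X by congr expR; ring.
have rb : 4 / (ap * am * b ^+ 3) * E * X / (2 * complex.Re z) <= 2 / (ap * b ^+ 3) * E * (X / am).
  have -> : 2 / (ap * b ^+ 3) * E * (X / am) = 4 / (ap * am * b ^+ 3) * E * X / 2.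
    by field; rewrite !gt_eqF.
  apply: ler_wpM2l.
    apply: mulr_ge0 => //; apply: mulr_ge0 => //; rewrite divr_ge0 // ltW //.
    by rewrite mulr_gt0 ?exprn_gt0 // mulr_gt0.
  by rewrite lef_pV2 ?posrE ?mulr_gt0 // ler_peMr.
have hh : nrm (hint (gk z) (3 * b) (- b) b) <= 2 / (9 * b ^+ 2 * am) * (X * E) * (b - - b).
  apply: cintegral_nrm_le_segment; first exact: quarter_sym.
    move=> x; rewrite in_itv /= => hx; apply: continuous_h; apply: derivable_continuousC.
    by apply: derivable_gker => //; exact: regular_top.
  by move=> x; rewrite in_itv /= => hx; exact: nrm_gker_top.
rewrite XE in r1 r2.
rewrite /staple; apply: le_trans (nrmD _ _) _.
apply: le_trans (lerD (nrmB _ _) hh) _; rewrite nrmJ.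
apply: (@le_trans _ _ (2 / (ap * b ^+ 3) * E * (X / am) + 2 / (ap * b ^+ 3) * E * (X / am) +
  2 / (9 * b ^+ 2 * am) * (X * E) * (b - - b))).
  by rewrite lerD2r; apply: lerD; [exact: le_trans rb|exact: le_trans rb].
by rewrite le_eqVlt; apply/orP; left; apply/eqP; field; rewrite !gt_eqF.
Qed.

End Bounds.

Variable lam : R.
Hypothesis hlam : 1 <= lam.

Definition right_limit z : C := (lead lam ap)%:C * cexp (- ((2 * pi / ap)%:C * z)).

(** As 6 b s = (3 / 2) ln (1 / am), the contour term is at most c2 times the
    square root of am. *)
Lemma right_formula_limit (B e : R) : 0 < e -> exists2 d : R, 0 < d &
  forall am z, 0 < am < d -> nrm z <= B ->
    [/\ am <= ap / 2, 0 < complex.Re (z + (lam * s_ ap am)%:C) &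
     nrm (right_formula ap am (z + (lam * s_ ap am)%:C) - right_limit z) < e].
Proof.
move=> e0; have bp := b0.
pose k := 2 * pi / ap; have k0 : 0 < k by rewrite divr_gt0 // mulr_gt0 // pi_gt0.
pose c1 := expR (k * B); have c10 : 0 < c1 by exact: expR_gt0.
pose c2 := (4 / (ap * b ^+ 3) + 4 / (9 * b)) * expR (2 * b * B) * expR (6 * b * B).
have c20 : 0 < c2.
  rewrite /c2 !mulr_gt0 ?expR_gt0 // addr_gt0 // divr_gt0 // mulr_gt0 // exprn_gt0 //.
have ec1 : 0 < e / (3 * c1) by rewrite divr_gt0 // mulr_gt0.
have [d1 d10 hd1] := lead_limit hap hlam ec1.
have [r r0 hr] := @sin_small (1 / 2) ltac:(lra).
(* The last two bounds make Re w >= 1 and c2 (am)^(1/2) < e. *)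
pose d := Num.min (Num.min d1 (r / (3 * b))) (Num.min (ap / 2)
  (Num.min (expR (- (k * (B + 1)))) ((e / c2) ^+ 2))).
have d0 : 0 < d.
  have h1 : 0 < r / (3 * b) by rewrite divr_gt0 // mulr_gt0.
  have h2 : 0 < (e / c2) ^+ 2 by rewrite exprn_gt0 // divr_gt0.
  by rewrite /d !lt_min d10 expR_gt0 h1 h2 divr_gt0.
exists d => // am z /andP[a0]; rewrite /d !lt_min => /andP[/andP[ad1 ar] /andP[ah /andP[ak ae]]] zB.
set L := ln am.
have Lk : L <= - (k * (B + 1)).
  by rewrite -[leRHS]expRK ler_ln ?posrE ?expR_gt0 // ltW.
have sE : s_ ap am = - L / k.
  rewrite /s_ div1r lnV ?posrE // -/L /k; move: (pi : R) (pi_gt0 R) => P P0.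
  by field; rewrite !gt_eqF.
have B0 : 0 <= B by exact: le_trans (nrm_ge0 _) zB.
have sB : B + 1 <= s_ ap am.
  by rewrite sE ler_pdivlMr // mulrC; lra.
have sl : s_ ap am <= lam * s_ ap am by rewrite ler_peMl //; lra.
set w := z + (lam * s_ ap am)%:C.
have wR : complex.Re w = complex.Re z + lam * s_ ap am by rewrite /w; case: (z).
have wI : complex.Im w = complex.Im z by rewrite /w; case: (z) => p q /=; rewrite addr0.
have zR : - B <= complex.Re z <= B by rewrite -ler_norml; apply: le_trans (ler_Re_nrm _) zB.
have zI : `|complex.Im z| <= B by apply: le_trans (ler_Im_nrm _) zB.
have w1 : 1 <= complex.Re w by rewrite wR; have /andP[] := zR; lra.
have alt : am <= ap / 2 by exact: ltW.
split; [exact: alt|by rewrite -/w; lra|].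
have hs : 3 * b * am / 2 <= sin (3 * b * am).
  have : `|sin (3 * b * am) - 3 * b * am| <= 1 / 2 * (3 * b * am).
    have b3 : 0 < 3 * b by rewrite mulr_gt0.
    by apply: hr; rewrite (mulr_gt0 b3 a0) /= mulrC -ltr_pdivlMr.
  by rewrite ler_norml; lra.
have := nrm_staple_le a0 alt w1 hs; rewrite wI => st.
have {}st : nrm (staple ap am w (3 * b)) <= c2 * expR (L / 2).
  apply: le_trans st _; rewrite /c2; set D := 4 / _ + _.
  have D0 : 0 <= D by rewrite addr_ge0 // divr_ge0 // mulr_ge0 ?exprn_ge0 // ltW.
  have b20 : 0 <= 2 * b by rewrite mulr_ge0 // ltW.
  rewrite -[leRHS]mulrA; apply: ler_pM.
  - exact: mulr_ge0 D0 (expR_ge0 _).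
  - by rewrite divr_ge0 ?expR_ge0 // ltW.
  - by apply: ler_wpM2l => //; rewrite ler_expR; exact: ler_wpM2l.
  rewrite -[X in _ / X](@lnK R) ?posrE // -/L -expRN -!expRD ler_expR.
  have e6 : 6 * b * s_ ap am = - (3 / 2 * L).
    by rewrite sE /k /quarter; move: (pi : R) (pi_gt0 R) => P P0; field; rewrite !gt_eqF.
  have h1 : 6 * b * s_ ap am <= 6 * b * (lam * s_ ap am).
    by rewrite ler_wpM2l // mulr_ge0 // ltW.
  have h2 : 6 * b * - B <= 6 * b * complex.Re z.
    by have b60 : 0 <= 6 * b; [rewrite mulr_ge0 // ltW|apply: ler_wpM2l => //; have /andP[] := zR].
  by rewrite wR mulrDr; lra.
have eL : c2 * expR (L / 2) < e.
  rewrite mulrC -ltr_pdivlMr // -(@ltr_pXn2r _ 2) ?nnegrE ?expR_ge0 ?divr_ge0 ?ltW //.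
  rewrite expr2 -expRD; have -> : L / 2 + L / 2 = L by field.
  by rewrite lnK ?posrE.
have main : cexp (- (k%:C * w)) = (expR (lam * L))%:C * cexp (- (k%:C * z)).
  have -> : (expR (lam * L))%:C = cexp (lam * L)%:C :> C.
    by rewrite /cexp /= sin0 cos0 -[1 +i* 0]/(1 : C) mulr1.
  rewrite -cexpD; congr cexp; rewrite /w mulrDr opprD addrC; congr (_ + _).
  rewrite -rmorphM -rmorphN; congr (_%:C); rewrite sE; field; rewrite !gt_eqF //.
have E1 : nrm (cexp (- (k%:C * z))) <= c1.
  rewrite nrm_cexp ler_expR.
  have -> : complex.Re (- (k%:C * z)) = k * - complex.Re z by case: (z) => p q /=; ring.
  by apply: (ler_wpM2l (ltW k0)); have /andP[zR1 zR2] := zR; lra.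
rewrite /right_formula /right_limit -/k main.
set E := cexp (- (k%:C * z)) in E1 *; set S := 2 * sin _.
have -> : (expR (lam * L))%:C * E / S%:C + (4%:R * 'i%C)^-1 * staple ap am w (3 * b) - (lead lam ap)%:C * E =
  (expR (lam * L) / S - lead lam ap)%:C * E + (4%:R * 'i%C)^-1 * staple ap am w (3 * b).
  by rewrite [(_ / S - _)%:C]rmorphB /= [(_ / S)%:C]rmorphM fmorphV /=; ring.
have n4 : nrm ((4%:R * 'i%C)^-1 : C) = 4^-1 by rewrite nrmV nrmM nrm_nat nrm_i mulr1.
apply: le_lt_trans (nrmD _ _) _.
rewrite [nrm (_ * E)]nrmM nrmR [nrm (_ * staple _ _ _ _)]nrmM n4.
have l1 : `|expR (lam * L) / S - lead lam ap| <= e / (3 * c1) by apply: hd1; rewrite a0.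
have : `|expR (lam * L) / S - lead lam ap| * nrm E <= e / (3 * c1) * c1.
  by apply: ler_pM => //; exact: nrm_ge0.
have -> : e / (3 * c1) * c1 = e / 3 by field; rewrite gt_eqF.
lra.
Qed.

End Asymptotics.

(** * Reflection in the origin *)

Section Reflection.
Variable R : realType.
Local Notation C := (R[i]^o).
Local Notation mu := (@lebesgue_measure R).
Implicit Types (z : C) (g : C -> C).

(** The real value of an infinite integral is 0, and so is that of the
    difference of two infinite ones. *)
Lemma RintegralN_total (D : set R) (f : R -> R) :
  \int[mu]_(t in D) (- f t) = - \int[mu]_(t in D) f t.
Proof.
rewrite /Rintegral integralE [in RHS]integralE.
have -> : (fun t => (- f t)%:E)%E = (\- (fun t => (f t)%:E))%E by apply/funext => t; rewrite EFinN.
rewrite funeposN funenegN.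
set A := (\int[mu]_(t in D) _)%E; set B := (\int[mu]_(t in D) _)%E.
by case: A B => [a| |] [c| |] //=; rewrite ?oppr0 // opprB.
Qed.

Lemma g_strip_opp (ap am : R) z : g_strip ap am (- z) = - g_strip ap am z.
Proof.
have opp t : g_integrand ap am (- z) t = - g_integrand ap am z t.
  rewrite /g_integrand -[RHS]mulrN; congr (_ * _); rewrite /csin.
  rewrite !mulrN opprK; set E := cexp _; set E' := cexp _.
  by ring.
rewrite /g_strip /cintegral -[RHS]/(_ +i* _); congr (_ +i* _).
  by rewrite -RintegralN_total; apply: eq_Rintegral => t _; rewrite opp; case: (g_integrand _ _ _ _).
by rewrite -RintegralN_total; apply: eq_Rintegral => t _; rewrite opp; case: (g_integrand _ _ _ _).
Qed.

Lemma is_g_opp (ap am : R) g : is_g ap am g -> is_g ap am (fun z => - g (- z)).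
Proof.
move=> [gs gh].
have Re_opp z : complex.Re (- z) = - complex.Re z by case: z.
have Im_opp z : complex.Im (- z) = - complex.Im z by case: z.
split.
  move=> z hz; rewrite gs; last by rewrite Im_opp normrN.
  by rewrite g_strip_opp opprK.
move=> z hz; apply: derivableCN; apply: (@derivable_compC R g (fun z => - z)).
  by apply: derivableCN; exact: derivableC_id.
apply: gh; rewrite /cut_plane /= Re_opp Im_opp normrN => -[e h]; apply: hz; split=> //.
by apply: oppr_inj; rewrite oppr0.
Qed.

(** The left limits for g are the right limits for z |-> - g (- z). *)
Lemma g_L_reflect (ap am : R) g z :
  g_L ap am g z = - g_R ap am (fun z => - g (- z)) (- z).
Proof. by rewrite /g_L /g_R opprK sqrrN; ring. Qed.

End Reflection.

(** * Uniform convergence on compact sets *)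

Section Convergence.
Variable R : realType.
Local Notation C := (R[i]^o).

Lemma compact_nrm_bounded (K : set C) : compact K -> exists B : R, forall z, K z -> nrm z <= B.
Proof.
move=> cK; have cn : compact (@nrm R @` K).
  by apply: continuous_compact => //; apply: continuous_in_subspaceT => z _; exact: continuous_nrm.
have [M [_ hM]] := compact_bounded cn.
have M1 : M < M + 1 by rewrite ltrDl.
exists (M + 1) => z Kz; have /= := hM (M + 1) M1 (nrm z).
by rewrite ger0_norm ?nrm_ge0 //; apply; exists z.
Qed.

Lemma uniform_cvg_right0 (K : set C) (f : R -> C -> C) (l : C -> C) :
  (forall e : R, 0 < e -> exists2 d : R, 0 < d &
    forall am z, 0 < am < d -> K z -> nrm (f am z - l z) < e) ->
  {uniform K, f am @[am --> (0 : R)^'+] --> l}.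
Proof.
move=> h P /uniform_nbhs[E [entE EP]].
have [e /= e0 eE] : exists2 e : R[i], 0 < e & (fun xy : C * C => `|xy.1 - xy.2| < e) `<=` E.
  by move: entE; rewrite -entourage_ballE => -[e /= e0 he]; exists e => // -[x y] /= xy; apply: he.
move: (e0); rewrite ltcE /= => /andP[/eqP ei er].
have [d d0 hd] := h _ er.
suff : \forall am \near (0 : R)^'+, P (f am) by [].
near=> am; apply: EP => z Kz; apply: eE => /=; rewrite distrC nrmE ltcE /= ei eqxx /=.
apply: hd Kz; apply/andP; split; near: am; first exact: nbhs_right_gt.
exact: nbhs_right_lt.
Unshelve. all: end_near. Qed.

Lemma g_R_limit (g : R -> R -> C -> C) (ap lam B e : R) :
  (forall am : R, 0 < am -> is_g ap am (g ap am)) ->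
  0 < ap -> 1 <= lam -> 0 < e -> exists2 d : R, 0 < d &
  forall am z, 0 < am < d -> nrm z <= B ->
    nrm (g_R ap am (g ap am) (z + (lam * s_ ap am)%:C) - right_limit ap lam z) < e.
Proof.
move=> hg hap hlam e0; have [d d0 hd] := right_formula_limit hap hlam B e0.
exists d => // am z had zB; have [h1 h2 h3] := hd am z had zB; have /andP[a0 _] := had.
by rewrite (g_R_right_formula hap a0 h1 (hg am a0) h2).
Qed.

Lemma right_limitE (ap lam : R) (z : C) : right_limit ap lam z =
  if lam == 1 then (ap / (2 * pi))%:C * cexp (- ((2 * pi / ap)%:C * z)) else 0.
Proof. by rewrite /right_limit /lead; case: ifP => // _; rewrite mul0r. Qed.

End Convergence.

Theorem mainTheorem7 (R : realType)
    (g : R -> R -> R[i]^o -> R[i]^o)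
    (hg : forall ap am : R, 0 < ap -> 0 < am -> is_g ap am (g ap am))
    (ap : R) (hap : 0 < ap) (lam : R) (hlam : 1 <= lam)
    (K : set R[i]^o) (hK : compact K) :
  {uniform K,
    (fun z : R[i]^o => g_R ap am (g ap am) (z + (lam * s_ ap am)%:C) : R[i]^o)
      @[am --> (0 : R)^'+] -->
    (fun z : R[i]^o =>
       if lam == 1 then
         (ap / (2 * pi))%:C * cexp (- ((2 * pi / ap)%:C * z)) : R[i]^o
       else 0)} /\
  {uniform K,
    (fun z : R[i]^o => g_L ap am (g ap am) (z - (lam * s_ ap am)%:C) : R[i]^o)
      @[am --> (0 : R)^'+] -->
    (fun z : R[i]^o =>
       if lam == 1 then
         - ((ap / (2 * pi))%:C * cexp ((2 * pi / ap)%:C * z)) : R[i]^o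
       else 0)}.
Proof.
have [B hB] := compact_nrm_bounded hK.
split; apply: uniform_cvg_right0 => e e0.
  have [d d0 hd] := g_R_limit B (fun am => hg ap am hap) hap hlam e0.
  by exists d => // am z had Kz; rewrite -right_limitE; apply: hd => //; exact: hB.
pose g' (ap am : R) (z : R[i]^o) : R[i]^o := - g ap am (- z).
have hg' (am : R) : 0 < am -> is_g ap am (g' ap am).
  by move=> a0; apply: is_g_opp; exact: hg.
have [d d0 hd] := g_R_limit B hg' hap hlam e0.
exists d => // am z had Kz.
have zB : nrm (- z) <= B by rewrite nrmN; exact: hB.
have -> : (if lam == 1 then - ((ap / (2 * pi))%:C * cexp ((2 * pi / ap)%:C * z)) else 0) =
    - right_limit ap lam (- z).
  by rewrite right_limitE mulrN opprK; case: ifP => // _; rewrite oppr0.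
rewrite g_L_reflect opprB [_ - z]addrC -opprD nrmN; exact: hd.
Qed.
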